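(* Let $E\subset\mathbb{R}^N$ be open, $p>1$ and $\gamma>0$. (i) Let $\varphi:(a,+\infty)\to\mathbb{R}$, for some $a<\infty$, be convex, non-increasing, and such that $$\lim_{t\to+\infty}\varphi(t)=\lim_{t\to+\infty}t\varphi'(t)=0,$$ and let $u\in[DG]_p^-(E;\gamma)$ have range in $(a,+\infty)$. There exists a positive constant $\overline{\gamma}$, depending only on $\{p,\gamma,N\}$, such that $\varphi(u)\in[GDG]_p^+(E;\overline{\gamma})$. (ii) Likewise, let $\psi:(-\infty,a)\to\mathbb{R}$, for some $a>-\infty$, be concave, non-increasing, and such that $$\lim_{t\to-\infty}\psi(t)=\lim_{t\to-\infty}t\psi'(t)=0,$$ and let $u\in[DG]_p^+(E;\gamma)$ have range in $(-\infty,a)$. There exists a positive constant $\overline{\gamma}$, depending only on $\{p,\gamma,N\}$, such that $\psi(u)\in[GDG]_p^-(E;\overline{\gamma})$.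
   Context: For $y\in\mathbb{R}^N$ and $\rho>0$, $K_\rho(y)$ denotes the (axis-parallel) cube of edge $2\rho$ centered at $y$. Pairs of cubes $K_\rho(y)\subset K_R(y)$ have $0<\rho<R$. For a function $w$, $w_+=\max\{w,0\}$ and $w_-=\max\{-w,0\}$; $D$ denotes the weak gradient. The derivative of a convex or concave function of one variable is understood, at points of non-differentiability, as a one-sided derivative. DeGiorgi classes: for $p>1$ and a constant $\gamma>0$, $[DG]_p^{\pm}(E;\gamma)$ is the collection of functions $u\in W^{1,p}_{\mathrm{loc}}(E)$ such that $$\int_{K_\rho(y)}|D(u-k)_\pm|^p\,dx\le\frac{\gamma}{(R-\rho)^p}\int_{K_R(y)}|(u-k)_\pm|^p\,dx$$ for all cubes $K_\rho(y)\subset K_R(y)\subset E$ and all $k\in\mathbb{R}$ (upper signs for $[DG]_p^+$, lower signs for $[DG]_p^-$). Generalized DeGiorgi classes: $[GDG]_p^{\pm}(E;\gamma)$ is the collection of functions $u\in W^{1,p}_{\mathrm{loc}}(E)$ such that $$\int_{K_\rho(y)}|D(u-k)_\pm|^p\,dx\le\frac{\gamma}{(R-\rho)^p}\Big(\frac{R}{R-\rho}\Big)^{Np}\int_{K_R(y)}|(u-k)_\pm|^p\,dx$$ for all cubes $K_\rho(y)\subset K_R(y)\subset E$ and all $k\in\mathbb{R}$. *)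

(* Defs.v *)
From HB Require Import structures.
From mathcomp Require Import all_boot all_order all_algebra.
From mathcomp Require Import all_classical all_reals all_analysis.

Set Implicit Arguments.
Unset Strict Implicit.
Unset Printing Implicit Defensive.

Import Order.TTheory GRing.Theory Num.Theory.
Import numFieldNormedType.Exports.

Local Open Scope classical_set_scope.
Local Open Scope ring_scope.

(* The sigma-algebra on row vectors generated by the coordinates, as the
   library does for tuples; it is the Borel sigma-algebra of R^n. *)
Section measurable_rV.
Context {R : realType} {n : nat}.

Let coord (i : 'I_n) (x : 'rV[R]_n) : R := x ord0 i.

Let rV_set0 : g_sigma_preimage coord set0.
Proof. exact: sigma_algebra0. Qed.

Let rV_setC A : g_sigma_preimage coord A -> g_sigma_preimage coord (~` A).
Proof. exact: sigma_algebraC. Qed.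

Let rV_bigcup (F : _^nat) : (forall i, g_sigma_preimage coord (F i)) ->
  g_sigma_preimage coord (\bigcup_i (F i)).
Proof. exact: sigma_algebra_bigcup. Qed.

HB.instance Definition _ := @isMeasurable.Build
  (measure_tuple_display default_measure_display)
  'rV[R]_n (g_sigma_preimage coord) rV_set0 rV_setC rV_bigcup.

Lemma measurable_coord (i : 'I_n) :
  measurable_fun [set: 'rV[R]_n] (fun x : 'rV[R]_n => x ord0 i).
Proof.
move=> _ Y mY; rewrite setTI; apply: sub_sigma_algebra => /=.
rewrite -bigcup_seq/=; exists i => /=; first by rewrite mem_index_enum.
by exists Y => //; rewrite setTI.
Qed.

Lemma measurable_rVP d (T : measurableType d) (f : T -> 'rV[R]_n) :
  (forall i, measurable_fun [set: T] (fun t => f t ord0 i)) ->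
  measurable_fun [set: T] f.
Proof.
move=> mf.
suff prefS : g_sigma_preimage (fun i => coord i \o f) `<=` measurable.
  move=> _ A mA; apply: prefS.
  by rewrite g_sigma_preimage_comp; exists A.
apply: smallest_sub; first exact: sigma_algebra_measurable.
rewrite -bigcup_seq; apply: bigcup_sub => i _.
by move=> _ [B mB <-]; exact: mf.
Qed.
End measurable_rV.

Section lebesgue_rV.
Context {R : realType}.
Local Open Scope ereal_scope.

Definition rV_cons n (p : measurableTypeR R * 'rV[R]_n) : 'rV[R]_n.+1 :=
  \row_i if unlift ord0 i is Some j then p.2 ord0 j else p.1.

Definition rV_uncons n (x : 'rV[R]_n.+1) : measurableTypeR R * 'rV[R]_n :=
  (x ord0 ord0, \row_j x ord0 (lift ord0 j)).

Lemma rV_consK n : cancel (@rV_cons n) (@rV_uncons n).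
Proof.
move=> [a v]; rewrite /rV_cons /rV_uncons mxE unlift_none; congr pair.
by apply/rowP => j; rewrite !mxE liftK.
Qed.

Lemma measurable_rV_cons n : measurable_fun setT (@rV_cons n).
Proof.
apply: measurable_rVP => i; under eq_fun do rewrite mxE.
case: unliftP => [j _|_]; last exact: measurable_fst.
exact: (measurableT_comp (measurable_coord j) measurable_snd).
Qed.

Lemma measurable_rV_uncons n : measurable_fun setT (@rV_uncons n).
Proof.
apply: measurable_fun_pair; first exact: measurable_coord.
apply: measurable_rVP => i; under eq_fun do rewrite mxE.
exact: measurable_coord.
Qed.

Section step.
Variables (n : nat) (mu : {sigma_finite_measure set 'rV[R]_n -> \bar R}).

Definition lebesgue_rV_step : set 'rV[R]_n.+1 -> \bar R :=
  pushforward (lebesgue_measure \x mu) (@rV_cons n).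

Let step0 : lebesgue_rV_step set0 = 0.
Proof. apply: measure0; exact: measurable_rV_cons. Qed.

Let step_ge0 A : 0 <= lebesgue_rV_step A.
Proof. apply: measure_ge0; exact: measurable_rV_cons. Qed.

Let step_sigma_additive : semi_sigma_additive lebesgue_rV_step.
Proof.
apply: measure_semi_sigma_additive; exact: measurable_rV_cons.
Qed.

HB.instance Definition _ := isMeasure.Build _ _ _ lebesgue_rV_step
  step0 step_ge0 step_sigma_additive.

Let step_sigma_finite : sigma_finite setT lebesgue_rV_step.
Proof.
have /sigma_finiteP[F [TF ndF Foo]] := sigma_finiteT (@lebesgue_measure R).
have /sigma_finiteP[G [TG ndG Goo]] := sigma_finiteT mu.
exists (fun k => @rV_uncons n @^-1` (F k `*` G k)).
  apply/seteqP; split=> // x _.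
  have [i _ Fi] : (\bigcup_k F k) (rV_uncons x).1 by rewrite -TF.
  have [j _ Gj] : (\bigcup_k G k) (rV_uncons x).2 by rewrite -TG.
  exists (maxn i j) => //; split.
  - exact: (subsetPset _ _ (ndF _ _ (leq_maxl i j))).
  - exact: (subsetPset _ _ (ndG _ _ (leq_maxr i j))).
move=> k; have [mF Fk] := Foo k; have [mG Gk] := Goo k; split.
  rewrite -[X in measurable X]setTI.
  by apply: measurable_rV_uncons => //; exact: measurableX.
rewrite /lebesgue_rV_step /pushforward -comp_preimage.
rewrite (_ : _ \o _ = id); last by apply/funext => p; exact: rV_consK.
by rewrite preimage_id product_measure1E// lte_mul_pinfty// ge0_fin_numE.
Qed.

HB.instance Definition _ := Measure_isSigmaFinite.Build _ _ _ lebesgue_rV_step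
  step_sigma_finite.

End step.

(* Lebesgue measure on R^n, as an n-fold product of lebesgue_measure; the
   lemma lebesgue_rV_box below gives its value on boxes. *)
Fixpoint lebesgue_rV n : {sigma_finite_measure set 'rV[R]_n -> \bar R} :=
  match n with
  | 0 => \d_(0%R : 'rV[R]_0)
  | n'.+1 => lebesgue_rV_step (lebesgue_rV n')
  end.

Lemma measurable_rV_box n (A : 'I_n -> set R) : (forall i, measurable (A i)) ->
  measurable [set x : 'rV[R]_n | forall i, A i (x ord0 i)].
Proof.
move=> mA; pose F i := (fun x : 'rV[R]_n => x ord0 i) @^-1` A i.
rewrite (_ : [set _ | _] = \bigcap_(i in [set: 'I_n]) F i); last first.
  by apply/seteqP; split => [x Ax i _|x Ax i]; exact: Ax.
apply: fin_bigcap_measurable => // i _.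
by rewrite -[X in measurable X]setTI; exact: measurable_coord.
Qed.

Lemma lebesgue_rV_box n (A : 'I_n -> set R) : (forall i, measurable (A i)) ->
  lebesgue_rV n [set x | forall i, A i (x ord0 i)] =
  \prod_(i < n) lebesgue_measure (A i).
Proof.
elim: n A => [|n IHn] A mA.
  by rewrite big_ord0 /= diracE mem_set// => -[].
rewrite big_ord_recl -IHn//=.
have mB : measurable [set x : 'rV[R]_n | forall i, A (lift ord0 i) (x ord0 i)].
  exact: (@measurable_rV_box _ (fun i => A (lift ord0 i))).
rewrite -(product_measure1E lebesgue_measure (lebesgue_rV n) (mA ord0) mB).
rewrite /lebesgue_rV_step /pushforward; congr product_measure1.
apply/seteqP; split => [[a v] /= H|[a v] /= [H0 H] i].
  split; first by have := H ord0; rewrite mxE unlift_none.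
  by move=> i; have := H (lift ord0 i); rewrite mxE liftK.
by rewrite mxE; case: unliftP => [j ->|->].
Qed.

End lebesgue_rV.

Section sobolev.
Context {R : realType} {N : nat}.
Implicit Types (E K : set 'rV[R]_N) (p : R) (i : 'I_N).

Local Notation mu := (lebesgue_rV N).

Definition cube (rho : R) (y : 'rV[R]_N) : set 'rV[R]_N :=
  [set x | forall i, `|x ord0 i - y ord0 i| < rho].

(* The library norm on 'rV[R]_N is the sup norm, hence this definition. *)
Definition euclidean_norm (v : 'rV[R]_N) : R :=
  Num.sqrt (\sum_i (v ord0 i) ^+ 2).

Definition partial i (f : 'rV[R]_N -> R^o) : 'rV[R]_N -> R^o :=
  'D_(delta_mx ord0 i) f.

Fixpoint Ck (k : nat) (f : 'rV[R]_N -> R^o) : Prop :=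
  match k with
  | 0 => continuous f
  | k'.+1 => [/\ continuous f,
      forall i x, derivable f x (delta_mx ord0 i) &
      forall i, Ck k' (partial i f)]
  end.

Definition test_function E (f : 'rV[R]_N -> R^o) : Prop :=
  (forall k, Ck k f) /\
  exists K, [/\ compact K, K `<=` E & forall x, ~ K x -> f x = 0].

(* measurable_fun refers to Borel sets, so Lebesgue measurability on E is
   expressed as almost-everywhere equality with a Borel function. *)
Definition lebesgue_measurable_fun E (f : 'rV[R]_N -> R) : Prop :=
  exists2 h : 'rV[R]_N -> R, measurable_fun E h &
    {ae mu, forall x, E x -> f x = h x}.

Definition Lploc E p (f : 'rV[R]_N -> R) : Prop :=
  lebesgue_measurable_fun E f /\
  forall K, compact K -> K `<=` E ->
    (\int[mu]_(x in K) (`|f x| `^ p)%:E < +oo)%E.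

Definition weak_gradient E (w : 'rV[R]_N -> R) (g : 'rV[R]_N -> 'rV[R]_N) :
    Prop :=
  [/\ Lploc E 1 w,
    forall i, Lploc E 1 (fun x => g x ord0 i) &
    forall f, test_function E f -> forall i,
      (\int[mu]_(x in E) (w x * partial i f x)%:E =
       - \int[mu]_(x in E) (g x ord0 i * f x)%:E)%E].

Definition W1ploc E p (u : 'rV[R]_N -> R) : Prop :=
  Lploc E p u /\
  exists2 g, weak_gradient E u g &
    forall i, Lploc E p (fun x => g x ord0 i).

(* The energy inequality with constant c rho r for a single truncation w. The
   integrals may be infinite, since a cube contained in E need not be relatively
   compact in E. *)
Definition energy_inequality E p (c : R -> R -> R) (w : 'rV[R]_N -> R) : Prop :=
  exists2 g, weak_gradient E w g &
    forall y rho r, 0 < rho -> rho < r -> cube r y `<=` E ->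
      (\int[mu]_(x in cube rho y) (euclidean_norm (g x) `^ p)%:E <=
       (c rho r)%:E * \int[mu]_(x in cube r y) (`|w x| `^ p)%:E)%E.

Definition DG_const p (gamma rho r : R) : R := gamma / (r - rho) `^ p.

Definition GDG_const p (gamma rho r : R) : R :=
  gamma / (r - rho) `^ p * (r / (r - rho)) `^ (N%:R * p).

Definition DG_plus E p (gamma : R) (u : 'rV[R]_N -> R) : Prop :=
  W1ploc E p u /\
  forall k : R, energy_inequality E p (DG_const p gamma) (fun x => u x - k)^\+.

Definition DG_minus E p (gamma : R) (u : 'rV[R]_N -> R) : Prop :=
  W1ploc E p u /\
  forall k : R, energy_inequality E p (DG_const p gamma) (fun x => u x - k)^\-.

Definition GDG_plus E p (gamma : R) (u : 'rV[R]_N -> R) : Prop :=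
  W1ploc E p u /\
  forall k : R, energy_inequality E p (GDG_const p gamma) (fun x => u x - k)^\+.

Definition GDG_minus E p (gamma : R) (u : 'rV[R]_N -> R) : Prop :=
  W1ploc E p u /\
  forall k : R, energy_inequality E p (GDG_const p gamma) (fun x => u x - k)^\-.

End sobolev.

Section real_functions.
Context {R : realType}.

Definition one_sided_derivative (f : R -> R) (t d : R) : Prop :=
  ((f (t + h) - f t) / h @[h --> 0^'+] --> d) \/
  ((f (t + h) - f t) / h @[h --> 0^'-] --> d).

Definition convex_on (D : set R) (f : R -> R) : Prop :=
  convex_function (E := R^o) D f.

Definition concave_on (D : set R) (f : R -> R) : Prop := convex_on D (\- f).

Definition nonincreasing_on (D : set R) (f : R -> R) : Prop :=
  {in D &, nonincreasing_fun f}.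

End real_functions.

(* Main.v *)
Require Import Defs.
From HB Require Import structures.
From mathcomp Require Import all_boot all_order all_algebra.
From mathcomp Require Import all_classical all_reals all_analysis.
From mathcomp Require Import measurable_realfun zify ring lra.

Set Implicit Arguments.
Unset Strict Implicit.
Unset Printing Implicit Defensive.

Import Order.TTheory GRing.Theory Num.Theory.
Import numFieldNormedType.Exports.

Local Open Scope classical_set_scope.
Local Open Scope ring_scope.

(** Why the theorem is true. Part (ii) is part (i) for [- u] and the function
    [t |-> - psi (- t)], so let [phi] be convex, nonincreasing and zero at
    infinity, and let [u] be in the lower De Giorgi class.

    On a grid, [phi] is a limit from below of finite sums
    [F t = \sum_i c_i * (k_i - t)_+] with [c_i >= 0], whose slopes increase
    ([convex_truncations]). The hypothesis is an energy inequality for each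
    truncation [(k_i - u)_+], but the two sides of that inequality are [p]-th
    powers, which do not add up over [i]. De Giorgi's supremum estimate replaces
    the integral of [(k_i - u)_+ ^ p] on the right by the [p]-th power of the
    integral of [(k_i - u)_+] over a larger cube ([energy_mean]). Now both sides
    are homogeneous of degree [p]: Minkowski's inequality adds up the [L^p] norms
    of the gradients on the left, the integrals on the right add up to that of
    [F u], which is at most that of [phi u], and the power mean inequality
    returns to the integral of [phi u ^ p] ([energy_sum], [convex_composition]).
    Estimating a supremum by a mean costs powers of the volume of the gap between
    the cubes; these make up the additional factor [(R / (R - rho)) ^ (N p)] of
    the generalized class.

    The supremum estimate ([degiorgi_sup_cubes]) is De Giorgi's iteration over
    shrinking cubes and decreasing levels. In place of Sobolev's inequality it
    uses that a function which vanishes on half of every small cube is bounded in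
    [L^p] by its gradient, with a constant proportional to the edge of the small
    cubes ([poincare_small_support]). This follows from the representation of
    [w (x + h) - w x] as the integral of the weak gradient along a segment
    ([translation_formula]), itself obtained by testing with smooth tensor bumps.

    Three facts allow the limit over the grids. The gradient of [(k - u)_+] is
    minus the gradient of [u] times the indicator of [u < k]: the convexity of
    the truncation compares its difference quotients with those of [u], and
    translations are continuous in the mean ([gradient_below]). Locally [u] is
    bounded away from the endpoint [a], again by the supremum estimate, so that
    [phi u] and the slopes are locally bounded ([lower_bound_local]). Hence the
    weak gradients converge by dominated convergence ([truncation_limit]), and
    the energies by monotone convergence.

    For a level [k >= 0], [(phi - k)_+] satisfies the assumptions on [phi]. For
    [k < 0], [phi u - k] has the gradient of [phi u] and is larger
    ([composition_GDG_plus]). Membership in the classes does not change on null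
    sets, even for functions that are not measurable ([ae_integral]), which
    allows Borel representatives throughout ([DG_minus_borel]). *)

(** * Cubes and Lebesgue measure on row vectors *)

Section cubes.
Context {R : realType} {N : nat}.
Implicit Types (x y h : 'rV[R]_N) (r s : R).
Local Notation mu := (@lebesgue_rV R N).

Lemma cube_ball r y : 0 < r -> cube r y = ball y r.
Proof.
move=> r0; apply/seteqP; split => x /=.
  by move=> yx; split=> // i j; rewrite ord1 /ball/= distrC.
by case=> _ yx i; have := yx ord0 i; rewrite /ball/= distrC.
Qed.

Lemma open_cube r y : 0 < r -> open (cube r y).
Proof. by move=> r0; rewrite cube_ball//; exact: ball_open. Qed.

Lemma cube_center r y : 0 < r -> cube r y y.
Proof. by move=> r0 i; rewrite subrr normr0. Qed.

Lemma open_cube_sub (U : set 'rV[R]_N) x : open U -> U x ->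
  exists2 e, 0 < e & cube e x `<=` U.
Proof.
rewrite openE => /(_ x) /[apply] /nbhs_ballP[e /= e0 xU].
by exists e => //; rewrite cube_ball.
Qed.

Lemma cubeD r s y x h : cube r y x -> cube s 0 h -> cube (r + s) y (x + h).
Proof.
move=> yx hs i; have := yx i; have := hs i; rewrite !mxE subr0 => h1 h2.
have -> : x ord0 i + h ord0 i - y ord0 i = (x ord0 i - y ord0 i) + h ord0 i.
  by ring.
by rewrite (le_lt_trans (ler_normD _ _))// ltrD.
Qed.

Lemma sub_cube r s y : r <= s -> cube r y `<=` cube s y.
Proof. by move=> rs x yx i; exact: lt_le_trans (yx i) rs. Qed.

Lemma sub_cube_center r s x y : cube r y x -> cube s x `<=` cube (r + s) y.
Proof.
move=> yx z xz; have -> : z = x + (z - x) by rewrite addrC subrK.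
by apply: cubeD => // i; rewrite !mxE subr0; exact: xz.
Qed.

Lemma cube_scale s t h : 0 <= t <= 1 -> cube s 0 h -> cube s 0 (t *: h).
Proof.
move=> /andP[t0 t1] hs i; have := hs i; rewrite !mxE !subr0 normrM.
by apply: le_lt_trans; rewrite ler_piMl// ger0_norm.
Qed.

Definition closed_cube r y : set 'rV[R]_N :=
  [set x | forall i, `|x ord0 i - y ord0 i| <= r].

Lemma closed_cube_compact r y : compact (closed_cube r y).
Proof.
rewrite (_ : closed_cube r y = [set x : 'rV[R]_N |
    forall i, `[y ord0 i - r, y ord0 i + r]%classic (x ord0 i)]).
  apply: (@rV_compact _ _ (fun i => `[y ord0 i - r, y ord0 i + r]%classic)) => i.
  exact: segment_compact.
apply/seteqP; split => x /= H i; have := H i; rewrite /= in_itv/= ler_distl.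
  by rewrite andbC.
by rewrite andbC.
Qed.

Lemma closed_cube_sub r s y : r < s -> closed_cube r y `<=` cube s y.
Proof. by move=> rs x xy i; exact: le_lt_trans (xy i) rs. Qed.

Lemma cube_sub_closed r s y : r <= s -> cube r y `<=` closed_cube s y.
Proof. by move=> rs x xy i; exact: ltW (lt_le_trans (xy i) rs). Qed.

Definition rat_cube (qn : 'rV[rat]_N * nat) : set 'rV[R]_N :=
  cube (qn.2.+1%:R^-1) (map_mx ratr qn.1).

(** Cubes with rational centre and radius [1/(n+1)] form a countable base. *)
Lemma rat_cube_base x (e : R) : 0 < e ->
  exists2 qn, rat_cube qn x & rat_cube qn `<=` cube e x.
Proof.
move=> e0.
pose n := Num.truncn (2 / e); have n1 : 2 / e < n.+1%:R.
  by rewrite truncnS_gt.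
have n0 : 0 < (n.+1%:R^-1 : R) by rewrite invr_gt0.
have en : n.+1%:R^-1 + n.+1%:R^-1 < e.
  have n1' : 2 < e * n.+1%:R by rewrite mulrC -ltr_pdivrMr.
  have -> : n.+1%:R^-1 + n.+1%:R^-1 = 2 / n.+1%:R :> R by rewrite mulr_natl mulr2n.
  by rewrite ltr_pdivrMr.
have /choice[q qP] : forall i, exists q : rat, `|x ord0 i - ratr q| < n.+1%:R^-1.
  move=> i; have : ball (x ord0 i) (n.+1%:R^-1) `&` range ratr !=set0.
    apply: dense_rat; last exact: ball_open.
    by exists (x ord0 i); exact: ballxx.
  by case=> t [/= tb [q _ qt]]; exists q; rewrite qt.
exists (\row_i q i, n); first by move=> i; rewrite !mxE; exact: qP.
move=> z zq i; apply: lt_trans en; have := zq i; rewrite !mxE /= => zqi.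
have -> : z ord0 i - x ord0 i = (z ord0 i - ratr (q i)) - (x ord0 i - ratr (q i)).
  by ring.
by rewrite (le_lt_trans (ler_normB _ _))// ltrD.
Qed.

Lemma measurable_cube r y : measurable (cube r y).
Proof.
rewrite (_ : cube r y = [set x : 'rV[R]_N |
    forall i, [set t | `|t - y ord0 i| < r] (x ord0 i)])//.
apply: (measurable_rV_box (A := fun i => [set t | `|t - y ord0 i| < r])) => i.
rewrite (_ : mkset _ = `]y ord0 i - r, y ord0 i + r[%classic); first exact: measurable_itv.
by apply/seteqP; split => t /=; rewrite in_itv/= ltr_distl.
Qed.

Lemma lebesgue_cube r y : 0 < r -> mu (cube r y) = ((2 * r) ^+ N)%:E.
Proof.
move=> r0; rewrite (_ : cube r y = [set x : 'rV[R]_N |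
    forall i, `]y ord0 i - r, y ord0 i + r[%classic (x ord0 i)]); last first.
  by apply/seteqP; split => x /= H i; have := H i; rewrite /= in_itv/= ltr_distl.
rewrite (@lebesgue_rV_box _ _ (fun i => `]y ord0 i - r, y ord0 i + r[%classic))//.
rewrite (eq_bigr (fun=> (2 * r)%:E)) => [|i _].
  by rewrite prodEFin big_const_ord iter_mulr_1.
rewrite lebesgue_measure_itv/= lte_fin ifT; first by congr _%:E; ring.
by lra.
Qed.

Lemma open_measurable_rV (U : set 'rV[R]_N) : open U -> measurable U.
Proof.
move=> oU.
rewrite (_ : U = \bigcup_(qn in [set qn | rat_cube qn `<=` U]) rat_cube qn).
  rewrite bigcup_mkcond; apply: countable_bigcupT_measurable => [|qn].
    exact: countableP.
  by case: ifP => // _; exact: measurable_cube.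
apply/seteqP; split => [x Ux|x [qn]]; last by move=> /[apply].
have [e e0 eU] := open_cube_sub oU Ux.
have [qn qnx qne] := rat_cube_base x e0.
by exists qn => //; exact: subset_trans eU.
Qed.

Lemma closed_measurable_rV (U : set 'rV[R]_N) : closed U -> measurable U.
Proof.
move=> cU; rewrite -[U]setCK; apply: measurableC; apply: open_measurable_rV.
exact: closed_openC.
Qed.

Lemma compact_measurable_rV (K : set 'rV[R]_N) : compact K -> measurable K.
Proof.
move=> cK; apply: closed_measurable_rV; apply: compact_closed => //.
Qed.

Lemma continuous_measurable_rV (f : 'rV[R]_N -> R) : continuous f ->
  measurable_fun setT f.
Proof.
move=> cf; apply: (measurability _ (measurable_realfun.RGenOpens.measurableE R)).
move=> _ [_ [a [b ->] <-]].
rewrite setTI; apply: open_measurable_rV.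
by move/continuousP : cf; apply; exact: interval_open.
Qed.

(** A property that holds almost everywhere near each point of [U] holds almost
    everywhere on [U], because countably many small cubes cover [U]. *)
Lemma ae_local (U : set 'rV[R]_N) (P : 'rV[R]_N -> Prop) :
  (forall x, U x -> exists2 e, 0 < e & {ae mu, forall z, cube e x z -> P z}) ->
  {ae mu, forall z, U z -> P z}.
Proof.
move=> UP.
pose Q qn := {ae mu, forall z, rat_cube qn z -> P z}.
pose F n : set 'rV[R]_N :=
  if (unpickle n : option ('rV[rat]_N * nat)) is Some qn
  then (if `[< Q qn >] then [set z | rat_cube qn z /\ ~ P z] else set0) else set0.
suff : mu.-negligible (\bigcup_n F n).
  apply: negligibleS => z /= /not_implyP[Uz nPz].
  have [e e0 eP] := UP _ Uz; have [qn qnz qne] := rat_cube_base z e0.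
  exists (pickle qn) => //; rewrite /F pickleK ifT//.
  by apply/asboolP; apply: filterS eP => x + /qne; exact.
apply: negligible_bigcup => n; rewrite /F; case: unpickle => [qn|]; last exact: negligible_set0.
case: asboolP => [Qqn|_]; last exact: negligible_set0.
by apply: negligibleS Qqn => z /= [? ?]; exact/not_implyP.
Qed.

End cubes.

(** * Translation invariance of the integral *)

Section translation.
Context {R : realType}.
Local Open Scope ereal_scope.

Lemma lebesgue_measure_shift (a : R) (A : set R) : measurable A ->
  lebesgue_measure ((fun t => t + a)%R @^-1` A) = lebesgue_measure A.
Proof.
move=> mA.
have ms : measurable_fun [set: measurableTypeR R]
    (fun t => (t + a)%R : measurableTypeR R).
  by apply: measurable_funD => //; exact: measurable_cst.
transitivity (pushforward (@lebesgue_measure R) (fun t => t + a)%R A); first by [].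
symmetry.
apply: (lebesgue_measure_unique (mu := pushforward lebesgue_measure
   (fun t => (t + a)%R : measurableTypeR R))) => // X [[b c] _ <-].
rewrite /= /pushforward (_ : _ @^-1` _ = `](b - a)%R, (c - a)%R]%classic); last first.
  by apply/seteqP; split => t /=; rewrite !in_itv/= ltrBlDr lerBrDr.
rewrite !lebesgue_measure_itv/= !lte_fin ltrD2r -!EFinB.
by have -> : (c - a - (b - a) = c - b)%R by ring.
Qed.

Lemma ge0_integral_shift1 (a : R) (f : R -> \bar R) :
  measurable_fun [set: R] f -> (forall t, 0 <= f t) ->
  \int[lebesgue_measure]_t f (t + a)%R = \int[lebesgue_measure]_t f t.
Proof.
move=> mf f0.
have ms : measurable_fun [set: measurableTypeR R]
    (fun t => (t + a)%R : measurableTypeR R).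
  by apply: measurable_funD => //; exact: measurable_cst.
have := ge0_integral_pushforward ms lebesgue_measure measurableT mf (fun _ _ => f0 _).
rewrite preimage_setT => <-; apply: eq_measure_integral => A mA _.
exact: lebesgue_measure_shift.
Qed.

Lemma ge0_integral_rVS n (f : 'rV[R]_n.+1 -> \bar R) :
  measurable_fun setT f -> (forall x, 0 <= f x) ->
  \int[lebesgue_rV n.+1]_x f x =
  \int[lebesgue_measure]_t \int[lebesgue_rV n]_v f (rV_cons (t, v)).
Proof.
move=> mf f0.
have mfc : measurable_fun setT (f \o @rV_cons R n).
  exact: measurableT_comp mf (@measurable_rV_cons R n).
transitivity (\int[pushforward (lebesgue_measure \x lebesgue_rV n)
   (@rV_cons R n)]_x f x); first by [].
rewrite (ge0_integral_pushforward (@measurable_rV_cons R n))// preimage_setT.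
by apply: fubini_tonelli1 => // -[t v]; exact: f0.
Qed.

Lemma rV_consD n t (v : 'rV[R]_n) (h : 'rV[R]_n.+1) :
  (rV_cons (t, v) + h)%R =
  rV_cons ((t + h ord0 ord0)%R, (v + (\row_j h ord0 (lift ord0 j)))%R).
Proof.
by apply/rowP => j; rewrite /rV_cons !mxE; case: unliftP => [k ->|->]; rewrite ?mxE.
Qed.

Lemma measurable_rV_add n (h : 'rV[R]_n) : 
  measurable_fun setT (fun x : 'rV[R]_n => (x + h)%R).
Proof.
apply: measurable_rVP => i; under eq_fun do rewrite mxE.
by apply: measurable_funD => //; exact: measurable_coord.
Qed.

(** By induction on the dimension: Fubini's theorem splits off the first
    coordinate, and the line is invariant. *)
Lemma ge0_integral_shift n (h : 'rV[R]_n) (f : 'rV[R]_n -> \bar R) :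
  measurable_fun setT f -> (forall x, 0 <= f x) ->
  \int[lebesgue_rV n]_x f (x + h)%R = \int[lebesgue_rV n]_x f x.
Proof.
elim: n h f => [|n IH] h f mf f0.
  by apply: eq_integral => x _; congr f; apply/rowP => -[].
rewrite ge0_integral_rVS//; last first.
  by apply: measurableT_comp => //; exact: measurable_rV_add.
rewrite [RHS](ge0_integral_rVS mf f0).
have mfc : measurable_fun setT (f \o @rV_cons R n).
  by apply: measurableT_comp => //; exact: measurable_rV_cons.
pose F t := \int[lebesgue_rV n]_v f (rV_cons (t, v)).
transitivity (\int[lebesgue_measure]_t F (t + h ord0 ord0)%R).
  apply: eq_integral => t _; rewrite /F.
  rewrite -(IH (\row_j h ord0 (lift ord0 j))%R
      (fun v => f (rV_cons ((t + h ord0 ord0)%R, v)))) //.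
    by apply: eq_integral => v _; rewrite rV_consD.
  exact: (measurable_fun_pair2 _ mfc).
rewrite ge0_integral_shift1//.
- exact: (measurable_fun_fubini_tonelli_F (f \o @rV_cons R n) mfc (fun=> f0 _)).
- by move=> t; exact: integral_ge0.
Qed.

End translation.

(** * Smooth tensor products *)

Section smooth_line.
Context {R : realType}.
Implicit Types (a b : R -> R) (k m : nat) (t : R).

Fixpoint diffn k a : Prop :=
  if k is k'.+1 then (forall t, derivable a t 1) /\ diffn k' (derive1 a) else True.

Definition smooth a := forall k, diffn k a.

Lemma diffnW k a : diffn k.+1 a -> diffn k a.
Proof. by elim: k a => [//|k IH] a [da /IH ka]; split. Qed.

Lemma diffnD k a b : diffn k a -> diffn k b -> diffn k (fun t => a t + b t).
Proof.
elim: k a b => [//|k IH] a b [da ka] [db kb]; split.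
  by move=> t; exact: derivableD.
suff -> : derive1 (fun t => a t + b t) = (fun t => derive1 a t + derive1 b t) by exact: IH.
by apply/funext => t; rewrite !derive1E deriveD.
Qed.

Lemma diffnM k a b : diffn k a -> diffn k b -> diffn k (fun t => a t * b t).
Proof.
elim: k a b => [//|k IH] a b ka kb; split.
  by move=> t; apply: derivableM; [exact: ka.1|exact: kb.1].
have -> : derive1 (fun t => a t * b t) = (fun t => a t * derive1 b t + b t * derive1 a t).
  apply/funext => t; rewrite !derive1E.
  by rewrite deriveM; [|exact: ka.1|exact: kb.1].
apply: diffnD; apply: IH; [exact: diffnW|exact: kb.2|exact: diffnW|exact: ka.2].
Qed.

Lemma diffn_cst k (c : R) : diffn k (fun=> c).
Proof.
elim: k c => [//|k IH] c; split; first by move=> t; exact: derivable_cst.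
suff -> : derive1 (fun=> c) = (fun=> 0) :> (R -> R) by exact: IH.
by apply/funext => t; rewrite derive1_cst.
Qed.

Lemma is_derive_affine (c d t : R) : is_derive t 1 (fun u => c * u + d) c.
Proof.
have -> : (fun u => c * u + d) = (c \*: (id : R -> R^o) + cst d)%R :> (R -> R^o).
  by apply/funext.
by apply: is_derive_eq; rewrite addr0 /GRing.scale/= mulr1.
Qed.

Lemma diffn_affine k a (c d : R) : diffn k a -> diffn k (fun t => a (c * t + d)).
Proof.
elim: k a => [//|k IH] a [da ka].
have H t : is_derive t 1 (fun t => a (c * t + d)) (derive1 a (c * t + d) * c).
  apply: (@is_derive1_comp _ a (fun u => c * u + d)); last exact: is_derive_affine.
  by rewrite derive1E; apply: derivableP.
split; first by move=> t; case: (H t).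
suff -> : derive1 (fun t => a (c * t + d)) = (fun t => derive1 a (c * t + d) * c).
  by apply: diffnM; [exact: IH|exact: diffn_cst].
by apply/funext => t; rewrite derive1E; case: (H t).
Qed.

(** The classical flat function and, up to linear combinations, its
    derivatives: differentiation maps [flat m] into the span of
    [flat m.+1] and [flat m.+2]. *)
Definition flat m t : R := if 0 < t then t^-1 ^+ m * expR (- t^-1) else 0.

Lemma flat_ge0 m t : 0 <= flat m t.
Proof.
rewrite /flat; case: ifPn => // t0.
by rewrite mulr_ge0 ?expR_ge0// exprn_ge0// invr_ge0 ltW.
Qed.

Lemma flat_le m t : flat m t <= m%:R ^+ m.
Proof.
rewrite /flat; case: ifPn => [t0|_]; last by rewrite exprn_ge0.
have s0 : 0 < t^-1 by rewrite invr_gt0.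
move: (t^-1) s0 => s s0; case: m => [|m].
  by rewrite !expr0 mul1r -expR0 ler_expR oppr_le0 ltW.
have m0 : 0 < m.+1%:R :> R by [].
rewrite expRN ler_pdivrMr ?expR_gt0//.
have -> : expR s = expR (s / m.+1%:R) ^+ m.+1.
  by rewrite -expRM_natl mulrC divfK.
rewrite -exprMn; apply: lerXn2r; rewrite ?nnegrE ?mulr_ge0 ?expR_ge0 ?(ltW s0)//.
rewrite mulrC -ler_pdivrMr//.
by apply: le_trans (expR_ge1Dx _); rewrite lerDr.
Qed.

Lemma flatS m t : t * flat m.+1 t = flat m t.
Proof.
rewrite /flat; case: ifPn => [t0|_]; last by rewrite mulr0.
by rewrite exprS !mulrA mulfV ?mul1r// gt_eqF.
Qed.

Lemma flat0_le1 t : flat 0 t <= 1.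
Proof. exact: flat_le. Qed.

Lemma is_derive_flat m t :
  is_derive t 1 (flat m) (flat m.+2 t - m%:R * flat m.+1 t).
Proof.
have [t0|t0|->] := ltgtP t 0.
- have -> : flat m.+2 t - m%:R * flat m.+1 t = 0.
    by rewrite /flat ltNge ltW//= mulr0 subrr.
  have d0 : is_derive t 1 (fun=> 0 : R) (0 : R) by apply: is_derive_cst.
  apply: near_eq_is_derive d0.
  near=> u; rewrite /flat ifF//; apply/negbTE; rewrite -leNgt; near: u.
  exact: lt_le_nbhsl.
- have -> : flat m.+2 t - m%:R * flat m.+1 t =
      t^-1 ^+ m * (expR (- t^-1) * (t ^- 2)) +
      expR (- t^-1) * (m%:R * t^-1 ^+ m.-1 * (- t ^- 2)).
    rewrite /flat t0 -exprVn; case: m => [|m] /=.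
      by rewrite !mul0r mulr0 subr0 addr0 expr0 mul1r mulrC.
    rewrite !exprS; ring.
  have tn0 : t != 0 by rewrite gt_eqF.
  have dV : is_derive t 1 (fun y : R => y^-1) (- t ^- 2).
    have := @is_deriveV _ id t 1 1 tn0 (is_derive_id _ _).
    by rewrite /GRing.scale/= mulr1.
  have dE : is_derive t 1 (fun y : R => expR (- y^-1)) (expR (- t^-1) * t ^- 2).
    apply: (@is_derive1_comp _ expR (fun y => - y^-1)).
    by have := is_deriveN dV; rewrite opprK.
  have dX : is_derive t 1 (fun y : R => y^-1 ^+ m) (m%:R * t^-1 ^+ m.-1 * (- t ^- 2)).
    have dXm : is_derive t 1 ((fun y : R => y^-1) ^+ m)
        ((m%:R * t^-1 ^+ m.-1) *: (- t ^- 2)).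
      case: (m) => [|n]; last exact: is_deriveX.
      rewrite !mul0r scale0r expr0; exact: is_derive_cst.
    rewrite (_ : (fun y => _) = (fun y : R => y^-1) ^+ m)//.
    by apply/funext => y; rewrite exprfctE.
  apply: near_eq_is_derive (is_deriveM dX dE).
  near=> u; rewrite /flat ifT//; near: u.
  exact: lt_nbhsr.
- have -> : flat m.+2 0 - m%:R * flat m.+1 0 = 0 by rewrite /flat ltxx mulr0 subrr.
  have cv : (fun h => h^-1 *: ((flat m \o shift 0) (h *: 1) - flat m 0)) @ 0^' --> (0 : R).
    apply/cvgrPdist_le => e e0.
    have C0 : 0 < 1 + m.+2%:R ^+ m.+2 :> R by rewrite ltr_pwDl// exprn_ge0.
    near=> h.
    have hn0 : h != 0 by near: h; exact: nbhs_dnbhs_neq.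
    rewrite /= addr0 /GRing.scale/= mulr1 {2}/flat ltxx subr0 sub0r normrN.
    rewrite -flatS -flatS mulKf// normrM.
    apply: (@le_trans _ _ (`|h| * (1 + m.+2%:R ^+ m.+2))).
      rewrite ler_wpM2l// ger0_norm ?flat_ge0//.
      by rewrite (le_trans (flat_le _ _))// lerDr.
    rewrite -ler_pdivlMr//.
    near: h; apply: dnbhs0_le; exact: divr_gt0.
  split; first by apply/cvg_ex; exists 0.
  exact/cvg_lim.
Unshelve. all: by end_near. Qed.

Lemma smooth_flat m : smooth (flat m).
Proof.
move=> k; elim: k m => [//|k IH] m; split.
  by move=> t; case: (is_derive_flat m t).
have -> : derive1 (flat m) = (fun t => flat m.+2 t + (- m%:R) * flat m.+1 t).
  apply/funext => t; rewrite derive1E mulNr; by case: (is_derive_flat m t).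
by apply: diffnD => //; apply: diffnM => //; exact: diffn_cst.
Qed.

(** As [n] grows these bumps increase to the indicator of the open interval. *)
Definition itv_bump (l r : R) (n : nat) t : R :=
  flat 0 (n%:R * t + - (n%:R * l)) * flat 0 (- n%:R * t + n%:R * r).

Lemma smooth_bump l r n : smooth (itv_bump l r n).
Proof.
by move=> k; apply: diffnM; apply: (diffn_affine _ _ (smooth_flat _ _)).
Qed.

Lemma itv_bump_ge0 l r n t : 0 <= itv_bump l r n t.
Proof. by rewrite mulr_ge0// flat_ge0. Qed.

Lemma itv_bump_le1 l r n t : itv_bump l r n t <= 1.
Proof. by rewrite mulr_ile1 ?flat_ge0 ?flat0_le1. Qed.

Lemma itv_bump_out l r n t : t \notin `]l, r[ -> itv_bump l r n t = 0.
Proof.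
rewrite in_itv/= negb_and -!leNgt /itv_bump => /orP[tl|rt].
  rewrite {1}/flat ifF ?mul0r//; apply/negbTE; rewrite -leNgt -mulrBr.
  by rewrite mulr_ge0_le0// subr_le0.
rewrite [X in _ * X]/flat ifF ?mulr0//; apply/negbTE; rewrite -leNgt.
by rewrite addrC mulNr -mulrBr mulr_ge0_le0// subr_le0.
Qed.

Lemma flat_cvg1 (d : R) : 0 < d -> flat 0 (n%:R * d) @[n --> \oo] --> (1 : R).
Proof.
move=> d0.
have H : (fun n : nat => - (n.+1%:R * d)^-1) @ \oo --> (0 : R).
  rewrite -[0]oppr0; apply: cvgN.
  rewrite (_ : (fun _ => _) = (fun n : nat => n.+1%:R^-1 * d^-1)); last first.
    by apply/funext => n; rewrite invfM.
  rewrite -[0](mul0r d^-1); apply: cvgM; last exact: cvg_cst.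
  exact: cvg_harmonic.
have H2 : (fun n : nat => expR (- (n.+1%:R * d)^-1)) @ \oo --> (1 : R).
  by have := cvg_comp _ _ H (@continuous_expR R 0); rewrite expR0.
rewrite -cvg_shiftS; apply: cvg_trans H2; apply: near_eq_cvg.
by near=> n; rewrite /= /flat expr0 mul1r mulr_gt0.
Unshelve. all: by end_near. Qed.

Lemma itv_bump_cvg l r t :
  itv_bump l r n t @[n --> \oo] --> (\1_(`]l, r[%classic) t : R).
Proof.
rewrite indicE; have [tlr|tlr] := boolP (t \in `]l, r[).
  rewrite mem_set// -[1%:R](mulr1 1); apply: cvgM.
    rewrite (_ : (fun n : nat => _) = (fun n => flat 0 (n%:R * (t - l)))).
      by apply: flat_cvg1; rewrite subr_gt0; move: tlr; rewrite in_itv/= => /andP[].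
    by apply/funext => n; rewrite mulrBr.
  rewrite (_ : (fun n : nat => _) = (fun n => flat 0 (n%:R * (r - t)))).
    by apply: flat_cvg1; rewrite subr_gt0; move: tlr; rewrite in_itv/= => /andP[].
  by apply/funext => n; rewrite mulrBr mulNr addrC.
rewrite memNset//=; last exact/negP.
rewrite (_ : (fun n : nat => _) = cst 0); first exact: cvg_cst.
by apply/funext => n; rewrite itv_bump_out.
Qed.

End smooth_line.

(** * Tensor products as test functions *)

Section tensor.
Context {R : realType} {N : nat}.
Implicit Types (a : 'I_N -> R -> R) (x h : 'rV[R]_N).

Definition tensor a : 'rV[R]_N -> R^o := fun x => \prod_i a i (x ord0 i).

Lemma differentiable_coord (i : 'I_N) x :
  differentiable (fun x : 'rV[R]_N => x ord0 i : R^o) x.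
Proof.
pose c : 'rV[R]_N -> R^o := fun x => x ord0 i.
have lc : linear c by move=> k u v; rewrite /c !mxE.
pose cL : {linear 'rV[R]_N -> R^o} := HB.pack c (GRing.isLinear.Build _ _ _ _ c lc).
have := @linear_differentiable _ _ _ cL x; apply.
exact: coord_continuous.
Qed.

Lemma differentiable_tensor a x : (forall i t, derivable (a i) t 1) ->
  differentiable (tensor a) x.
Proof.
move=> da; rewrite /tensor; elim: (index_enum _) => [|i s IH].
  rewrite (_ : (fun _ => _) = cst (1 : R^o)); first exact: differentiable_cst.
  by apply/funext => y; rewrite big_nil.
rewrite (_ : (fun _ => _) = (fun x : 'rV[R]_N => a i (x ord0 i) : R^o) *
    (fun x : 'rV[R]_N => \prod_(j <- s) a j (x ord0 j) : R^o)); last first.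
  by apply/funext => y; rewrite big_cons.
apply: differentiableM => //.
apply: (differentiable_comp (f := fun x : 'rV[R]_N => x ord0 i : R^o)).
  exact: differentiable_coord.
exact/derivable1_diffP.
Qed.

Definition derive_factor (i : 'I_N) a : 'I_N -> R -> R :=
  fun j => if j == i then derive1 (a j) else a j.

Lemma partial_tensor a (i : 'I_N) : (forall i t, derivable (a i) t 1) ->
  partial i (tensor a) = tensor (derive_factor i a).
Proof.
move=> da; apply/funext => x; rewrite /partial.
have H (u : R) : tensor a (u *: delta_mx ord0 i + x) =
    a i (u + x ord0 i) * \prod_(j | j != i) a j (x ord0 j).
  rewrite /tensor (bigD1 i)//= !mxE !eqxx mulr1; congr *%R.
  by apply: eq_bigr => j ji; rewrite !mxE eqxx (negbTE ji) mulr0 add0r.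
have -> : tensor (derive_factor i a) x =
    derive1 (a i) (x ord0 i) * \prod_(j | j != i) a j (x ord0 j).
  rewrite /tensor (bigD1 i)//= /derive_factor eqxx; congr *%R.
  by apply: eq_bigr => j /negbTE ->.
set C := \prod_(j | j != i) _ in H *.
rewrite -derive1Mr// /derive /derive1.
have -> : (fun u : R => u^-1 *: ((tensor a \o shift x) (u *: delta_mx ord0 i) -
      tensor a x)) =
    (fun u : R => u^-1 *: (a i (u + x ord0 i) * C - a i (x ord0 i) * C)).
  apply/funext => u /=; rewrite H; congr (_ *: (_ - _)).
  by rewrite /tensor (bigD1 i).
by [].
Qed.

Lemma Ck_tensor k a : (forall i, smooth (a i)) -> Ck k (tensor a).
Proof.
have dS b (sb : forall i, smooth (b i)) i t : derivable (b i) t 1.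
  by have [] := sb i 1.
elim: k a => [|k IH] a sa.
  by move=> x; apply/differentiable_continuous/differentiable_tensor/dS.
split.
- by move=> x; apply/differentiable_continuous/differentiable_tensor/dS.
- by move=> i x; apply/diff_derivable/differentiable_tensor/dS.
- move=> i; rewrite partial_tensor; last exact: dS.
  apply: IH => j m; rewrite /derive_factor; case: eqP => _; last exact: sa.
  by have [] := sa j m.+1.
Qed.

Lemma derive_tensor a x h : (forall i t, derivable (a i) t 1) ->
  'D_h (tensor a) x = \sum_i h ord0 i * partial i (tensor a) x.
Proof.
move=> da; have df := differentiable_tensor x da.
rewrite deriveE// {1}[h]row_sum_delta linear_sum; apply: eq_bigr => i _.
by rewrite linearZ /partial deriveE.
Qed.

Lemma is_derive_tensor_line a x h (t : R) : (forall i t, derivable (a i) t 1) ->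
  is_derive t 1 (fun t : R => tensor a (x - t *: h))
    (- \sum_i h ord0 i * partial i (tensor a) (x - t *: h)).
Proof.
move=> da; have df := differentiable_tensor (x - t *: h) da.
have E : (fun u : R => u^-1 *: (((fun t : R => tensor a (x - t *: h)) \o shift t) (u *: 1) -
     tensor a (x - t *: h))) =
   (fun u : R => u^-1 *: ((tensor a \o shift (x - t *: h)) (u *: - h) -
     tensor a (x - t *: h))).
  apply/funext => u /=; congr (_ *: (tensor a _ - _)).
  by rewrite [_%:A]mulr1 scalerDl scalerN opprD addrCA.
have -> : - (\sum_i h ord0 i * partial i (tensor a) (x - t *: h)) =
    'D_(- h) (tensor a) (x - t *: h).
  rewrite derive_tensor// -sumrN; apply: eq_bigr => i _.
  by rewrite mxE mulNr.
split; first by rewrite /derivable E; exact: diff_derivable.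
by rewrite /derive E.
Qed.

Lemma test_function_tensor (E : set 'rV[R]_N) a l r : (forall i, smooth (a i)) ->
  (forall i t, t \notin `]l i, r i[ -> a i t = 0) ->
  [set x : 'rV[R]_N | forall i, x ord0 i \in `[l i, r i]] `<=` E ->
  test_function E (tensor a).
Proof.
move=> sa a0 lrE; split; first by move=> k; exact: Ck_tensor.
exists [set x : 'rV[R]_N | forall i, x ord0 i \in `[l i, r i]]; split => //.
  apply: (@rV_compact _ _ (fun i => `[l i, r i]%classic)) => i.
  exact: segment_compact.
move=> x; rewrite -existsNP => -[i xi]; rewrite /tensor (bigD1 i)//= a0 ?mul0r//.
by apply/negP => xi'; apply: xi; apply: subset_itv_oo_cc.
Qed.

End tensor.

(** * Testing against tensor bumps *)

Section open_boxes.
Context {R : realType} {N : nat}.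
Implicit Types (l r : 'I_N -> R) (x : 'rV[R]_N).
Local Notation mu := (@lebesgue_rV R N).

Definition open_box l r : set 'rV[R]_N :=
  [set x | forall i, x ord0 i \in `]l i, r i[].

Definition closed_box l r : set 'rV[R]_N :=
  [set x | forall i, x ord0 i \in `[l i, r i]].

Lemma measurable_open_box l r : measurable (open_box l r).
Proof.
apply: (measurable_rV_box (A := fun i => `]l i, r i[%classic)) => i.
exact: measurable_itv.
Qed.

Lemma open_boxI l r l' r' : open_box l r `&` open_box l' r' =
  open_box (fun i => Num.max (l i) (l' i)) (fun i => Num.min (r i) (r' i)).
Proof.
apply/seteqP; split => [x [h h'] i|x h]; last first.
  by split=> i; have := h i; rewrite !in_itv/= gt_max lt_min;
    case/andP=> /andP[a1 b1] /andP[a2 b2]; rewrite ?a1 ?b1 ?a2 ?b2.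
have := h i; have := h' i; rewrite !in_itv/= gt_max lt_min.
by move=> /andP[a1 b1] /andP[a2 b2]; rewrite a1 b1 a2 b2.
Qed.

Lemma cube_open_box (rho : R) y :
  cube rho y = open_box (fun i => y ord0 i - rho) (fun i => y ord0 i + rho).
Proof.
by apply/seteqP; split => x h i; have := h i; rewrite /= in_itv/= ltr_distl.
Qed.

(** Preimages of open intervals under the coordinates are increasing unions of
    open boxes, so that uniqueness of measures applies to boxes. *)
Lemma measurable_rV_boxE :
  @measurable _ 'rV[R]_N = <<s [set A | exists l r, A = open_box l r] >>.
Proof.
apply/seteqP; split; last first.
  apply: smallest_sub; first exact: sigma_algebra_measurable.
  by move=> _ [l [r ->]]; exact: measurable_open_box.
apply: smallest_sub; first exact: smallest_sigma_algebra.
rewrite -bigcup_seq; apply: bigcup_sub => i _ _ [B mB <-]; rewrite setTI.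
pose G : set (set 'rV[R]_N) := [set A | exists l r, A = open_box l r].
have sG := smallest_sigma_algebra setT G.
pose coord x := x ord0 i.
have mE : (measurable : set (set R)) = <<s @measurable_realfun.RGenOpens.G R >>.
  exact: measurable_realfun.RGenOpens.measurableE.
have : <<s @measurable_realfun.RGenOpens.G R >> `<=` [set B | <<s G >> (coord @^-1` B)].
  apply: smallest_sub; last first.
    move=> _ [a [b ->]] /=.
    rewrite (_ : _ @^-1` _ = \bigcup_n open_box
        (fun j => if j == i then a else - n%:R)
        (fun j => if j == i then b else n%:R)).
      apply: sigma_algebra_bigcup => n; apply: sub_sigma_algebra.
      by eexists; eexists.
    apply/seteqP; split => [x xab|x [n _ /(_ i)]]; last by rewrite eqxx.
    exists (Num.truncn (\sum_j `|x ord0 j|)).+1 => // j.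
    case: eqP => [->//|_].
    rewrite in_itv/= -ltr_norml; apply: le_lt_trans (truncnS_gt _).
    by rewrite (bigD1 j)//= lerDl sumr_ge0.
  split=> /=.
  - by rewrite preimage_set0; exact: sigma_algebra0.
  - by move=> A sA; rewrite setTD preimage_setC; exact: sigma_algebraC.
  - by move=> F sF; rewrite preimage_bigcup; exact: sigma_algebra_bigcup.
by rewrite -mE; apply.
Qed.

Definition bumps l r n : 'rV[R]_N -> R := tensor (fun i => itv_bump (l i) (r i) n).

Lemma bumps_ge0 l r n x : 0 <= bumps l r n x.
Proof. by apply: prodr_ge0 => i _; exact: itv_bump_ge0. Qed.

Lemma bumps_le1 l r n x : bumps l r n x <= 1.
Proof.
rewrite /bumps /tensor; elim: (index_enum _) => [|i s IH]; first by rewrite big_nil.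
rewrite big_cons mulr_ile1 ?itv_bump_ge0 ?itv_bump_le1//.
by apply: prodr_ge0 => j _; exact: itv_bump_ge0.
Qed.

Lemma continuous_bumps l r n : continuous (bumps l r n).
Proof. by apply: (@Ck_tensor R N 0) => i; exact: smooth_bump. Qed.

Lemma bumps_cvg l r x : bumps l r n x @[n --> \oo] --> (\1_(open_box l r) x : R).
Proof.
have -> : \1_(open_box l r) x = \prod_i (\1_(`]l i, r i[%classic) (x ord0 i)) :> R.
  rewrite indicE; have [xb|xb] := boolP (x \in open_box l r).
    rewrite big1// => i _; rewrite indicE mem_set//.
    by move/set_mem : xb; exact.
  have [i xi] : exists i, x ord0 i \notin `]l i, r i[.
    apply: contrapT => h; move/negP : xb; apply; apply/mem_set => i.
    by apply: contraT => xi; exfalso; apply: h; exists i.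
  by rewrite (bigD1 i)//= indicE memNset ?mul0r//; exact/negP.
rewrite /bumps /tensor; elim: (index_enum _) => [|i s IH].
  by under eq_fun do rewrite big_nil; rewrite big_nil; exact: cvg_cst.
under eq_fun do rewrite big_cons.
by rewrite big_cons; apply: cvgM => //; exact: itv_bump_cvg.
Qed.

Local Open Scope ereal_scope.

Lemma measurable_bumps l r n : measurable_fun setT (bumps l r n).
Proof. by apply: continuous_measurable_rV; exact: continuous_bumps. Qed.

Lemma integral_open_box_eq0 (F : 'rV[R]_N -> R) l r :
  mu.-integrable setT (EFin \o F) ->
  (forall n, \int[mu]_x (F x * bumps l r n x)%:E = 0) ->
  \int[mu]_(x in open_box l r) (F x)%:E = 0.
Proof.
move=> iF h.
have mF : measurable_fun setT F by apply/measurable_EFinP; exact: measurable_int iF.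
have [|||||_ _] := @dominated_convergence _ _ _ mu setT measurableT
   (fun n x => (F x * bumps l r n x)%:E) (fun x => (F x * \1_(open_box l r) x)%:E)
   (fun x => `|(F x)%:E|).
- move=> n; apply/measurable_EFinP; apply: measurable_funM => //.
  exact: measurable_bumps.
- apply/measurable_EFinP; apply: measurable_funM => //.
  by apply: measurable_indic; exact: measurable_open_box.
- apply: aeW => x _; apply: cvg_EFin; first by near=> n.
  by apply: cvgM; [exact: cvg_cst|exact: bumps_cvg].
- exact: integrable_abse.
- apply: aeW => x n _; rewrite /= lee_fin normrM.
  by rewrite ler_piMr// ger0_norm ?bumps_ge0 ?bumps_le1.
rewrite (_ : (fun _ => _) = cst 0); last by apply/funext => n; exact: h.
move=> /(cvg_lim (@ereal_hausdorff R)); rewrite lim_cst// => ->.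
rewrite [in LHS]integral_mkcond/=; apply: eq_integral => x _.
by rewrite patchE indicE; case: ifPn => _; rewrite ?mulr1 ?mulr0.
Unshelve. all: by end_near. Qed.

(** The fundamental lemma of the calculus of variations, for tensor bumps:
    open boxes form a generating family that is stable under intersection. *)
Lemma ae_eq0_bumps (F : 'rV[R]_N -> R) (y : 'rV[R]_N) (rho : R) :
  (0 < rho)%R -> mu.-integrable setT (EFin \o F) ->
  (forall l r n, closed_box l r `<=` cube rho y ->
     \int[mu]_x (F x * bumps l r n x)%:E = 0) ->
  {ae mu, forall x, cube rho y x -> F x = 0}%R.
Proof.
move=> rho0 iF h; apply: ae_local => x xy.
have : exists2 s, (0 < s)%R & closed_cube s x `<=` cube rho y.
  have [e e0 ey] : exists2 e, (0 < e)%R & cube e x `<=` cube rho y.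
    by apply: open_cube_sub => //; exact: open_cube.
  exists (e / 2)%R; first by rewrite divr_gt0.
  by apply: subset_trans ey; apply: closed_cube_sub; rewrite ltr_pdivrMr// ltr_pMr// ltr1n.
move=> [s s0 sy]; exists s => //.
pose P A := \int[mu]_(z in A `&` cube s x) (F z)%:E = 0.
have mQ := @measurable_cube R N s x.
have iFQ : mu.-integrable (cube s x) (EFin \o F) by exact: integrableS iF.
have PA A : measurable A -> P A.
  move=> mA; move: (mA); rewrite measurable_rV_boxE; move: A {mA}.
  apply: dynkin_induction.
  - exact: measurable_rV_boxE.
  - move=> _ _ [l [r ->]] [l' [r' ->]]; rewrite open_boxI.
    by eexists; eexists.
  - rewrite /P setTI cube_open_box; apply: integral_open_box_eq0 => // n.
    apply: h; apply: subset_trans sy => z zb i; have := zb i.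
    by rewrite in_itv/= ler_distl.
  - move=> _ [l [r ->]]; rewrite /P cube_open_box open_boxI.
    apply: integral_open_box_eq0 => // n.
    apply: h; apply: subset_trans sy => z zb i; have := zb i.
    rewrite in_itv/= ge_max le_min ler_distl.
    by move=> /andP[/andP[_ a2] /andP[_ b2]]; rewrite a2 b2.
  - move=> A mA; rewrite /P => A0.
    have : P setT.
      rewrite /P setTI cube_open_box; apply: integral_open_box_eq0 => // n.
      apply: h; apply: subset_trans sy => z zb i; have := zb i.
      by rewrite in_itv/= ler_distl.
    rewrite /P setTI -{1}[cube s x]setTI -(setUv A) setIUl integral_setU.
    + by rewrite A0 add0e.
    + exact: measurableI.
    + by apply: measurableI => //; exact: measurableC.
    + by rewrite -setIUl setUv setTI; exact: measurable_int iFQ.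
    + by apply/disj_setPS => z [[Az _] [nAz _]].
  - move=> G mG tG GP; rewrite /P setI_bigcupl integral_bigcup.
    + by rewrite eseries0// => n _ _; exact: GP.
    + exact: trivIset_setIr.
    + by move=> k; exact: measurableI.
    + apply: integrableS iF => //; apply: bigcup_measurable => k _.
      exact: measurableI.
have : ae_eq mu (cube s x) (EFin \o F) (cst 0).
  apply: integral_ae_eq => // A As mA; rewrite integral0; have := PA A mA.
  by rewrite /P (setIidl As).
by apply: filterS => z /[apply] -[].
Qed.

End open_boxes.

(** * Integral representation of translation differences *)

Section test_functions.
Context {R : realType} {N : nat}.
Implicit Types (E : set 'rV[R]_N) (f : 'rV[R]_N -> R^o) (x : 'rV[R]_N).

Lemma test_function_bounded E f : test_function E f ->
  exists2 C, 0 < C & forall x, `|f x| <= C.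
Proof.
move=> [sf [K [cK _ fK]]].
have cf : continuous f by exact: (sf 0).
have : bounded_set (f @` K).
  apply: compact_bounded; apply: continuous_compact => //.
  exact: continuous_subspaceT.
move=> [M [_ /(_ (`|M| + 1)) MK]].
have M1 : 0 < `|M| + 1 by rewrite ltr_wpDl.
exists (`|M| + 1) => // x; have [Kx|nKx] := pselect (K x).
  by apply: MK; [rewrite (le_lt_trans (ler_norm _))// ltrDl|exists x].
by rewrite fK// normr0 ltW.
Qed.

Lemma test_function_partial E f i : test_function E f ->
  test_function E (partial i f).
Proof.
move=> [sf [K [cK KE fK]]]; split; first by move=> k; have [_ _] := sf k.+1; exact.
exists K; split=> // x nKx; rewrite /partial (@near_eq_derive _ _ _ f (cst 0)).
  by rewrite derive_cst.
have oK : open (~` K) by apply: closed_openC; exact: compact_closed.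
have := open_nbhs_nbhs (conj oK nKx); apply: filterS => z nKz.
by rewrite fK.
Qed.

Lemma measurable_test_function E f : test_function E f -> measurable_fun setT f.
Proof. by move=> [sf _]; apply: continuous_measurable_rV; exact: (sf 0). Qed.

Lemma test_function_sub E E' f : E `<=` E' -> test_function E f -> test_function E' f.
Proof.
move=> EE' [sf [K [cK KE fK]]]; split=> //; exists K; split=> //.
exact: subset_trans EE'.
Qed.

Lemma partial_shift i f (c x : 'rV[R]_N) :
  partial i (fun z => f (z - c)) x = partial i f (x - c).
Proof.
rewrite /partial /derive.
have -> : (fun h : R => h^-1 *: (((fun z => f (z - c)) \o shift x) (h *: delta_mx ord0 i) -
     f (x - c))) = (fun h : R => h^-1 *: ((f \o shift (x - c)) (h *: delta_mx ord0 i) -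
     f (x - c))).
  by apply/funext => h /=; rewrite addrA.
by [].
Qed.

Lemma test_function_bumps E l r n : closed_box l r `<=` E ->
  test_function E (bumps l r n).
Proof.
move=> lrE; apply: test_function_tensor lrE => i; first exact: smooth_bump.
by move=> t tlr; exact: itv_bump_out.
Qed.

Lemma bumps_shift l r n x c : bumps l r n (x - c) =
  bumps (fun i => l i + c ord0 i) (fun i => r i + c ord0 i) n x.
Proof.
rewrite /bumps /tensor; apply: eq_bigr => i _; rewrite !mxE /itv_bump.
by congr (flat _ _ * flat _ _); ring.
Qed.

End test_functions.

Section integrability.
Context {R : realType}.
Local Open Scope ereal_scope.

(** Products of an integrable function with a bounded one: test functions and
    their derivatives are the bounded factors. *)
Lemma integrable_mulb d (T : measurableType d) (nu : {measure set T -> \bar R})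
    (D : set T) (f b : T -> R) (C : R) : measurable D ->
  nu.-integrable D (EFin \o f) -> measurable_fun D b ->
  (forall x, D x -> `|b x| <= C)%R -> nu.-integrable D (fun x => (f x * b x)%:E).
Proof.
move=> mD fi mb bC.
have mf : measurable_fun D f by apply/measurable_EFinP; exact: measurable_int fi.
apply: (@le_integrable _ _ _ nu D mD _ (fun x => C%:E * (f x)%:E)).
- by apply/measurable_EFinP; exact: measurable_funM.
- move=> x Dx; rewrite -EFinM !abse_EFin lee_fin !normrM mulrC ler_wpM2r//.
  exact: le_trans (bC _ Dx) (ler_norm _).
- exact: integrableZl.
Qed.

Section linear_combination.
Context d (T : measurableType d) (nu : {measure set T -> \bar R}) (D : set T).
Context (I : Type) (s : seq I) (c : I -> R) (F : I -> T -> R).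
Hypotheses (mD : measurable D) (iF : forall i, nu.-integrable D (EFin \o F i)).

Let lincombE : (fun x => (\sum_(i <- s) c i * F i x)%R%:E) =
  (fun x => \sum_(i <- s) (c i)%:E * (F i x)%:E).
Proof. by apply/funext => x; rewrite -sumEFin; apply: eq_bigr. Qed.

Lemma integrable_lincomb :
  nu.-integrable D (fun x => (\sum_(i <- s) c i * F i x)%R%:E).
Proof.
by rewrite lincombE; apply: integrable_sum => // i _; exact: integrableZl (iF i).
Qed.

Lemma integral_lincomb :
  \int[nu]_(x in D) (\sum_(i <- s) c i * F i x)%R%:E =
  \sum_(i <- s) (c i)%:E * \int[nu]_(x in D) (F i x)%:E.
Proof.
rewrite lincombE integral_sum//.
  by apply: eq_bigr => i _; rewrite (integralZl mD (iF i)).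
by move=> i; exact: integrableZl (iF i).
Qed.

End linear_combination.

Context {N : nat}.
Local Notation mu := (@lebesgue_rV R N).
Local Notation leb := (@lebesgue_measure R).
Implicit Types (f : 'rV[R]_N -> R) (h : 'rV[R]_N).

Lemma integrable_shift f h : mu.-integrable setT (EFin \o f) ->
  mu.-integrable setT (fun x => (f (x + h)%R)%:E).
Proof.
move=> fi; have mf := measurable_int _ fi.
have mfh : measurable_fun setT (fun x : 'rV[R]_N => (f (x + h)%R)%:E).
  exact: (measurableT_comp mf (measurable_rV_add h)).
apply/integrableP; split => //.
rewrite (ge0_integral_shift h (f := fun x => `|(f x)%:E|))//.
  by have /integrableP[] := fi.
exact: measurableT_comp.
Qed.

Lemma integral_shift f h : mu.-integrable setT (EFin \o f) ->
  \int[mu]_x (f (x + h)%R)%:E = \int[mu]_x (f x)%:E.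
Proof.
move=> fi; have mf := measurable_int _ fi.
rewrite -[LHS]/(\int[mu]_x ((EFin \o f) \o (fun z => z + h)%R) x).
rewrite -[RHS]/(\int[mu]_x (EFin \o f) x).
rewrite integralE [RHS]integralE funepos_comp funeneg_comp; congr (_ - _).
  exact: (ge0_integral_shift h (measurable_funepos mf) (fun _ => funepos_ge0 _ _)).
exact: (ge0_integral_shift h (measurable_funeneg mf) (fun _ => funeneg_ge0 _ _)).
Qed.

Lemma measurable_line h : measurable_fun setT
  (fun z : 'rV[R]_N * measurableTypeR R => (z.1 + z.2 *: h)%R).
Proof.
apply: measurable_rVP => i; under eq_fun do rewrite !mxE.
apply: measurable_funD.
  exact: (measurableT_comp (measurable_coord i) measurable_fst).
by apply: measurable_funM => //; exact: measurable_snd.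
Qed.

(** The function integrated in the representation formula, on the whole product
    space so that Fubini's theorem applies. *)
Lemma integrable_line f h : mu.-integrable setT (EFin \o f) ->
  (mu \x leb).-integrable setT
    (fun z => (f (z.1 + z.2 *: h) * \1_(`[0%R, 1%R]%classic : set R) z.2)%R%:E).
Proof.
move=> fi; have /measurable_EFinP mf := measurable_int _ fi.
have m1 : measurable_fun setT (\1_(`[0%R, 1%R]%classic : set R) : measurableTypeR R -> R).
  by apply: measurable_indic; exact: measurable_itv.
apply/integrable21ltyP.
  apply/measurable_EFinP; apply: measurable_funM.
    exact: (measurableT_comp mf (measurable_line h)).
  exact: (measurableT_comp m1 measurable_snd).
rewrite /=.
have H (t : R) : \int[mu]_x `|(f (x + t *: h) * \1_(`[0%R, 1%R]%classic : set R) t)%:E| =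
    (\1_(`[0%R, 1%R]%classic : set R) t)%:E * \int[mu]_x `|(f x)%:E|.
  under eq_integral do rewrite EFinM abseM muleC.
  rewrite ge0_integralZl//; last first.
    by apply: measurableT_comp => //; exact: (measurable_int _ (integrable_shift (t *: h) fi)).
  rewrite (ge0_integral_shift (t *: h)%R (f := fun x => `|(f x)%:E|))//.
    by rewrite gee0_abs// lee_fin.
  by apply: measurableT_comp => //; exact/measurable_EFinP.
under eq_integral do rewrite H.
have fin : \int[mu]_x `|(f x)%:E| \is a fin_num.
  rewrite ge0_fin_numE ?integral_ge0//; by have /integrableP[] := fi.
rewrite ge0_integralZr//; last 2 first.
- by apply/measurable_EFinP.
- exact: integral_ge0.
rewrite integral_indic// setIT. 
rewrite /= lebesgue_measure_itv/= lte_fin ltr01 -EFinB subr0 mul1e.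
by rewrite ltey_eq fin.
Qed.

End integrability.

Section translation_formula.
Context {R : realType} {N : nat}.
Local Notation mu := (@lebesgue_rV R N).
Local Notation leb := (@lebesgue_measure R).
Local Notation I01 := (`[0%R, 1%R]%classic : set R).
Implicit Types (h y : 'rV[R]_N).
Local Open Scope ereal_scope.

(** The value is extended real because a line may meet an integrable function in
    a function that is not integrable. *)
Definition line_integral (f : 'rV[R]_N -> R) h (x : 'rV[R]_N) : \bar R :=
  \int[leb]_t (f (x + t *: h) * \1_I01 t)%R%:E.

Lemma line_integralE f h x :
  line_integral f h x = \int[leb]_(t in I01) (f (x + t *: h)%R)%:E.
Proof.
rewrite [RHS]integral_mkcond; apply: eq_integral => t _.
by rewrite patchE indicE; case: ifPn => _; rewrite ?mulr1 ?mulr0.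
Qed.

Lemma integrable_line_integral f h : mu.-integrable setT (EFin \o f) ->
  mu.-integrable setT (line_integral f h).
Proof. by move=> /(integrable_line h)/integrable_fubini_F. Qed.

Lemma continuous_sum_line (F : 'I_N -> R -> R) : (forall i, continuous (F i)) ->
  continuous (fun t => \sum_i F i t)%R.
Proof.
move=> cF; elim: (index_enum _) => [|i s IH].
  rewrite (_ : (fun t => _) = cst 0%R); first by move=> t; exact: cvg_cst.
  by apply/funext => t; rewrite big_nil.
rewrite (_ : (fun t => _) = (F i \+ (fun t => \sum_(j <- s) F j t))%R).
  by move=> t; apply: cvgD; [exact: cF|exact: IH].
by apply/funext => t; rewrite big_cons.
Qed.

Lemma continuous_line_partial l r n x h : continuous (fun t : R =>
  (\sum_i h ord0 i * partial i (bumps l r n) (x - t *: h))%R).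
Proof.
apply: continuous_sum_line => i t; apply: cvgM; first exact: cvg_cst.
apply: (@continuous_comp _ _ _ (fun t : R => (x - t *: h)%R) (partial i (bumps l r n))).
  apply: cvgB; first exact: cvg_cst.
  by apply: cvgZl; exact: cvg_id.
have [_ _ /(_ i)] := @Ck_tensor R N 1%N (fun i => itv_bump (l i) (r i) n)
   (fun i => smooth_bump _ _ _).
exact.
Qed.

Lemma FTC_bumps l r n x h :
  \int[leb]_(t in I01) (\sum_i h ord0 i * partial i (bumps l r n) (x - t *: h))%R%:E =
  (bumps l r n x - bumps l r n (x - h))%R%:E.
Proof.
pose F (t : R) : R := (- bumps l r n (x - t *: h))%R.
pose F' (t : R) : R := (\sum_i h ord0 i * partial i (bumps l r n) (x - t *: h))%R.
have ds (i : 'I_N) t : derivable (itv_bump (l i) (r i) n) t 1%R.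
  by have [] := smooth_bump (l i) (r i) n 1%N.
have dF (t : R) : is_derive t 1%R F (F' t).
  have := is_deriveN (is_derive_tensor_line x h t ds).
  by rewrite opprK.
have cF' : continuous F' by exact: continuous_line_partial.
have cF : continuous F.
  by move=> t; apply: differentiable_continuous; apply/derivable1_diffP; case: (dF t).
transitivity ((F 1)%:E - (F 0)%:E).
  apply: (@continuous_FTC2 _ F') => //.
  - exact: continuous_subspaceT.
  - split.
    + by move=> t _; case: (dF t).
    + by apply: cvg_at_right_filter; exact: cF.
    + by apply: cvg_at_left_filter; exact: cF.
  - by move=> t _; rewrite derive1E; case: (dF t).
by rewrite /F scale0r subr0 scale1r -EFinB opprK addrC.
Qed.

Lemma weak_derivative_shift (w gi : 'rV[R]_N -> R) (f : 'rV[R]_N -> R^o) i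
    (c : 'rV[R]_N) :
  (\int[mu]_x (w x * partial i (fun z => f (z - c)%R) x)%:E =
    - \int[mu]_x (gi x * f (x - c)%R)%:E) ->
  \int[mu]_x (w x * partial i f (x - c)%R)%:E =
    - \int[mu]_x (gi x * f (x - c)%R)%:E.
Proof. by move=> <-; apply: eq_integral => x _; rewrite partial_shift. Qed.

(** Both sides, tested against a bump, move all translations to the bump, where
    the fundamental theorem of calculus applies. *)
Lemma translation_formula (w : 'rV[R]_N -> R) (g : 'I_N -> 'rV[R]_N -> R)
    (y : 'rV[R]_N) (rho s : R) h :
  (0 < rho)%R -> cube s 0 h ->
  mu.-integrable setT (EFin \o w) ->
  (forall i, mu.-integrable setT (EFin \o g i)) ->
  (forall f, test_function (cube (rho + s) y) f -> forall i,
     \int[mu]_x (w x * partial i f x)%:E = - \int[mu]_x (g i x * f x)%:E) ->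
  {ae mu, forall x, cube rho y x ->
    line_integral (fun x => \sum_i h ord0 i * g i x)%R h x = (w (x + h) - w x)%R%:E}.
Proof.
move=> rho0 hs iw ig wg.
pose G x := (\sum_i h ord0 i * g i x)%R.
have mw : measurable_fun setT w by apply/measurable_EFinP; exact: measurable_int iw.
have iG : mu.-integrable setT (EFin \o G).
  exact: integrable_lincomb.
have mG : measurable_fun setT G by apply/measurable_EFinP; exact: measurable_int iG.
pose A := line_integral G h.
have iA : mu.-integrable setT A by exact: integrable_line_integral.
pose D x := ((w (x + h) - w x) - fine (A x))%R.
have mA : measurable_fun setT (fun x => fine (A x)).
  by apply: measurableT_comp => //; exact: measurable_int iA.
have Afin : {ae mu, forall x, A x \is a fin_num}.
  by have := integrable_ae measurableT iA; apply: filterS => x; exact.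
have iA' : mu.-integrable setT (fun x => (fine (A x))%:E).
  apply: le_integrable iA => //; first exact/measurable_EFinP.
  by move=> x _; case: (A x) => [r||] //=; rewrite ?lexx ?normr0 ?leey.
have iw' := integrable_shift h iw.
have iD : mu.-integrable setT (EFin \o D).
  rewrite (_ : EFin \o D = (fun x => (w (x + h))%:E) \- (EFin \o w) \-
     (fun x => (fine (A x))%:E)).
    by apply: integrableB => //; exact: integrableB.
  by apply/funext => x; rewrite /= /D !EFinB.
suff : {ae mu, forall x, cube rho y x -> D x = 0}%R.
  move=> D0; apply: filterS2 Afin D0 => x Ax /[apply] /eqP; rewrite subr_eq0 => /eqP ->.
  by rewrite fineK.
apply: ae_eq0_bumps => // l r n lry.
pose f := bumps l r n.
have mf : measurable_fun setT f := measurable_bumps l r n.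
have f1 x : (`|f x| <= 1)%R by rewrite ger0_norm ?bumps_ge0 ?bumps_le1.
have mfs (c : 'rV[R]_N) : measurable_fun setT (fun x : 'rV[R]_N => f (x - c)%R).
  exact: (measurableT_comp mf (measurable_rV_add (- c)%R)).
have tf (t : R) : I01 t -> test_function (cube (rho + s) y) (fun x => f (x - t *: h)%R).
  move=> t01.
  rewrite (_ : (fun x => _) = bumps (fun i => l i + (t *: h)%R ord0 i)%R
      (fun i => r i + (t *: h)%R ord0 i)%R n); last first.
    by apply/funext => x; rewrite -bumps_shift.
  apply: test_function_bumps => x xlr.
  have -> : x = (x - t *: h + t *: h)%R by rewrite subrK.
  apply: cubeD.
    apply: lry => i; have := xlr i; rewrite !in_itv/= !mxE.
    by rewrite lerBrDr lerBlDr.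
  by apply: cube_scale => //; move: t01; rewrite /= in_itv.
have tf0 : test_function (cube (rho + s) y) f.
  have := tf 0%R; rewrite (_ : (fun x => _) = f); last first.
    by apply/funext => x; rewrite scale0r subr0.
  by apply; rewrite /= in_itv/= lexx ler01.
have /choice[C Cp] : forall i, exists C : R, forall x, (`|partial i f x| <= C)%R.
  by move=> i; have [C _ HC] := test_function_bounded (test_function_partial i tf0); exists C.
have mp i : measurable_fun setT (partial i f).
  exact: measurable_test_function (test_function_partial i tf0).
pose psi x (t : R) := (\sum_i h ord0 i * partial i f (x - t *: h))%R.
have key : \int[mu]_x (fine (A x) * f x)%:E =
    \int[mu]_x (- (w x * (f x - f (x - h))))%R%:E.
  pose Psi (z : 'rV[R]_N * measurableTypeR R) :=
    ((G (z.1 + z.2 *: h) * \1_I01 z.2) * f z.1)%R.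
  have iPhi := integrable_line h iG.
  have iPsi : (mu \x leb).-integrable setT (EFin \o Psi).
    apply: (integrable_mulb (C := 1%R)) iPhi _ _ => //.
    exact: measurableT_comp mf measurable_fst.
  transitivity (\int[mu]_x \int[leb]_t (Psi (x, t))%:E).
    apply: ae_eq_integral => //.
    - by apply/measurable_EFinP; exact: measurable_funM.
    - exact: (measurable_int _ (integrable_fubini_F iPsi)).
    - apply: filterS2 Afin (ae_integrable1 iPhi) => x Ax ix _.
      rewrite EFinM fineK// -integralZr//.
  rewrite (Fubini iPsi).
  pose Q (z : 'rV[R]_N * measurableTypeR R) :=
    ((w z.1 * \1_I01 z.2) * (- psi z.1 z.2))%R.
  have iQ : (mu \x leb).-integrable setT (EFin \o Q).
    have := integrable_line 0%R iw.
    under eq_fun do rewrite scaler0 addr0.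
    move=> iw1.
    apply: (integrable_mulb (C := (\sum_i `|h ord0 i| * C i)%R)) iw1 _ _ => //.
      apply: measurableT_comp => //; apply: measurable_sum => i.
      apply: measurable_funM => //.
      rewrite (_ : (fun z => _) = partial i f \o (fun z : 'rV[R]_N * measurableTypeR R =>
          (z.1 + z.2 *: (- h))%R)); last by apply/funext => z; rewrite /= scalerN.
      exact: measurableT_comp (mp i) (measurable_line _).
    move=> z _; rewrite normrN; apply: (le_trans (ler_norm_sum _ _ _)).
    by apply: ler_sum => i _; rewrite normrM ler_wpM2l.
  transitivity (\int[leb]_t \int[mu]_x (Q (x, t))%:E).
    apply: eq_integral => t _; rewrite /Psi /Q /=.
    have [t01|t01] := pselect (I01 t); last first.
      rewrite indicE memNset//=.
      by under eq_integral do rewrite mulr0 mul0r; under [RHS]eq_integral do rewrite mulr0 mul0r.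
    rewrite indicE mem_set//=.
    under eq_integral do rewrite mulr1.
    under [RHS]eq_integral do rewrite mulr1.
    have iGf := integrable_mulb measurableT iG (mfs (t *: h)%R) (fun x _ => f1 _).
    have := integral_shift (t *: h)%R iGf.
    rewrite /=; under eq_integral do rewrite addrK.
    move=> ->.
    have igf i := integrable_mulb measurableT (ig i) (mfs (t *: h)%R) (fun x _ => f1 _).
    have mpt i : measurable_fun setT (fun x : 'rV[R]_N => partial i f (x - t *: h)%R).
      exact: (measurableT_comp (mp i) (measurable_rV_add (- (t *: h))%R)).
    have iwp i := integrable_mulb measurableT iw (mpt i) (fun x _ => Cp i _).
    transitivity (\sum_i (h ord0 i)%:E * \int[mu]_x (g i x * f (x - t *: h)%R)%:E).
      rewrite -integral_lincomb//; apply: eq_integral => x _; rewrite mulr_suml.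
      by congr _%:E; apply: eq_bigr => i _; rewrite mulrA.
    transitivity (\sum_i (- h ord0 i)%:E * \int[mu]_x (w x * partial i f (x - t *: h)%R)%:E).
      apply: eq_bigr => i _; have -> := weak_derivative_shift (wg _ (tf t t01) i).
      by rewrite EFinN muleNN.
    rewrite -integral_lincomb//; apply: eq_integral => x _; rewrite /psi mulrN mulr_sumr -sumrN.
    by congr _%:E; apply: eq_bigr => i _; ring.
  rewrite -(Fubini iQ); apply: eq_integral => x _.
  rewrite -mulNr EFinM.
  transitivity (\int[leb]_t ((- w x)%:E * (psi x t * \1_I01 t)%:E)).
    by apply: eq_integral => t _; rewrite /Q/= -EFinM; congr _%:E; ring.
  have ipsi : leb.-integrable setT (fun t => (psi x t * \1_I01 t)%:E).
    rewrite (_ : (fun t => _) = (EFin \o psi x) \_ I01).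
      have ic : leb.-integrable I01 (EFin \o psi x).
        apply: continuous_compact_integrable; first exact: segment_compact.
        by apply: continuous_subspaceT; exact: continuous_line_partial.
      have mI : measurable (I01 : set (measurableTypeR R)) by exact: measurable_itv.
      exact: (integrable_mkcond _ mI).1 ic.
    by apply/funext => t; rewrite patchE indicE; case: ifPn => _; rewrite ?mulr1 ?mulr0.
  rewrite integralZl//; congr (_ * _); apply: etrans (FTC_bumps l r n x h).
  rewrite [RHS]integral_mkcond; apply: eq_integral => t _.
  by rewrite patchE indicE; case: ifPn => _; rewrite ?mulr1 ?mulr0.
have iwf := integrable_mulb measurableT iw mf (fun x _ => f1 x).
have iwfh := integrable_mulb measurableT iw (mfs h) (fun x _ => f1 _).
have ishift := integral_shift h iwfh.
have iwhf := integrable_mulb measurableT iw' mf (fun x _ => f1 x).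
have iAf := integrable_mulb measurableT iA' mf (fun x _ => f1 x).
have iwB : mu.-integrable setT (fun x => (w (x + h) * f x)%:E - (w x * f x)%:E).
  exact: (integrableB measurableT iwhf iwf).
transitivity (\int[mu]_x ((w (x + h) * f x - w x * f x)%:E - (fine (A x) * f x)%:E)).
  by apply: eq_integral => x _; rewrite /D mulrBl mulrBl.
rewrite (integralB_EFin measurableT iwB iAf) key.
transitivity (\int[mu]_x ((w (x + h) * f x)%:E - (w x * f x)%:E) -
   \int[mu]_x ((w x * f (x - h)%R)%:E - (w x * f x)%:E)).
  by congr (_ - _); apply: eq_integral => x _; rewrite -EFinB; congr _%:E; ring.
rewrite (integralB_EFin measurableT iwhf iwf) (integralB_EFin measurableT iwfh iwf).
move: ishift; rewrite /=; under eq_integral do rewrite addrK.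
move=> <-; rewrite subee// fin_numB.
by rewrite (integrable_fin_num measurableT iwhf) (integrable_fin_num measurableT iwf).
Qed.

End translation_formula.

(** * Poincare inequality for functions with small support *)

Section power_mean.
Context {R : realType}.

Lemma powR_tangent (p a c : R) : 1 < p -> 0 <= a -> 0 <= c ->
  p * (c `^ (p - 1) * a) <= a `^ p + (p - 1) * c `^ p.
Proof.
move=> p1 a0 c0.
have p0 : 0 < p by rewrite (lt_trans ltr01).
have p10 : 0 < p - 1 by rewrite subr_gt0.
have := @conjugate_powR R a (c `^ (p - 1)) p (p / (p - 1)) a0 (powR_ge0 _ _) p0
  (divr_gt0 p0 p10).
have E1 : (p - 1) * (p / (p - 1)) = p by field; rewrite gt_eqF.
rewrite invf_div -powRrM E1.
have -> : p^-1 + (p - 1) / p = 1 by field; rewrite gt_eqF.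
move=> /(_ erefl) H; rewrite [X in p * X]mulrC.
have -> : a `^ p + (p - 1) * c `^ p = p * (a `^ p / p + c `^ p * ((p - 1) / p)).
  by field; rewrite gt_eqF.
by rewrite ler_pM2l.
Qed.

Local Open Scope ereal_scope.

(** The power mean inequality; bounding a real number by the integral covers
    integrals that are infinite. *)
Lemma power_mean_le d (T : measurableType d) (nu : {measure set T -> \bar R})
    (D : set T) (f : T -> R) (p m c : R) : (1 < p)%R -> measurable D ->
  measurable_fun D f -> (forall x, D x -> 0 <= f x)%R ->
  nu D = m%:E -> (0 < m)%R -> (0 <= c)%R ->
  c%:E <= \int[nu]_(x in D) (f x)%:E ->
  (c `^ p)%:E <= (m `^ (p - 1))%:E * \int[nu]_(x in D) (f x `^ p)%:E.
Proof.
move=> p1 mD mf f0 Dm m0 c0 cf.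
have p0 : (0 < p)%R by rewrite (lt_trans ltr01).
set X := \int[nu]_(x in D) (f x `^ p)%:E.
pose k := (c / m)%R.
have k0 : (0 <= k)%R by rewrite divr_ge0// ltW.
have H : (p * (k `^ (p - 1) * c))%:E <= X + ((p - 1) * k `^ p * m)%:E.
  apply: (@le_trans _ _ (\int[nu]_(x in D) ((p * k `^ (p - 1))%:E * (f x)%:E))).
    have mfE : measurable_fun D (EFin \o f) by exact/measurable_EFinP.
    have fE0 x : D x -> 0 <= (f x)%:E by move=> Dx; rewrite lee_fin f0.
    have pk0 : 0 <= (p * k `^ (p - 1))%:E.
      by rewrite lee_fin mulr_ge0 ?powR_ge0 ?ltW.
    rewrite (ge0_integralZl nu mD mfE fE0 pk0).
    rewrite mulrA EFinM lee_wpmul2l// lee_fin mulr_ge0 ?powR_ge0 ?ltW//.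
  have -> : ((p - 1) * k `^ p * m)%:E = \int[nu]_(x in D) ((p - 1) * k `^ p)%:E.
    by rewrite integral_cst// Dm.
  have e0 : (0 <= (p - 1) * k `^ p)%R.
    by rewrite mulr_ge0 ?powR_ge0// subr_ge0 ltW.
  rewrite -ge0_integralD//; last 2 first.
  - by move=> x Dx; rewrite lee_fin powR_ge0.
  - by apply/measurable_EFinP; exact: (measurableT_comp (measurable_powR p) mf).
  apply: ge0_le_integral => //.
  - by move=> x Dx; rewrite -EFinM lee_fin mulr_ge0 ?f0// mulr_ge0 ?powR_ge0 ?ltW.
  - by apply/measurable_EFinP; exact: measurable_funM.
  - apply/measurable_EFinP; apply: measurable_funD => //.
    exact: (measurableT_comp (measurable_powR p) mf).
  - by move=> x Dx; rewrite -EFinM -EFinD lee_fin -mulrA powR_tangent// f0.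
have kc : (k `^ (p - 1) * c = k `^ p * m)%R.
  have -> : c = (k * m)%R by rewrite /k divfK// gt_eqF.
  by rewrite mulrA [X in (X * m)%R]mulrC mulr_powRB1.
have H2 : (k `^ p * m)%:E <= X.
  have -> : (k `^ p * m = p * (k `^ (p - 1) * c) - (p - 1) * k `^ p * m)%R.
    by rewrite kc; ring.
  by rewrite EFinB leeBlDr.
apply: (@le_trans _ _ ((m `^ (p - 1))%:E * (k `^ p * m)%:E)).
  rewrite -EFinM lee_fin.
  have -> : c = (k * m)%R by rewrite /k divfK// gt_eqF.
  rewrite powRM// ?(ltW m0)// -(mulr_powRB1 (ltW m0) p0).
  by rewrite le_eqVlt; apply/orP; left; apply/eqP; ring.
by rewrite lee_wpmul2l// lee_fin powR_ge0.
Qed.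

Lemma fubini_tonelli_set d1 d2 (T1 : measurableType d1) (T2 : measurableType d2)
    (m1 : {sigma_finite_measure set T1 -> \bar R})
    (m2 : {sigma_finite_measure set T2 -> \bar R})
    (A : set T1) (B : set T2) (f : T1 * T2 -> \bar R) :
  measurable A -> measurable B -> measurable_fun setT f -> (forall z, 0 <= f z) ->
  \int[m1]_(x in A) \int[m2]_(y in B) f (x, y) =
  \int[m2]_(y in B) \int[m1]_(x in A) f (x, y).
Proof.
move=> mA mB mf f0.
have mF : measurable_fun setT (f \_ (A `*` B)).
  apply/(measurable_restrictT _ _).1; first exact: measurableX.
  exact: measurable_funTS.
transitivity (\int[m1]_x \int[m2]_y (f \_ (A `*` B)) (x, y)).
  rewrite integral_mkcond; apply: eq_integral => x _.
  rewrite patchE; case: ifPn => xA.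
    rewrite integral_mkcond; apply: eq_integral => y _.
    by rewrite !patchE in_setX xA.
  by rewrite integral0_eq// => y _; rewrite patchE in_setX (negbTE xA).
have F0 z : 0 <= (f \_ (A `*` B)) z by rewrite patchE; case: ifP.
rewrite (fubini_tonelli _ mF F0).
rewrite [RHS]integral_mkcond; apply: eq_integral => y _.
rewrite [RHS]patchE; case: ifPn => yB.
  rewrite [RHS]integral_mkcond; apply: eq_integral => x _.
  by rewrite !patchE in_setX yB andbT.
by rewrite integral0_eq// => x _; rewrite patchE in_setX (negbTE yB) andbF.
Qed.

Lemma measurable_fubini_tonelli_setF d1 d2 (T1 : measurableType d1)
    (T2 : measurableType d2) (m2 : {sigma_finite_measure set T2 -> \bar R})
    (B : set T2) (f : T1 * T2 -> \bar R) :
  measurable B -> measurable_fun setT f -> (forall z, 0 <= f z) ->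
  measurable_fun setT (fun x => \int[m2]_(y in B) f (x, y)).
Proof.
move=> mB mf f0.
have mF : measurable_fun setT (f \_ (setT `*` B)).
  apply/(measurable_restrictT _ _).1; first exact: measurableX.
  exact: measurable_funTS.
rewrite (_ : (fun x => _) = fubini_F m2 (f \_ (setT `*` B))).
  apply: measurable_fun_fubini_tonelli_F => // z.
  by rewrite patchE; case: ifP.
apply/funext => x; rewrite /fubini_F [LHS]integral_mkcond; apply: eq_integral => y _.
by rewrite !patchE in_setX in_setT.
Qed.

Lemma measurable_fubini_tonelli_setG d1 d2 (T1 : measurableType d1)
    (T2 : measurableType d2) (m1 : {sigma_finite_measure set T1 -> \bar R})
    (A : set T1) (f : T1 * T2 -> \bar R) :
  measurable A -> measurable_fun setT f -> (forall z, 0 <= f z) ->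
  measurable_fun setT (fun y => \int[m1]_(x in A) f (x, y)).
Proof.
move=> mA mf f0.
have msw : measurable_fun setT (fun z : T2 * T1 => (z.2, z.1)).
  by apply: measurable_fun_pair; [exact: measurable_snd|exact: measurable_fst].
exact: (measurable_fubini_tonelli_setF (f := f \o (fun z => (z.2, z.1))) m1 mA
  (measurableT_comp mf msw) (fun z => f0 _)).
Qed.

End power_mean.

Lemma integral_cube_shift_le {R : realType} {N : nat} (F : 'rV[R]_N -> \bar R)
    (y h : 'rV[R]_N) (rho s : R) :
  measurable_fun setT F -> (forall x, 0 <= F x)%E -> cube s 0 h ->
  (\int[lebesgue_rV N]_(x in cube rho y) F (x + h)%R <=
   \int[lebesgue_rV N]_(x in cube (rho + s) y) F x)%E.
Proof.
move=> mF F0 hs; rewrite [leLHS]integral_mkcond [leRHS]integral_mkcond.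
have mC r := @measurable_cube R N r y.
have mFs : measurable_fun setT (F \_ (cube (rho + s) y)).
  apply/(measurable_restrictT _ _).1; first exact: mC.
  exact: measurable_funTS mF.
have F0' z : (0 <= (F \_ (cube (rho + s) y)) z)%E by rewrite patchE; case: ifP.
rewrite -(ge0_integral_shift h mFs F0').
apply: ge0_le_integral.
- exact: measurableT.
- by move=> x _; rewrite patchE; case: ifP.
- apply/(measurable_restrictT _ _).1; first exact: mC.
  apply: measurable_funTS; exact: (measurableT_comp mF (measurable_rV_add h)).
- exact: (measurableT_comp mFs (measurable_rV_add h)).
move=> x _; rewrite patchE; case: ifPn => // /set_mem xy.
by rewrite patchE mem_set//; exact: cubeD.
Qed.

Section small_support.
Context {R : realType} {N : nat}.
Local Notation mu := (@lebesgue_rV R N).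
Local Notation leb := (@lebesgue_measure R).
Local Notation I01 := (`[0%R, 1%R]%classic : set R).
Implicit Types (h y : 'rV[R]_N).
Local Open Scope ereal_scope.

Variables (w : 'rV[R]_N -> R) (g : 'I_N -> 'rV[R]_N -> R) (y : 'rV[R]_N).
Variables (rho s p : R) (gam : 'rV[R]_N -> R).
Hypotheses (rho0 : (0 < rho)%R) (s0 : (0 < s)%R) (p1 : (1 < p)%R).
Hypotheses (iw : mu.-integrable setT (EFin \o w)).
Hypotheses (ig : forall i, mu.-integrable setT (EFin \o g i)).
Hypothesis wg : forall f, test_function (cube (rho + s) y) f -> forall i,
  \int[mu]_x (w x * partial i f x)%:E = - \int[mu]_x (g i x * f x)%:E.
Hypotheses (mgam : measurable_fun setT gam) (ggam : forall i x, (`|g i x| <= gam x)%R).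

Let mw : measurable_fun setT w.
Proof. by apply/measurable_EFinP; exact: measurable_int iw. Qed.

Let mp (f : 'rV[R]_N -> R) : measurable_fun setT f ->
  measurable_fun setT (fun x => (f x `^ p)%:E).
Proof.
move=> mf; apply/measurable_EFinP.
exact: (measurableT_comp (measurable_powR p) mf).
Qed.

(** A difference of values is the integral of the gradient along a segment, whose
    [p]-th power Jensen's inequality moves inside; Fubini's theorem and
    translation invariance then remove the segment. *)
Lemma Lp_translation h : cube s 0 h ->
  \int[mu]_(x in cube rho y) (`|w (x + h) - w x| `^ p)%R%:E <=
  ((N%:R * s) `^ p)%:E * \int[mu]_(x in cube (rho + s) y) (gam x `^ p)%:E.
Proof.
move=> hs.
have p0 : (0 <= p)%R by rewrite ltW// (lt_trans ltr01).
have tf := translation_formula rho0 hs iw ig wg.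
pose G x := (\sum_i h ord0 i * g i x)%R.
have mG : measurable_fun setT G.
  apply: measurable_sum => i; apply: measurable_funM => //.
  by apply/measurable_EFinP; exact: measurable_int (ig i).
have gam0 : (0 < N)%N -> forall x, (0 <= gam x)%R.
  by move=> N0 x; exact: le_trans (normr_ge0 _) (ggam (Ordinal N0) x).
have Gle x : (`|G x| `^ p <= (N%:R * s) `^ p * gam x `^ p)%R.
  have [N0|N0] := posnP N.
    rewrite /G big1 ?normr0; last first.
      by case=> i iN _; have := leq_trans iN (eq_leq N0).
    by rewrite powR0 ?gt_eqF ?(lt_trans ltr01)// mulr_ge0 ?powR_ge0.
  rewrite -powRM ?gam0 ?mulr_ge0 ?(ltW s0)//.
  apply: ge0_ler_powR; rewrite ?nnegrE ?mulr_ge0 ?gam0 ?(ltW s0)//.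
  apply: (le_trans (ler_norm_sum _ _ _)).
  apply: (@le_trans _ _ (\sum_(i < N) s * gam x)%R); last first.
    by rewrite sumr_const card_ord -[leLHS]mulr_natl mulrA.
  apply: ler_sum => i _; rewrite normrM ler_pM//.
  by have := hs i; rewrite mxE subr0 => /ltW.
have mgl : measurable_fun setT (fun z : 'rV[R]_N * measurableTypeR R =>
    (gam (z.1 + z.2 *: h)%R `^ p)%:E).
  exact: (measurableT_comp (mp mgam) (measurable_line h)).
have mI : measurable (I01 : set (measurableTypeR R)) by exact: measurable_itv.
pose H x := \int[leb]_(t in I01) (gam (x + t *: h)%R `^ p)%:E.
have gam0' z : 0 <= (gam z `^ p)%:E by rewrite lee_fin powR_ge0.
have mH : measurable_fun setT H.
  exact: (measurable_fubini_tonelli_setF leb mI mgl (fun z => gam0' _)).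
apply: (@le_trans _ _ (\int[mu]_(x in cube rho y) (((N%:R * s) `^ p)%:E * H x))).
  apply: ae_ge0_le_integral.
  - exact: measurable_cube.
  - by move=> x _; rewrite lee_fin powR_ge0.
  - apply: measurable_funTS; apply: mp; apply: measurableT_comp => //.
    apply: measurable_funB => //.
    exact: (measurableT_comp mw (measurable_rV_add h)).
  - move=> x _; rewrite mule_ge0 ?lee_fin ?powR_ge0//.
    by apply: integral_ge0 => t _; rewrite lee_fin powR_ge0.
  - by apply: measurable_funTS; exact: measurable_funeM.
  apply: filterS tf => x xtf /xtf {}xtf.
  have ml : measurable_fun setT (fun t : measurableTypeR R => (x + t *: h)%R).
    exact: (measurableT_comp (measurable_line h) (pair1_measurable x)).
  have mGl : measurable_fun I01 (fun t : measurableTypeR R => G (x + t *: h)%R).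
    by apply: measurable_funTS; exact: (measurableT_comp mG ml).
  have mgaml : measurable_fun I01 (fun t : measurableTypeR R => (gam (x + t *: h) `^ p)%R%:E).
    by apply: measurable_funTS; exact: (measurableT_comp (mp mgam) ml).
  apply: (@le_trans _ _ (\int[leb]_(t in I01) (`|G (x + t *: h)| `^ p)%R%:E)).
    have : (`|w (x + h)%R - w x|)%:E <= \int[leb]_(t in I01) (`|G (x + t *: h)|)%R%:E.
      rewrite -abse_EFin -xtf line_integralE.
      apply: le_trans (le_abse_integral _ _ _) _ => //.
      exact/measurable_EFinP.
    move=> /(power_mean_le p1 mI _ _ _ _ _) /=.
    move=> /(_ 1%R); rewrite powR1 mul1e; apply => //.
      by apply: measurableT_comp mGl.
    by rewrite lebesgue_measure_itv/= lte_fin ltr01 -EFinB subr0.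
  have k0 : 0 <= ((N%:R * s) `^ p)%:E by rewrite lee_fin powR_ge0.
  rewrite /H -(ge0_integralZl leb mI mgaml (fun t _ => gam0' _) k0).
  apply: ge0_le_integral.
  - exact: mI.
  - by move=> t _; rewrite lee_fin powR_ge0.
  - apply/measurable_EFinP; apply: (measurableT_comp (measurable_powR p)).
    exact: measurableT_comp mGl.
  - exact: measurable_funeM.
  - by move=> t _; rewrite -EFinM lee_fin Gle.
rewrite ge0_integralZl//; last 4 first.
- exact: measurable_cube.
- exact: measurable_funTS.
- by move=> x _; apply: integral_ge0 => t _; rewrite lee_fin powR_ge0.
- by rewrite lee_fin powR_ge0.
apply: lee_wpmul2l; first by rewrite lee_fin powR_ge0.
rewrite (fubini_tonelli_set mu leb (measurable_cube _ _) mI mgl); last first.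
  by move=> z; rewrite lee_fin powR_ge0.
set J := leRHS.
apply: (@le_trans _ _ (\int[leb]_(t in I01) J)); last first.
  by rewrite integral_cst//= lebesgue_measure_itv/= lte_fin ltr01 -EFinB subr0 mule1.
apply: ge0_le_integral.
- exact: mI.
- by move=> t _; apply: integral_ge0 => x _; rewrite lee_fin powR_ge0.
- apply: measurable_funTS.
  exact: (measurable_fubini_tonelli_setG mu (measurable_cube _ _) mgl (fun z => gam0' _)).
- exact: measurable_cst.
move=> t t01; rewrite /J.
have ths : cube s 0%R (t *: h) by apply: cube_scale => //; move: t01; rewrite /= in_itv.
exact: (integral_cube_shift_le y rho (mp mgam) gam0' ths).
Qed.

(** If [w] vanishes on half of every cube of half-edge [s], each value of [w] is a
    difference [w x - w (x + h)] for at least half of all [h] in such a cube, so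
    averaging the translation estimate over [h] bounds [w] itself. *)
Lemma poincare_small_support : (forall x, 0 <= w x)%R ->
  mu (cube (rho + s) y `&` [set x | w x != 0%R]) <= ((2 * s) ^+ N / 2)%:E ->
  \int[mu]_(x in cube rho y) (w x `^ p)%:E <=
  (2 * (N%:R * s) `^ p)%:E * \int[mu]_(x in cube (rho + s) y) (gam x `^ p)%:E.
Proof.
move=> w0 half.
pose V := ((2 * s) ^+ N)%R.
have V0 : (0 < V)%R by rewrite exprn_gt0// mulr_gt0.
have mC r z := @measurable_cube R N r z.
pose d (z : 'rV[R]_N * 'rV[R]_N) := (`|w (z.1 + z.2) - w z.1| `^ p)%R%:E.
have madd : measurable_fun setT (fun z : 'rV[R]_N * 'rV[R]_N => (z.1 + z.2)%R).
  apply: measurable_rVP => i; under eq_fun do rewrite mxE.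
  apply: measurable_funD.
    exact: (measurableT_comp (measurable_coord i) measurable_fst).
  exact: (measurableT_comp (measurable_coord i) measurable_snd).
have md : measurable_fun setT d.
  apply/measurable_EFinP; apply: (measurableT_comp (measurable_powR p)).
  apply: measurableT_comp => //; apply: measurable_funB.
    exact: (measurableT_comp mw madd).
  exact: (measurableT_comp mw measurable_fst).
have d0 z : 0 <= d z by rewrite lee_fin powR_ge0.
set J := \int[mu]_(x in cube (rho + s) y) (gam x `^ p)%:E.
have J0 : 0 <= J by apply: integral_ge0 => x _; rewrite lee_fin powR_ge0.
have upper : \int[mu]_(x in cube rho y) \int[mu]_(h in cube s 0%R) d (x, h) <=
    V%:E * (((N%:R * s) `^ p)%:E * J).
  rewrite (fubini_tonelli_set mu mu (mC _ _) (mC _ _) md d0).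
  apply: (@le_trans _ _ (\int[mu]_(h in cube s 0%R) (((N%:R * s) `^ p)%:E * J))).
    apply: ge0_le_integral.
    - exact: measurable_cube.
    - by move=> h _; exact: integral_ge0.
    - apply: measurable_funTS.
      exact: (measurable_fubini_tonelli_setG mu (mC _ _) md d0).
    - exact: measurable_cst.
    - by move=> h hs; exact: Lp_translation.
  by rewrite integral_cst//= lebesgue_cube// muleC.
have lower x : cube rho y x -> (w x `^ p)%:E * (V / 2)%:E <=
    \int[mu]_(h in cube s 0%R) d (x, h).
  move=> xy.
  pose Z := [set h | w (x + h)%R = 0%R] `&` cube s 0%R.
  have mwx : measurable_fun setT (fun h : 'rV[R]_N => w (x + h)%R).
    exact: (measurableT_comp mw (measurableT_comp madd (pair1_measurable x))).
  have mZ' : measurable [set h | w (x + h)%R = 0%R].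
    by have := mwx measurableT _ (measurable_set1 0%R); rewrite setTI.
  have mZ : measurable Z by exact: measurableI.
  pose Y := cube s 0%R `\` [set h | w (x + h)%R = 0%R].
  have mY : measurable Y by exact: measurableD.
  have muY : mu Y <= (V / 2)%:E.
    apply: le_trans half.
    pose S := cube (rho + s) y `&` [set z | w z != 0%R].
    have mS : measurable S.
      apply: measurableI => //.
      rewrite (_ : [set z | w z != 0%R] = ~` (w @^-1` [set 0%R])).
        by apply: measurableC; rewrite -[X in measurable X]setTI; exact: mw.
      by apply/seteqP; split => z /=; [move/eqP|move/eqP].
    have -> : mu S = \int[mu]_z (\1_S (z + x)%R)%:E.
      rewrite (ge0_integral_shift x (f := fun z => (\1_S z)%:E)).
      - by rewrite integral_indic// setIT.
      - by apply/measurable_EFinP; exact: measurable_indic.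
      - by move=> z; rewrite lee_fin.
    have -> : mu Y = \int[mu]_z (\1_Y z)%:E by rewrite integral_indic// setIT.
    apply: ge0_le_integral => //.
    - by apply/measurable_EFinP; exact: measurable_indic.
    - apply/measurable_EFinP.
      have m1S : measurable_fun setT (\1_S : 'rV[R]_N -> R) by exact: measurable_indic.
      exact: (measurableT_comp m1S (measurable_rV_add x)).
    move=> z _; rewrite lee_fin !indicE.
    have [/set_mem[zs wz]|//] := boolP (z \in Y).
    rewrite mem_set//; split; last by rewrite /= addrC; exact/eqP.
    by rewrite [(z + x)%R]addrC; exact: cubeD.
  have muZ : (V / 2)%:E <= mu Z.
    have H : mu (cube s 0%R) = mu Y + mu Z by rewrite (measureDI mu (mC _ _) mZ') setIC.
    rewrite (_ : (V / 2)%:E = V%:E - (V / 2)%:E); last by rewrite -EFinB; congr _%:E; field.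
    by rewrite leeBlDl// -[leLHS](lebesgue_cube 0 s0) H leeD2r.
  apply: (@le_trans _ _ (\int[mu]_(h in Z) (w x `^ p)%:E)).
    by rewrite integral_cst// lee_wpmul2l// lee_fin powR_ge0.
  apply: (@le_trans _ _ (\int[mu]_(h in Z) d (x, h))).
    rewrite le_eqVlt; apply/orP; left; apply/eqP; apply: eq_integral => h /set_mem[/= wh _].
    by rewrite /d/= wh sub0r normrN ger0_norm.
  apply: ge0_subset_integral => //; last by move=> h [].
  apply: measurable_funTS; exact: (measurableT_comp md (pair1_measurable x)).
have : (V / 2)%:E * \int[mu]_(x in cube rho y) (w x `^ p)%:E <=
    V%:E * (((N%:R * s) `^ p)%:E * J).
  apply: le_trans upper; rewrite -ge0_integralZl//; last 3 first.
  - by apply: measurable_funTS; exact: mp.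
  - by move=> x _; rewrite lee_fin powR_ge0.
  - by rewrite lee_fin divr_ge0// ltW.
  apply: ge0_le_integral => //.
  - by move=> x _; rewrite -EFinM lee_fin mulr_ge0 ?powR_ge0// divr_ge0// ltW.
  - by apply: measurable_funeM; apply: measurable_funTS; exact: mp.
  - apply: measurable_funTS.
    exact: (measurable_fubini_tonelli_setF mu (mC _ _) md d0).
  - by move=> x xy; rewrite muleC; exact: lower.
have -> : V%:E * (((N%:R * s) `^ p)%:E * J) =
    (V / 2)%:E * ((2 * (N%:R * s) `^ p)%:E * J).
  by rewrite !muleA -!EFinM; congr (_%:E * _); field.
by rewrite lee_pmul2l// lte_fin divr_gt0.
Qed.


End small_support.

(** * Localization of weak gradients to cubes *)

Section localization.
Context {R : realType} {N : nat}.
Local Notation mu := (@lebesgue_rV R N).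
Implicit Types (E : set 'rV[R]_N) (w : 'rV[R]_N -> R) (g : 'rV[R]_N -> 'rV[R]_N).
Local Open Scope ereal_scope.

Definition cutoff (K : set 'rV[R]_N) w : 'rV[R]_N -> R := fun x => (w x * \1_K x)%R.

Lemma cutoff_in K w x : K x -> cutoff K w x = w x.
Proof. by move=> Kx; rewrite /cutoff indicE mem_set// mulr1. Qed.

Lemma cutoff_out K w x : ~ K x -> cutoff K w x = 0%R.
Proof. by move=> Kx; rewrite /cutoff indicE memNset// mulr0. Qed.

Lemma measurable_closed_cube r y : measurable (@closed_cube R N r y).
Proof. by apply: compact_measurable_rV; exact: closed_cube_compact. Qed.

Lemma integrable_compact E w K : measurable_fun setT w -> Lploc E 1 w ->
  compact K -> K `<=` E -> mu.-integrable K (EFin \o w).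
Proof.
move=> mw [_ wE] cK KE.
apply/integrableP; split; first by apply/measurable_EFinP; exact: measurable_funTS.
apply: le_lt_trans (wE _ cK KE).
rewrite le_eqVlt; apply/orP; left; apply/eqP; apply: eq_integral => x _.
by rewrite /= powRr1.
Qed.

Lemma integrable_cutoff E w K : measurable_fun setT w -> Lploc E 1 w ->
  compact K -> K `<=` E -> mu.-integrable setT (EFin \o cutoff K w).
Proof.
move=> mw wE cK KE; have mK : measurable K by exact: compact_measurable_rV.
have := (integrable_mkcond _ mK).1 (integrable_compact mw wE cK KE).
congr (mu.-integrable _ _).
apply/funext => x; rewrite patchE /= /cutoff indicE.
by case: ifPn => _; rewrite ?mulr1 ?mulr0.
Qed.

Lemma test_function_out (A : set 'rV[R]_N) f x : test_function A f -> ~ A x -> f x = 0%R.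
Proof. by move=> [_ [K [_ KA fK]]] nAx; apply: fK => /KA. Qed.

Lemma weak_gradient_cutoff E w g r y f i : weak_gradient E w g ->
  closed_cube r y `<=` E -> test_function (cube r y) f ->
  \int[mu]_x (cutoff (closed_cube r y) w x * partial i f x)%:E =
  - \int[mu]_x (cutoff (closed_cube r y) (fun x => g x ord0 i) x * f x)%:E.
Proof.
move=> [_ _ wg] KE tf.
have cE : cube r y `<=` E by apply: subset_trans KE; exact: cube_sub_closed.
have := wg f (test_function_sub cE tf) i.
have H (h f' : 'rV[R]_N -> R) : test_function (cube r y) f' ->
    \int[mu]_(x in E) (h x * f' x)%:E =
    \int[mu]_x (cutoff (closed_cube r y) h x * f' x)%:E.
  move=> tf'; rewrite [LHS]integral_mkcond; apply: eq_integral => x _.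
  rewrite patchE; have [Kx|nKx] := pselect (closed_cube r y x).
    by rewrite mem_set ?cutoff_in//; exact: KE.
  rewrite cutoff_out// mul0r (test_function_out tf'); last first.
    by move=> cx; apply: nKx; exact: (cube_sub_closed (lexx r)).
  by rewrite mulr0; case: ifP.
by rewrite (H _ _ (test_function_partial i tf)) (H _ _ tf).
Qed.

Lemma euclidean_norm_ge0 (v : 'rV[R]_N) : (0 <= euclidean_norm v)%R.
Proof. exact: sqrtr_ge0. Qed.

Lemma coord_le_euclidean_norm (v : 'rV[R]_N) i : (`|v ord0 i| <= euclidean_norm v)%R.
Proof.
rewrite -sqrtr_sqr /euclidean_norm ler_wsqrtr// (bigD1 i)//= lerDl.
by apply: sumr_ge0 => j _; exact: sqr_ge0.
Qed.

Lemma measurable_euclidean_norm g :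
  (forall i, measurable_fun setT (fun x => g x ord0 i)) ->
  measurable_fun setT (fun x => euclidean_norm (g x)).
Proof.
move=> mg; apply: (measurableT_comp (continuous_measurable_fun (@sqrt_continuous R))).
by apply: measurable_sum => i; apply: measurable_funX.
Qed.

Lemma poincare_weak_gradient E w g y (rho s p : R) :
  (0 < rho)%R -> (0 < s)%R -> (1 < p)%R ->
  measurable_fun setT w -> (forall i, measurable_fun setT (fun x => g x ord0 i)) ->
  (forall x, 0 <= w x)%R -> weak_gradient E w g -> closed_cube (rho + s) y `<=` E ->
  mu (cube (rho + s) y `&` [set x | w x != 0%R]) <= ((2 * s) ^+ N / 2)%:E ->
  \int[mu]_(x in cube rho y) (w x `^ p)%:E <= (2 * (N%:R * s) `^ p)%:E *
    \int[mu]_(x in cube (rho + s) y) (euclidean_norm (g x) `^ p)%:E.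
Proof.
move=> rho0 s0 p1 mw mg w0 wg KE half.
pose K := closed_cube (rho + s) y; have [Lw Lg _] := wg.
have cK : compact K by exact: closed_cube_compact.
have sub : cube rho y `<=` K by apply: cube_sub_closed; rewrite lerDl ltW.
rewrite (eq_integral (fun x => (cutoff K w x `^ p)%:E)); last first.
  by move=> x /set_mem xy; rewrite cutoff_in//; exact: sub.
apply: (@poincare_small_support R N (cutoff K w)
   (fun i => cutoff K (fun x => g x ord0 i))) => //.
- exact: integrable_cutoff Lw cK KE.
- by move=> i; exact: integrable_cutoff (Lg i) cK KE.
- by move=> f tf i; exact: (weak_gradient_cutoff i wg KE tf).
- exact: measurable_euclidean_norm.
- move=> i x; rewrite /cutoff normrM.
  apply: le_trans (coord_le_euclidean_norm (g x) i).
  by rewrite ler_piMr// indicE; case: (x \in K); rewrite ?normr1 ?normr0.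
- by move=> x; rewrite mulr_ge0.
apply: le_trans half; rewrite le_eqVlt; apply/orP; left; apply/eqP.
congr (mu _); apply/seteqP; split => x [xy /= H]; split=> //; move: H;
  by rewrite /= cutoff_in//; exact: (cube_sub_closed (lexx _)).
Qed.

End localization.

(** * Local boundedness: De Giorgi's iteration *)

Section degiorgi.
Context {R : realType} {N : nat}.
Local Notation mu := (@lebesgue_rV R N).

Definition below (u : 'rV[R]_N -> R) (k : R) : 'rV[R]_N -> R :=
  fun x => Num.max (k - u x) 0.

(** De Giorgi's class for a Borel function, with a Borel gradient chosen for the
    truncation at each level. *)
Record borel_DG (E : set 'rV[R]_N) (p gamma : R) (u : 'rV[R]_N -> R)
    (g : R -> 'rV[R]_N -> 'rV[R]_N) : Prop := BorelDG {
  bDG_fun : measurable_fun setT u ;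
  bDG_grad : forall k i, measurable_fun setT (fun x => g k x ord0 i) ;
  bDG_Lp : forall k, Lploc E p (below u k) ;
  bDG_weak : forall k, weak_gradient E (below u k) (g k) ;
  bDG_energy : forall k y rho r, 0 < rho -> rho < r -> cube r y `<=` E ->
    (\int[mu]_(x in cube rho y) (euclidean_norm (g k x) `^ p)%:E <=
     (gamma / (r - rho) `^ p)%:E * \int[mu]_(x in cube r y) (below u k x `^ p)%:E)%E
}.

Lemma below_ge0 u k x : 0 <= below u k x.
Proof. by rewrite /below le_max lexx orbT. Qed.

Lemma measurable_below u k : measurable_fun setT u ->
  measurable_fun setT (below u k).
Proof. by move=> mu_; apply: measurable_maxr => //; exact: measurable_funB. Qed.

Lemma measurable_lt_level (u : 'rV[R]_N -> R) (k : R) : measurable_fun setT u ->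
  measurable_fun setT (fun x => (u x < k)%R%:R : R).
Proof.
move=> mu_; apply: (measurableT_comp (f := fun b : bool => (b%:R : R)))=> //.
exact: measurable_fun_ltr.
Qed.

Lemma le_below u (k l : R) x : k <= l -> below u k x <= below u l x.
Proof. by move=> kl; rewrite /below ge_max !le_max lerB// lexx orbT. Qed.

(** [eps] is the length of the first translation relative to the edge. It is
    small enough for the contraction in De Giorgi's step to beat the decay of the
    smallness condition, whose factor per step is the right-hand side. *)
Lemma step_constant (p gamma : R) : 1 < p -> 0 < gamma -> exists eps : R,
  [/\ 0 < eps, eps <= 8^-1 &
      2 * gamma * (8 * N%:R * eps) `^ p <= 2^-1 `^ p * (4 ^- N)].
Proof.
move=> p1 gamma0; have p0 : 0 < p by rewrite (lt_trans ltr01).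
pose c := 2^-1 `^ p * (4 ^- N) / (2 * gamma) : R.
have c0 : 0 < c by rewrite divr_gt0 ?mulr_gt0 ?powR_gt0 ?invr_gt0 ?exprn_gt0.
have N1 : 0 < 8 * N.+1%:R :> R by rewrite mulr_gt0.
exists (Num.min 8^-1 (c `^ p^-1 / (8 * N.+1%:R))); split.
- by rewrite lt_min invr_gt0 divr_gt0 ?powR_gt0//= ltr0n.
- by rewrite ge_min lexx.
rewrite mulrC -ler_pdivlMr ?mulr_gt0// -/c.
have {2}-> : c = (c `^ p^-1) `^ p.
  by rewrite -powRrM mulVf ?gt_eqF// powRr1// ltW.
have m0 : 0 <= Num.min 8^-1 (c `^ p^-1 / (8 * N.+1%:R)).
  by rewrite le_min invr_ge0 divr_ge0 ?powR_ge0 ?(ltW N1)//= ler0n.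
apply: ge0_ler_powR; rewrite ?nnegrE ?powR_ge0 ?(ltW p0)//.
  by rewrite mulr_ge0 ?mulr_ge0.
apply: (@le_trans _ _ (8 * N.+1%:R * (c `^ p^-1 / (8 * N.+1%:R)))).
  by rewrite ler_pM ?mulr_ge0 ?ler_pM2l ?ler_nat ?ge_min ?lexx ?orbT.
by rewrite mulrC divfK// gt_eqF.
Qed.

Variables (E : set 'rV[R]_N) (p gamma : R) (u : 'rV[R]_N -> R).
Variable g : R -> 'rV[R]_N -> 'rV[R]_N.
Hypotheses (p1 : 1 < p) (gamma0 : 0 < gamma) (DGu : borel_DG E p gamma u g).

Let p0 : 0 < p. Proof. exact: lt_trans ltr01 p1. Qed.

Let mu_ : measurable_fun setT u. Proof. exact: bDG_fun DGu. Qed.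

Lemma measurable_below_powR k :
  measurable_fun setT (fun x => (below u k x `^ p)%:E).
Proof.
apply/measurable_EFinP; apply: (measurableT_comp (measurable_powR p)).
exact: measurable_below.
Qed.

Let mC r (z : 'rV[R]_N) := @measurable_cube R N r z.

Lemma le_integral_below k l r s y : k <= l -> r <= s ->
  (\int[mu]_(x in cube r y) (below u k x `^ p)%:E <=
   \int[mu]_(x in cube s y) (below u l x `^ p)%:E)%E.
Proof.
move=> kl rs.
apply: (@le_trans _ _ (\int[mu]_(x in cube s y) (below u k x `^ p)%:E)%E).
  apply: ge0_subset_integral => //.
  - by apply: measurable_funTS; exact: measurable_below_powR.
  - by move=> x _; rewrite lee_fin powR_ge0.
  - exact: sub_cube.
apply: ge0_le_integral => //.
- by move=> x _; rewrite lee_fin powR_ge0.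
- by apply: measurable_funTS; exact: measurable_below_powR.
- by apply: measurable_funTS; exact: measurable_below_powR.
move=> x _; rewrite lee_fin; apply: ge0_ler_powR; rewrite ?nnegrE ?below_ge0 ?(ltW p0)//.
exact: le_below.
Qed.

(** One step: passing from level [l] on the cube of half-edge [r] to the lower
    level [k] on a cube whose half-edge is smaller by more than [s] gains the
    factor [(s / gap) ^ p], as soon as [u] is below [k] on a small set only. *)
Lemma degiorgi_step k l y (rho s r gap : R) : 0 < rho -> 0 < s -> k < l -> 0 < gap ->
  rho + s + gap <= r -> cube r y `<=` E ->
  (\int[mu]_(x in cube r y) (below u l x `^ p)%:E <=
    ((2 * s) ^+ N / 2 * (l - k) `^ p)%:E)%E ->
  (\int[mu]_(x in cube rho y) (below u k x `^ p)%:E <=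
    (2 * gamma * (N%:R * s / gap) `^ p)%:E *
    \int[mu]_(x in cube r y) (below u l x `^ p)%:E)%E.
Proof.
move=> rho0 s0 kl gap0 rhor rE small.
have rsr : rho + s < r by rewrite (lt_le_trans _ rhor)// ltrDl.
have lk0 : 0 < (l - k) `^ p by rewrite powR_gt0// subr_gt0.
set Y := (\int[mu]_(x in cube r y) (below u l x `^ p)%:E)%E in small *.
have Y0 : (0 <= Y)%E by apply: integral_ge0 => x _; rewrite lee_fin powR_ge0.
have half : (mu (cube (rho + s) y `&` [set x | below u k x != 0%R]) <=
    ((2 * s) ^+ N / 2)%:E)%E.
  set S := _ `&` _.
  have mS : measurable S.
    apply: measurableI => //.
    rewrite (_ : [set x | _] = ~` (below u k @^-1` [set 0%R])).
      apply: measurableC; rewrite -[X in measurable X]setTI.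
      by apply: measurable_below => //; exact: measurable_set1.
    by apply/seteqP; split => z /=; [move/eqP|move/eqP].
  have H : (((l - k) `^ p)%:E * mu S <= Y)%E.
    rewrite -integral_cst//.
    apply: (@le_trans _ _ (\int[mu]_(x in S) (below u l x `^ p)%:E)%E).
      apply: ge0_le_integral => //.
      - by move=> x _; rewrite lee_fin ltW.
      - by apply: measurable_funTS; exact: measurable_below_powR.
      move=> x [_ /= ux]; rewrite lee_fin; apply: ge0_ler_powR.
      - exact: ltW.
      - by rewrite nnegrE subr_ge0 ltW.
      - by rewrite nnegrE below_ge0.
      move: ux; rewrite /below; case: (leP (k - u x) 0); first by rewrite eqxx.
      by rewrite subr_gt0 => /ltW uk _; rewrite le_max lerB.
    apply: ge0_subset_integral => //.
    - by apply: measurable_funTS; exact: measurable_below_powR.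
    - by move=> x _; rewrite lee_fin powR_ge0.
    - by move=> x [xy _]; apply: sub_cube xy; exact: ltW.
  have := le_trans H small; rewrite EFinM muleC.
  by rewrite lee_pmul2r.
apply: (le_trans (poincare_weak_gradient (s := s) rho0 s0 p1 _ _ _ (bDG_weak DGu k) _ half)).
- exact: measurable_below.
- exact: bDG_grad DGu k.
- by move=> x; exact: below_ge0.
- by apply: subset_trans rE; exact: closed_cube_sub.
have rs0 : 0 < rho + s by rewrite addr_gt0.
apply: (@le_trans _ _ ((2 * (N%:R * s) `^ p)%:E * ((gamma / (r - (rho + s)) `^ p)%:E * Y))%E).
  apply: lee_wpmul2l; first by rewrite lee_fin mulr_ge0// powR_ge0.
  apply: le_trans (bDG_energy DGu k rs0 rsr rE) _.
  apply: lee_wpmul2l; first by rewrite lee_fin divr_ge0 ?powR_ge0// ltW.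
  by apply: le_integral_below => //; exact: ltW.
rewrite muleA -EFinM; apply: lee_wpmul2r => //; rewrite lee_fin.
have gapV : gap^-1 `^ p = (gap `^ p)^-1.
  by rewrite -[gap^-1]powR_inv1 ?ltW// -powRrM mulN1r powRN.
rewrite (@powRM _ (N%:R * s) gap^-1) ?invr_ge0 ?mulr_ge0 ?(ltW s0) ?(ltW gap0)// gapV.
rewrite [leLHS](_ : _ = 2 * gamma * ((N%:R * s) `^ p * ((r - (rho + s)) `^ p)^-1)); last by ring.
rewrite ler_wpM2l ?mulr_ge0 ?(ltW gamma0)// ler_wpM2l ?powR_ge0//.
have gr : gap <= r - (rho + s) by rewrite lerBrDl.
rewrite lef_pV2 ?posrE ?powR_gt0//; last by rewrite (lt_le_trans gap0).
by apply: ge0_ler_powR; rewrite ?nnegrE ?(ltW p0) ?(ltW gap0)// (le_trans (ltW gap0)).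
Qed.

End degiorgi.

Section local_boundedness.
Context {R : realType} {N : nat}.
Local Notation mu := (@lebesgue_rV R N).

Variables (p gamma eps : R).
Hypotheses (p1 : 1 < p) (gamma0 : 0 < gamma) (eps0 : 0 < eps) (eps8 : eps <= 8^-1).
Hypothesis epsC : 2 * gamma * (8 * N%:R * eps) `^ p <= 2^-1 `^ p * 4 ^- N.

Let p0 : 0 < p. Proof. exact: lt_trans ltr01 p1. Qed.

(** Decay factor of the smallness condition per step: [b] for halving the distance
    between levels, [4 ^- N] for the volume of the translations. *)
Let b : R := 2^-1 `^ p.
Let q : R := b * 4 ^- N.

Let b0 : 0 < b. Proof. by rewrite powR_gt0. Qed.

Let q0 : 0 < q. Proof. by rewrite mulr_gt0// invr_gt0 exprn_gt0. Qed.

Let q1 : q < 1.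
Proof.
have b1 : b < 1.
  have : b < 1 `^ p.
    by apply: gt0_ltr_powR; rewrite ?nnegrE ?invr_ge0// invf_lt1// ltr1n.
  by rewrite powR1.
rewrite (le_lt_trans _ b1)// ler_piMr ?(ltW b0)// invf_le1 ?exprn_gt0//.
by rewrite exprn_ege1// ler1n.
Qed.

Let half_powR j : (2^-1 ^+ j) `^ p = b ^+ j.
Proof.
elim: j => [|j IH]; first by rewrite !expr0 powR1.
by rewrite !exprS powRM ?invr_ge0 ?exprn_ge0// IH.
Qed.

Let four j : (2^-1 ^+ j * 2^-1 ^+ j) ^+ N = (4 ^- N) ^+ j :> R.
Proof.
rewrite -exprMn -exprM mulnC exprM; congr (_ ^+ j).
by rewrite -exprVn; congr (_ ^+ N); field.
Qed.

Section iteration.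
Variables (E : set 'rV[R]_N) (u : 'rV[R]_N -> R) (g : R -> 'rV[R]_N -> 'rV[R]_N).
Hypothesis DGu : borel_DG E p gamma u g.

Let mu_ : measurable_fun setT u. Proof. exact: bDG_fun DGu. Qed.

(** De Giorgi's iteration along the levels [k - M (1 - 2 ^- j)] and the
    half-edges [r / 2 (1 + 2 ^- j)]. Because the translation distance can be
    chosen freely at each step, here proportional to [4 ^- j], the decay is
    geometric from the start. *)
Lemma degiorgi_Lp y r k M : 0 < r -> 0 < M -> cube r y `<=` E ->
  (\int[mu]_(x in cube r y) (below u k x `^ p)%:E <=
    (M `^ p * ((2 * eps * r) ^+ N / 2 * b))%:E)%E ->
  {ae mu, forall x, cube (r / 2) y x -> below u k x <= M}.
Proof.
move=> r0 M0 rE Y0.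
set X := M `^ p * _ in Y0.
have X0 : 0 <= X.
  by rewrite !mulr_ge0 ?powR_ge0 ?(ltW b0)// exprn_ge0// !mulr_ge0 ?(ltW r0) ?(ltW eps0).
pose h j : R := 2^-1 ^+ j.
have h0 j : 0 < h j by rewrite exprn_gt0.
have h1 j : h j <= 1 by rewrite exprn_ile1// invf_le1// ler1n.
have hS j : h j.+1 = h j / 2 by rewrite /h exprSr.
pose rr j := r / 2 * (1 + h j).
pose kk j := k - M * (1 - h j).
pose Y j := (\int[mu]_(x in cube (rr j) y) (below u (kk j) x `^ p)%:E)%E.
have YX j : (Y j <= (q ^+ j * X)%:E)%E.
  elim: j => [|j IH].
    rewrite /Y /rr /kk /h expr0 subrr mulr0 subr0 expr0 mul1r.
    by have -> : r / 2 * (1 + 1) = r by field.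
  pose s := eps * r * (h j * h j); pose gap := r * h j / 8.
  have s0 : 0 < s by rewrite !mulr_gt0.
  have gap0 : 0 < gap by rewrite divr_gt0// mulr_gt0.
  have kl : kk j - kk j.+1 = M * h j / 2 by rewrite /kk hS; field.
  have step : (Y j.+1 <= (2 * gamma * (N%:R * s / gap) `^ p)%:E * Y j)%E.
    apply: (degiorgi_step p1 gamma0 DGu (s := s) (gap := gap)) => //.
    - by rewrite mulr_gt0 ?divr_gt0// addr_gt0.
    - by rewrite -subr_gt0 kl divr_gt0// mulr_gt0.
    - have : eps * r * (h j * h j) <= r * h j / 8.
        have -> : r * h j / 8 = 8^-1 * r * (h j * 1) by ring.
        rewrite ler_pM ?mulr_ge0 ?(ltW eps0) ?(ltW r0) ?(ltW (h0 _))//.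
          by rewrite ler_wpM2r// ltW.
        by rewrite ler_wpM2l// ltW.
      by rewrite /rr /s /gap hS; lra.
    - apply: subset_trans rE; apply: sub_cube; rewrite /rr.
      by rewrite -[leRHS](divfK (x := 2))// ler_wpM2l ?divr_ge0 ?(ltW r0)// -[leRHS]/(1 + 1) lerD2l.
    - apply: (le_trans IH); rewrite lee_fin kl.
      rewrite [M * h j / 2]mulrC -mulrA powRM ?mulr_ge0 ?(ltW M0) ?(ltW (h0 _))//.
      rewrite powRM ?(ltW M0) ?(ltW (h0 _))// half_powR -/b.
      rewrite (_ : 2 * s = 2 * eps * r * (h j * h j)); last by rewrite /s; ring.
      rewrite (@exprMn _ N (2 * eps * r)) four /X /q exprMn.
      by rewrite le_eqVlt; apply/orP; left; apply/eqP; ring.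
  apply: (le_trans step).
  have qle : 2 * gamma * (N%:R * s / gap) `^ p <= q.
    apply: le_trans epsC; rewrite ler_wpM2l ?mulr_ge0 ?(ltW gamma0)//.
    have -> : N%:R * s / gap = 8 * N%:R * eps * h j.
      by rewrite /s /gap; field; rewrite !gt_eqF.
    apply: ge0_ler_powR; rewrite ?nnegrE ?(ltW p0)//.
    - by rewrite !mulr_ge0 ?(ltW eps0) ?(ltW (h0 _)).
    - by rewrite !mulr_ge0 ?(ltW eps0).
    - by rewrite ler_piMr// !mulr_ge0 ?(ltW eps0).
  apply: (le_trans (lee_wpmul2l _ IH)).
    by rewrite lee_fin !mulr_ge0 ?powR_ge0 ?(ltW gamma0).
  rewrite -EFinM lee_fin exprS -[leRHS]mulrA ler_wpM2r// mulr_ge0//.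
  by rewrite exprn_ge0// ltW.
set I := (\int[mu]_(x in cube (r / 2) y) (below u (k - M) x `^ p)%:E)%E.
have I0 : (0 <= I)%E by apply: integral_ge0 => x _; rewrite lee_fin powR_ge0.
have IX j : (I <= (q ^+ j * X)%:E)%E.
  apply: le_trans (YX j); apply: (le_integral_below p1 DGu).
    by rewrite /kk lerD2l lerN2 ler_piMr ?(ltW M0)// gerBl ltW.
  by rewrite /rr ler_peMr ?divr_ge0 ?(ltW r0)// lerDl ltW.
have I00 : I = 0%E.
  have Ifin : I \is a fin_num by rewrite ge0_fin_numE// (le_lt_trans (IX 0%N))// ltry.
  apply/eqP; rewrite eq_le I0 andbT -(fineK Ifin) lee_fin.
  have cv : (fun j => q ^+ j * X) @ \oo --> (0 : R).
    rewrite -(mul0r X); apply: cvgM; last exact: cvg_cst.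
    by apply: cvg_expr; rewrite ger0_norm// ltW.
  apply: (cvgr_to_ge cv); apply: nearW => j.
  by rewrite -lee_fin fineK.
have : ae_eq mu (cube (r / 2) y) (fun x => (below u (k - M) x `^ p)%:E) (cst 0%E).
  apply/ae_eq_integral_abs.
  - exact: measurable_cube.
  - by apply: measurable_funTS; exact: (measurable_below_powR DGu).
  - rewrite -I00; apply: eq_integral => x _.
    by rewrite gee0_abs// lee_fin powR_ge0.
apply: filterS => x /[apply] -[/powR_eq0_eq0].
rewrite /below => H.
have : k - M - u x <= 0 by rewrite -H le_max lexx.
by move=> H2; rewrite ge_max (ltW M0) andbT; lra.
Qed.

Lemma ae_foralln (P : nat -> 'rV[R]_N -> Prop) :
  (forall n, {ae mu, forall x, P n x}) -> {ae mu, forall x, forall n, P n x}.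
Proof.
move=> nP; have := negligible_bigcup (fun n => nP n); apply: negligibleS => x /=.
by move=> /existsNP[n nPx]; exists n.
Qed.

Lemma Lp_below_finite k y r : cube r y `<=` E -> forall t, t < r ->
  (\int[mu]_(x in cube t y) (below u k x `^ p)%:E < +oo)%E.
Proof.
move=> rE t tr; have [_ Lw] := bDG_Lp DGu k.
have sub : closed_cube t y `<=` E by apply: subset_trans rE; exact: closed_cube_sub.
have L1 := Lw _ (@closed_cube_compact R N t y) sub; apply: le_lt_trans L1.
rewrite [leRHS](eq_integral (fun x => (below u k x `^ p)%:E)); last first.
  by move=> x _; rewrite ger0_norm// below_ge0.
apply: ge0_subset_integral => //.
- exact: measurable_cube.
- exact: measurable_closed_cube.
- by apply: measurable_funTS; exact: (measurable_below_powR DGu).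
- by move=> x _; rewrite lee_fin powR_ge0.
- exact: cube_sub_closed.
Qed.

(** The iteration applied at every centre in the smaller cube. *)
Lemma degiorgi_Lp_cubes y s r k M : s < r -> 0 < M -> cube r y `<=` E ->
  (\int[mu]_(x in cube r y) (below u k x `^ p)%:E <=
    (M `^ p * ((2 * eps * (r - s)) ^+ N / 2 * b))%:E)%E ->
  {ae mu, forall x, cube s y x -> below u k x <= M}.
Proof.
move=> sr M0 rE small; apply: ae_local => x xy.
have rs0 : 0 < r - s by rewrite subr_gt0.
exists ((r - s) / 2); first by rewrite divr_gt0.
have sub : cube (r - s) x `<=` cube r y.
  by have := sub_cube_center (s := r - s) xy; rewrite [s + _]addrC subrK.
apply: degiorgi_Lp => //; first exact: subset_trans rE.
apply: le_trans small; apply: ge0_subset_integral => //.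
- exact: measurable_cube.
- exact: measurable_cube.
- by apply: measurable_funTS; exact: (measurable_below_powR DGu).
- by move=> z _; rewrite lee_fin powR_ge0.
Qed.

(** Interpolation: a bound [S] on the larger cube improves on a smaller one. *)
Lemma degiorgi_improve y s r k (S L theta : R) : s < r -> cube r y `<=` E ->
  0 < S -> 0 < theta -> 0 <= L ->
  (\int[mu]_(x in cube r y) (below u k x)%:E <= L%:E)%E ->
  {ae mu, forall x, cube r y x -> below u k x <= S} ->
  {ae mu, forall x, cube s y x -> below u k x <=
     theta * S + theta `^ (1 - p) * L / ((2 * eps * (r - s)) ^+ N / 2 * b)}.
Proof.
move=> sr rE S0 theta0 L0 intL bS.
set c := (_ ^+ N / 2 * b).
have c0 : 0 < c by rewrite !mulr_gt0// exprn_gt0// !mulr_gt0// subr_gt0.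
have t0 : 0 < theta `^ (1 - p) by rewrite powR_gt0.
set M := (theta * S + _).
have tS0 : 0 < theta * S by rewrite mulr_gt0.
have M1 : theta * S <= M by rewrite lerDl divr_ge0 ?(ltW c0)// mulr_ge0// ltW.
have M0 : 0 < M by exact: lt_le_trans M1.
apply: (degiorgi_Lp_cubes (r := r)) => //; rewrite -/c.
apply: (@le_trans _ _ (\int[mu]_(x in cube r y) ((S `^ (p - 1))%:E * (below u k x)%:E))%E).
  apply: ae_ge0_le_integral.
  - exact: measurable_cube.
  - by move=> x _; rewrite lee_fin powR_ge0.
  - by apply: measurable_funTS; exact: (measurable_below_powR DGu).
  - by move=> x _; rewrite -EFinM lee_fin mulr_ge0 ?powR_ge0 ?below_ge0.
  - apply: measurable_funeM; apply: measurable_funTS; apply/measurable_EFinP.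
    exact: measurable_below.
  apply: filterS bS => x /[apply] xS; rewrite -EFinM lee_fin.
  rewrite -(mulr_powRB1 (below_ge0 u k x) p0) mulrC ler_wpM2r ?below_ge0//.
  by apply: ge0_ler_powR; rewrite ?nnegrE ?below_ge0 ?subr_ge0 ?(ltW p1) ?(ltW S0).
rewrite ge0_integralZl//; last 4 first.
- exact: measurable_cube.
- by apply: measurable_funTS; apply/measurable_EFinP; exact: measurable_below.
- by move=> x _; rewrite lee_fin below_ge0.
- by rewrite lee_fin powR_ge0.
apply: (le_trans (lee_wpmul2l _ intL)); first by rewrite lee_fin powR_ge0.
rewrite -EFinM lee_fin -(mulr_powRB1 (ltW M0) p0).
have H1 : (theta * S) `^ (p - 1) <= M `^ (p - 1).
  by apply: ge0_ler_powR; rewrite ?nnegrE ?subr_ge0 ?(ltW p1) ?(ltW tS0) ?(ltW M0).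
have H2 : theta `^ (1 - p) * L / c <= M by rewrite lerDr ltW.
apply: (@le_trans _ _ (theta `^ (1 - p) * L / c * (theta * S) `^ (p - 1) * c)).
  have pN : 1 - p = - (p - 1) by rewrite opprB.
  rewrite powRM ?(ltW theta0) ?(ltW S0)// pN powRN.
  have tn0 : theta `^ (p - 1) != 0 by rewrite gt_eqF// powR_gt0.
  rewrite le_eqVlt; apply/orP; left; apply/eqP; field.
  by rewrite tn0 gt_eqF.
rewrite ler_wpM2r ?(ltW c0)//; apply: ler_pM => //.
  by rewrite divr_ge0 ?(ltW c0)// mulr_ge0// ltW.
exact: powR_ge0.
Qed.

(** The volume factors grow by [2 ^+ N] when a gap is halved; with this weight
    their sum is still a geometric series of ratio one half. *)
Let theta : R := 2^-1 ^+ N.+1.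

Let theta0 : 0 < theta. Proof. by rewrite exprn_gt0. Qed.

Definition sup_const : R := 2 * (theta `^ (1 - p) / ((eps / 4) ^+ N / 2 * b)).

Lemma sup_const_gt0 : 0 < sup_const.
Proof.
by rewrite mulr_gt0// divr_gt0 ?powR_gt0// mulr_gt0// divr_gt0// exprn_gt0// divr_gt0.
Qed.

(** Iterating the interpolation along increasing cubes absorbs the finite but
    uncontrolled initial bound. *)
Lemma degiorgi_sup y r k L : 0 < r -> cube r y `<=` E -> 0 <= L ->
  (\int[mu]_(x in cube r y) (below u k x)%:E <= L%:E)%E ->
  {ae mu, forall x, cube (r / 2) y x -> below u k x <= sup_const * L / r ^+ N}.
Proof.
move=> r0 rE L0 intL.
pose h j : R := 2^-1 ^+ j.
have h0 j : 0 < h j by rewrite exprn_gt0.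
have h1 j : h j <= 1 by rewrite exprn_ile1// invf_le1// ler1n.
have hS j : h j.+1 = h j / 2 by rewrite /h exprSr.
pose sg j := r / 2 + r / 4 * (1 - h j).
pose A := theta `^ (1 - p) / ((eps / 4) ^+ N / 2 * b) * (L / r ^+ N).
have A0 : 0 <= A.
  rewrite mulr_ge0// divr_ge0 ?powR_ge0 ?exprn_ge0 ?(ltW r0)//.
  by rewrite mulr_ge0 ?(ltW b0)// divr_ge0// exprn_ge0// divr_ge0// ltW.
have sgS j : sg j.+1 - sg j = r * h j / 8 by rewrite /sg hS; field.
have claim n S : 0 < S ->
    {ae mu, forall x, cube (sg n) y x -> below u k x <= S} ->
    {ae mu, forall x, cube (r / 2) y x ->
      below u k x <= theta ^+ n * S + 2 * A * (1 - h n)}.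
  elim: n S => [|n IH] S S0 bS.
    move: bS; rewrite /sg /h !expr0 subrr !mulr0 !addr0 mul1r.
    by [].
  have gap : sg n < sg n.+1 by rewrite -subr_gt0 sgS divr_gt0// mulr_gt0.
  have sgr : sg n.+1 <= r.
    rewrite /sg; have := h0 n.+1; have := mulr_gt0 r0 (h0 n.+1); lra.
  have sE : cube (sg n.+1) y `<=` E by apply: subset_trans rE; exact: sub_cube.
  have intL' : (\int[mu]_(x in cube (sg n.+1) y) (below u k x)%:E <= L%:E)%E.
    apply: le_trans intL; apply: ge0_subset_integral => //.
    - exact: measurable_cube.
    - exact: measurable_cube.
    - by apply: measurable_funTS; apply/measurable_EFinP; exact: measurable_below.
    - by move=> x _; rewrite lee_fin below_ge0.
    - exact: sub_cube.
  have := degiorgi_improve gap sE S0 theta0 L0 intL' bS.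
  have -> : theta `^ (1 - p) * L / ((2 * eps * (sg n.+1 - sg n)) ^+ N / 2 * b) =
      A * (2 ^+ N) ^+ n.
    rewrite sgS /A.
    have -> : 2 * eps * (r * h n / 8) = eps / 4 * r * h n by field.
    rewrite !exprMn.
    have -> : h n ^+ N = ((2 ^+ N) ^+ n)^-1 by rewrite /h !exprVn -!exprM mulnC.
    by field; rewrite ?gt_eqF ?exprn_gt0// ?divr_gt0.
  move=> bS'.
  have S'0 : 0 < theta * S + A * (2 ^+ N) ^+ n.
    by rewrite ltr_pwDl ?mulr_gt0// mulr_ge0// exprn_ge0// exprn_ge0.
  have := IH _ S'0 bS'; apply: filterS => x /[apply] H; apply: (le_trans H).
  have th2 : theta ^+ n * (2 ^+ N) ^+ n = h n.
    rewrite -exprMn /h; congr (_ ^+ n).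
    by rewrite /theta exprS -mulrA -exprMn mulVf ?pnatr_eq0// expr1n mulr1.
  rewrite mulrDr [theta ^+ n * (A * _)]mulrCA th2 exprSr hS.
  by rewrite le_eqVlt; apply/orP; left; apply/eqP; field.
have [S S0 bS] : exists2 S, 0 < S &
    {ae mu, forall x, cube (3 / 4 * r) y x -> below u k x <= S}.
  have r78 : 7 / 8 * r < r by lra.
  have sr : 3 / 4 * r < 7 / 8 * r by lra.
  have sE : cube (7 / 8 * r) y `<=` E by apply: subset_trans rE; apply: sub_cube; lra.
  have fin := Lp_below_finite k rE r78.
  set Y := (\int[mu]_(x in _) _)%E in fin.
  have Y0 : (0 <= Y)%E by apply: integral_ge0 => x _; rewrite lee_fin powR_ge0.
  pose c := (2 * eps * (7 / 8 * r - 3 / 4 * r)) ^+ N / 2 * b.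
  have c0 : 0 < c by rewrite !mulr_gt0// exprn_gt0// !mulr_gt0// subr_gt0.
  have fY0 : 0 <= fine Y / c by rewrite divr_ge0 ?fine_ge0 ?(ltW c0).
  exists ((fine Y / c) `^ p^-1 + 1); first by rewrite ltr_pwDr// powR_ge0.
  apply: (degiorgi_Lp_cubes sr) => //; first by rewrite ltr_pwDr// powR_ge0.
  rewrite -/c -/Y -(fineK (x := Y)) ?ge0_fin_numE// lee_fin.
  rewrite -ler_pdivrMr//.
  have {1}-> : fine Y / c = ((fine Y / c) `^ p^-1) `^ p.
    by rewrite -powRrM mulVf ?gt_eqF// powRr1.
  apply: ge0_ler_powR; rewrite ?nnegrE ?powR_ge0 ?addr_ge0 ?powR_ge0 ?(ltW p0)//.
  by rewrite lerDl.
have all_n : {ae mu, forall x, forall n, cube (r / 2) y x ->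
      below u k x <= theta ^+ n * S + 2 * A}.
  apply: ae_foralln => n.
  have : {ae mu, forall x, cube (sg n) y x -> below u k x <= S}.
    apply: filterS bS => x + xn; apply; apply: sub_cube xn.
    by rewrite /sg; have := mulr_gt0 r0 (h0 n); lra.
  move=> /(claim n S S0); apply: filterS => x /[apply] H.
  apply: (le_trans H); rewrite lerD2l; apply: ler_piMr; first by rewrite mulr_ge0.
  by have := h0 n; lra.
apply: filterS all_n => x xall xy.
have -> : sup_const * L / r ^+ N = 0 + 2 * A by rewrite /A /sup_const; ring.
have th1 : `|theta| < 1.
  by rewrite ger0_norm ?(ltW theta0)// exprn_ilt1// invf_lt1// ltr1n.
have cv : (fun n => theta ^+ n * S + 2 * A) @ \oo --> 0 + 2 * A.
  apply: cvgD; last exact: cvg_cst.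
  rewrite -(mul0r S); apply: cvgM; last exact: cvg_cst.
  exact: cvg_expr.
by apply: (cvgr_to_ge cv); apply: nearW => n; exact: xall.
Qed.

Lemma degiorgi_sup_cubes y s r k L : s < r -> cube r y `<=` E -> 0 <= L ->
  (\int[mu]_(x in cube r y) (below u k x)%:E <= L%:E)%E ->
  {ae mu, forall x, cube s y x -> below u k x <= sup_const * L / (r - s) ^+ N}.
Proof.
move=> sr rE L0 intL; apply: ae_local => x xy.
have rs0 : 0 < r - s by rewrite subr_gt0.
exists ((r - s) / 2); first by rewrite divr_gt0.
have sub : cube (r - s) x `<=` cube r y.
  by have := sub_cube_center (s := r - s) xy; rewrite [s + _]addrC subrK.
apply: degiorgi_sup => //; first exact: subset_trans rE.
apply: le_trans intL; apply: ge0_subset_integral => //.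
- exact: measurable_cube.
- exact: measurable_cube.
- by apply: measurable_funTS; apply/measurable_EFinP; exact: measurable_below.
- by move=> z _; rewrite lee_fin below_ge0.
Qed.

Definition energy_const : R := gamma * 2 `^ p * (sup_const * 2 ^+ N) `^ p * 2 ^+ N.

Lemma energy_const_gt0 : 0 < energy_const.
Proof.
rewrite /energy_const !mulr_gt0 ?powR_gt0 ?exprn_gt0//.
by rewrite mulr_gt0 ?sup_const_gt0 ?exprn_gt0.
Qed.

(** The energy of each truncation is controlled by its mean, to which it is
    homogeneous of degree [p]; means, unlike [p]-energies, add up over levels. *)
Lemma energy_mean y rho r k L : 0 < rho -> rho < r -> cube r y `<=` E -> 0 <= L ->
  (\int[mu]_(x in cube r y) (below u k x)%:E <= L%:E)%E ->
  (\int[mu]_(x in cube rho y) (euclidean_norm (g k x) `^ p)%:E <=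
   (energy_const / (r - rho) `^ p * r ^+ N * (L / (r - rho) ^+ N) `^ p)%:E)%E.
Proof.
move=> rho0 rhor rE L0 intL.
pose m := (rho + r) / 2.
have rhom : rho < m by rewrite /m; lra.
have mr : m < r by rewrite /m; lra.
have m0 : 0 < m by exact: lt_trans rhom.
have rr0 : 0 < r - rho by rewrite subr_gt0.
have mE : cube m y `<=` E by apply: subset_trans rE; apply: sub_cube; exact: ltW.
have bnd := degiorgi_sup_cubes mr rE L0 intL.
apply: (le_trans (bDG_energy DGu k rho0 rhom mE)).
set S := sup_const * L / _ in bnd.
have S0 : 0 <= S.
  have rm0 : 0 <= r - m by rewrite subr_ge0 ltW.
  apply: divr_ge0; last exact: exprn_ge0.
  by apply: mulr_ge0 => //; rewrite ltW// sup_const_gt0.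
have H : (\int[mu]_(x in cube m y) (below u k x `^ p)%:E <= (S `^ p * (2 * r) ^+ N)%:E)%E.
  apply: (@le_trans _ _ (\int[mu]_(x in cube m y) (S `^ p)%:E)%E).
    apply: ae_ge0_le_integral => //.
    - exact: measurable_cube.
    - by move=> x _; rewrite lee_fin powR_ge0.
    - by apply: measurable_funTS; exact: (measurable_below_powR DGu).
    - by move=> x _; rewrite lee_fin powR_ge0.
    apply: filterS bnd => x /[apply] H; rewrite lee_fin.
    by apply: ge0_ler_powR; rewrite ?nnegrE ?below_ge0 ?(ltW p0).
  rewrite integral_cst ?lebesgue_cube//=; last exact: measurable_cube.
  rewrite lebesgue_cube// -EFinM lee_fin ler_wpM2l ?powR_ge0//.
  have r0 : 0 < r by exact: lt_trans mr.
  by apply: lerXn2r; rewrite ?nnegrE; lra.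
apply: (le_trans (lee_wpmul2l _ H)).
  by rewrite lee_fin divr_ge0 ?powR_ge0// ltW.
rewrite -EFinM lee_fin /S /energy_const.
have -> : m - rho = 2^-1 * (r - rho) by rewrite /m; field.
have -> : r - m = 2^-1 * (r - rho) by rewrite /m; field.
rewrite le_eqVlt; apply/orP; left; apply/eqP.
have -> : sup_const * L / (2^-1 * (r - rho)) ^+ N =
   (sup_const * 2 ^+ N) * (L / (r - rho) ^+ N).
  by rewrite exprMn exprVn; field; rewrite !gt_eqF ?exprn_gt0.
rewrite (@powRM _ (sup_const * _)); last 2 first.
- by rewrite mulr_ge0 ?(ltW sup_const_gt0)// exprn_ge0.
- by rewrite divr_ge0// exprn_ge0// ltW.
rewrite (@powRM _ 2^-1) ?invr_ge0 ?(ltW rr0)// exprMn.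
have -> : 2^-1 `^ p = (2 `^ p)^-1 by rewrite -powR_inv1// -powRrM mulN1r powRN.
by field; rewrite !gt_eqF ?powR_gt0.
Qed.

End iteration.
End local_boundedness.

(** * Continuity of translations in the mean *)

Section translation_continuity.
Context {R : realType} {N : nat}.
Local Notation mu := (@lebesgue_rV R N).
Implicit Types (f : 'rV[R]_N -> R) (h : 'rV[R]_N).
Local Open Scope ereal_scope.

Variables (y : 'rV[R]_N) (s : R).
Hypothesis s0 : (0 < s)%R.

Let Q := cube s y.
Let Q2 := cube (s + s) y.
Let mQ : measurable Q. Proof. exact: measurable_cube. Qed.
Let mQ2 : measurable Q2. Proof. exact: measurable_cube. Qed.

Lemma cube_measure_lty (r : R) (z : 'rV[R]_N) : mu (cube r z) < +oo.
Proof.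
apply: (@le_lt_trans _ _ (mu (cube (`|r| + 1)%R z))).
  apply: le_measure; rewrite ?inE; [exact: measurable_cube|exact: measurable_cube|].
  by apply: sub_cube; rewrite (le_trans (ler_norm _))// lerDl.
by rewrite lebesgue_cube ?ltry// ltr_wpDl.
Qed.

(** Continuity at [h = 0] of the translates of [f], in mean over a fixed cube. *)
Definition mean_continuous f := forall e : R, (0 < e)%R -> exists2 d, (0 < d)%R &
  forall h, cube d 0 h -> \int[mu]_(x in Q) `|f (x + h) - f x|%R%:E <= e%:E.

Let mshift f h : measurable_fun setT f ->
  measurable_fun setT (fun x : 'rV[R]_N => f (x + h)%R).
Proof. by move=> mf; exact: (measurableT_comp mf (measurable_rV_add h)). Qed.

Let mdiff (f g : 'rV[R]_N -> R) (D : set 'rV[R]_N) :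
  measurable_fun setT f -> measurable_fun setT g ->
  measurable_fun D (fun x => `|f x - g x|%R%:E).
Proof.
move=> mf mg; apply: measurable_funTS; apply/measurable_EFinP.
by apply: measurableT_comp => //; exact: measurable_funB.
Qed.

(** Translating the error moves it to the larger cube [Q2]. *)
Lemma mean_continuous_approx f : measurable_fun setT f ->
  (forall e : R, (0 < e)%R -> exists f', [/\ measurable_fun setT f',
     mean_continuous f' & \int[mu]_(x in Q2) `|f x - f' x|%R%:E <= e%:E]) ->
  mean_continuous f.
Proof.
move=> mf ap e e0; have e3 : (0 < e / 3)%R by rewrite divr_gt0.
have [f' [mf' cf' ff']] := ap _ e3.
have [d d0 df'] := cf' _ e3.
exists (Num.min d s); first by rewrite lt_min d0.
move=> h hd.
have hd' : cube d 0%R h by apply: sub_cube hd; rewrite ge_min lexx.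
have hs : cube s 0%R h by apply: sub_cube hd; rewrite ge_min lexx orbT.
have I1 : \int[mu]_(x in Q) `|f (x + h) - f' (x + h)|%R%:E <= (e / 3)%:E.
  apply: le_trans ff'.
  apply: (integral_cube_shift_le (F := fun x => `|f x - f' x|%R%:E)) => //.
  exact: mdiff.
have I3 : \int[mu]_(x in Q) `|f x - f' x|%R%:E <= (e / 3)%:E.
  apply: le_trans ff'; apply: ge0_subset_integral => //; first exact: mdiff.
  by apply: sub_cube; rewrite lerDl ltW.
apply: (@le_trans _ _ (\int[mu]_(x in Q) (`|f (x + h) - f' (x + h)|%R%:E +
   (`|f' (x + h) - f' x|%R%:E + `|f x - f' x|%R%:E)))).
  apply: ge0_le_integral => //.
  - exact: mdiff (mshift h mf) mf.
  - apply: emeasurable_funD; first exact: mdiff (mshift h mf) (mshift h mf').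
    by apply: emeasurable_funD; [exact: mdiff (mshift h mf') mf'|exact: mdiff].
  move=> x _; rewrite -!EFinD lee_fin.
  have -> : (f (x + h) - f x = (f (x + h) - f' (x + h)) +
     ((f' (x + h) - f' x) - (f x - f' x)))%R by ring.
  rewrite (le_trans (ler_normD _ _))// lerD2l.
  by rewrite (le_trans (ler_normB _ _)).
have m1 := mdiff (D := Q) (mshift h mf) (mshift h mf').
have m2 := mdiff (D := Q) (mshift h mf') mf'.
have m3 := mdiff (D := Q) mf mf'.
rewrite ge0_integralD//; last 2 first.
- by move=> x _; rewrite adde_ge0.
- exact: emeasurable_funD.
rewrite ge0_integralD//.
have -> : e%:E = (e / 3)%:E + ((e / 3)%:E + (e / 3)%:E).
  by rewrite -!EFinD; congr _%:E; field.
by apply: leeD => //; apply: leeD => //; exact: df'.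
Qed.

(** Bounded pointwise limits stay in the class, by dominated convergence. *)
Lemma mean_continuous_lim (f_ : nat -> 'rV[R]_N -> R) f C :
  (forall n, measurable_fun setT (f_ n)) -> (forall n, mean_continuous (f_ n)) ->
  measurable_fun setT f -> (forall n x, `|f_ n x| <= C)%R ->
  (forall x, f_ n x @[n --> \oo] --> f x) -> mean_continuous f.
Proof.
move=> mf_ cf_ mf fC fcvg; apply: mean_continuous_approx => // e e0.
have iC : mu.-integrable Q2 (cst C%:E).
  apply/integrableP; split; first exact: measurable_cst.
  rewrite (eq_integral (cst `|C|%:E)); last by move=> x _.
  rewrite integral_cst//; apply: lte_mul_pinfty => //; exact: cube_measure_lty.
have [|||||_ + _] := @dominated_convergence _ _ _ mu Q2 mQ2
    (fun n x => (f_ n x)%:E) (EFin \o f) (cst C%:E).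
- by move=> n; apply: measurable_funTS; exact/measurable_EFinP.
- by apply: measurable_funTS; exact/measurable_EFinP.
- by apply: aeW => x _; apply: cvg_EFin; [near=> n|exact: fcvg].
- exact: iC.
- by apply: aeW => x n _ /=; rewrite lee_fin.
move=> /fine_cvgP[finn /cvgrPdist_le /(_ _ e0)].
move=> nn; near \oo => n.
have fn : \int[mu]_(x in Q2) `|(f_ n x)%:E - (EFin \o f) x| \is a fin_num.
  by near: n; exact: finn.
exists (f_ n); split => //.
have -> : \int[mu]_(x in Q2) (`|f x - f_ n x|%R)%:E =
    \int[mu]_(x in Q2) `|(f_ n x)%:E - (EFin \o f) x|.
  by apply: eq_integral => x _; rewrite /= distrC.
rewrite -(fineK fn) lee_fin.
have : (`|0 - fine (\int[mu]_(x in Q2) `|(f_ n x)%:E - (EFin \o f) x|)| <= e)%R.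
  by near: n; exact: nn.
by rewrite sub0r normrN; apply: le_trans; exact: ler_norm.
Unshelve. all: by end_near. Qed.

Lemma mean_continuousD f g : measurable_fun setT f -> measurable_fun setT g ->
  mean_continuous f -> mean_continuous g -> mean_continuous (fun x => f x + g x)%R.
Proof.
move=> mf mg cf cg e e0; have e2 : (0 < e / 2)%R by rewrite divr_gt0.
have [d d0 df] := cf _ e2; have [d' d'0 dg] := cg _ e2.
exists (Num.min d d'); first by rewrite lt_min d0.
move=> h hd.
have hd1 : cube d 0%R h by apply: sub_cube hd; rewrite ge_min lexx.
have hd2 : cube d' 0%R h by apply: sub_cube hd; rewrite ge_min lexx orbT.
have m1 := mdiff (D := Q) (mshift h mf) mf; have m2 := mdiff (D := Q) (mshift h mg) mg.
apply: (@le_trans _ _ (\int[mu]_(x in Q) (`|f (x + h) - f x|%R%:E +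
   `|g (x + h) - g x|%R%:E))).
  apply: ge0_le_integral => //.
  - apply: (mdiff (D := Q) (f := fun x => f (x + h) + g (x + h))%R).
      by apply: measurable_funD; exact: mshift.
    exact: measurable_funD.
  - exact: emeasurable_funD.
  move=> x _; rewrite -EFinD lee_fin opprD addrACA; exact: ler_normD.
rewrite ge0_integralD// (splitr e) EFinD.
by apply: leeD; [exact: df|exact: dg].
Qed.

Lemma mean_continuous_cst (c : R) : mean_continuous (fun=> c).
Proof.
move=> e e0; exists 1%R => // h _.
rewrite integral0_eq ?lee_fin ?ltW// => x _.
by rewrite subrr normr0.
Qed.

Lemma mean_continuousZ (c : R) f : measurable_fun setT f ->
  mean_continuous f -> mean_continuous (fun x => c * f x)%R.
Proof.
move=> mf cf e e0; have c1 : (0 < `|c| + 1)%R by rewrite ltr_wpDl.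
have [d d0 df] := cf _ (divr_gt0 e0 c1); exists d => // h hd.
have m1 := mdiff (D := Q) (mshift h mf) mf.
apply: (@le_trans _ _ (\int[mu]_(x in Q) ((`|c| + 1)%:E * `|f (x + h) - f x|%R%:E))).
  apply: ge0_le_integral => //.
  - by apply: (mdiff (D := Q) (f := fun x => c * f (x + h))%R); apply: measurable_funM => //; exact: mshift.
  - exact: measurable_funeM.
  move=> x _; rewrite -EFinM lee_fin -mulrBr normrM ler_wpM2r//.
  by rewrite lerDl.
rewrite ge0_integralZl ?lee_fin ?(ltW c1)//.
apply: (le_trans (lee_wpmul2l _ (df _ hd))); first by rewrite lee_fin ltW.
by rewrite -EFinM lee_fin mulrC divfK// gt_eqF.
Qed.

Lemma mean_continuous_sum (I : Type) (r : seq I) (F : I -> 'rV[R]_N -> R) :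
  (forall i, measurable_fun setT (F i)) -> (forall i, mean_continuous (F i)) ->
  mean_continuous (fun x => \sum_(i <- r) F i x)%R.
Proof.
move=> mF cF; elim: r => [|i r IH].
  rewrite (_ : (fun x => _) = fun=> 0%R); first exact: mean_continuous_cst.
  by apply/funext => x; rewrite big_nil.
rewrite (_ : (fun x => _) = fun x => (F i x + \sum_(j <- r) F j x)%R); last first.
  by apply/funext => x; rewrite big_cons.
by apply: mean_continuousD => //; exact: measurable_sum.
Qed.

Lemma mean_continuous_bumps l r n : mean_continuous (bumps l r n).
Proof.
have tf : test_function setT (bumps l r n : 'rV[R]_N -> R^o).
  by apply: test_function_bumps.
have /choice[C Cp] : forall i, exists C : R, forall x, (`|partial i (bumps l r n) x| <= C)%R.
  by move=> i; have [C _ HC] := test_function_bounded (test_function_partial i tf); exists C.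
pose M := (\sum_i `|C i| + 1)%R.
have M0 : (0 < M)%R by rewrite ltr_wpDl// sumr_ge0.
have lip x h d : (0 < d)%R -> cube d 0%R h ->
    (`|bumps l r n (x + h) - bumps l r n x| <= M * d)%R.
  move=> d0 hd.
  have := FTC_bumps l r n (x + h)%R h; rewrite addrK => E.
  rewrite -lee_fin -abse_EFin -E.
  have mI : measurable (`[0%R, 1%R]%classic : set (measurableTypeR R)).
    exact: measurable_itv.
  apply: le_trans (le_abse_integral _ _ _) _ => //.
    apply: measurable_funTS; apply/measurable_EFinP.
    by apply: continuous_measurable_fun; exact: continuous_line_partial.
  apply: (@le_trans _ _ (\int[lebesgue_measure]_(t in `[0%R, 1%R]) (M * d)%:E)).
    apply: ge0_le_integral => //.
    - apply: measurable_funTS; apply: measurableT_comp => //; apply/measurable_EFinP.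
      by apply: continuous_measurable_fun; exact: continuous_line_partial.
    move=> t _; rewrite lee_fin (le_trans (ler_norm_sum _ _ _))//.
    apply: (@le_trans _ _ (\sum_i `|C i| * d)%R); last first.
      by rewrite -mulr_suml ler_wpM2r ?(ltW d0)// lerDl.
    apply: ler_sum => i _; rewrite normrM mulrC ler_pM//.
      exact: le_trans (Cp _ _) (ler_norm _).
    by have := hd i; rewrite mxE subr0 => /ltW.
  by rewrite integral_cst//= lebesgue_measure_itv/= lte_fin ltr01 -EFinB subr0 mule1.
move=> e e0.
have V0 : (0 < (2 * s) ^+ N :> R)%R by rewrite exprn_gt0// mulr_gt0.
have d0 : (0 < e / (M * (2 * s) ^+ N))%R by rewrite divr_gt0// mulr_gt0.
exists (e / (M * (2 * s) ^+ N))%R => // h hd.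
apply: (@le_trans _ _ (\int[mu]_(x in Q) (M * (e / (M * (2 * s) ^+ N)))%:E)).
  apply: ge0_le_integral => //.
  - exact: mdiff (mshift h (measurable_bumps l r n)) (measurable_bumps l r n).
  by move=> x _; rewrite lee_fin lip.
rewrite integral_cst//= lebesgue_cube// -EFinM lee_fin.
rewrite le_eqVlt; apply/orP; left; apply/eqP; field.
by rewrite !gt_eqF// mulr_gt0.
Qed.

(** Indicators of open boxes are limits of smooth bumps, and the measurable sets
    whose indicator is continuous in mean form a Dynkin system. *)
Lemma mean_continuous_indic (A : set 'rV[R]_N) : measurable A ->
  mean_continuous (\1_A : 'rV[R]_N -> R).
Proof.
move=> mA; move: (mA); rewrite measurable_rV_boxE; move: A {mA}.
apply: dynkin_induction.
- exact: measurable_rV_boxE.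
- move=> _ _ [l [r ->]] [l' [r' ->]]; rewrite open_boxI.
  by eexists; eexists.
- rewrite (_ : \1_setT = fun=> 1%R); first exact: mean_continuous_cst.
  by apply/funext => x; rewrite indicT.
- move=> _ [l [r ->]].
  apply: (@mean_continuous_lim (bumps l r) _ 1%R).
  + by move=> n; exact: measurable_bumps.
  + by move=> n; exact: mean_continuous_bumps.
  + by apply: measurable_indic; exact: measurable_open_box.
  + by move=> n x; rewrite ger0_norm ?bumps_ge0 ?bumps_le1.
  + by move=> x; exact: bumps_cvg.
- move=> A mA cA e e0; have [d d0 dA] := cA _ e0; exists d => // h hd.
  apply: le_trans (dA _ hd); rewrite le_eqVlt; apply/orP; left; apply/eqP.
  apply: eq_integral => x _; congr _%:E; rewrite !indicE !in_setC.
  by case: (_ \in A); case: (_ \in A); rewrite /= ?subrr ?subr0 ?sub0r ?normrN.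
- move=> F mF tF cF.
  have m1 i : measurable_fun setT (\1_(F i) : 'rV[R]_N -> R) by exact: measurable_indic.
  have sumE x j n : F j x -> (\sum_(i < n) \1_(F i) x = (j < n)%N%:R :> R)%R.
    move=> Fjx.
    have ind i : \1_(F i) x = (i == j)%:R :> R.
      rewrite indicE; congr (nat_of_bool _)%:R; apply/idP/eqP => [/set_mem Fix|->]; last exact/mem_set.
      by apply: (tF i j) => //; exists x.
    under eq_bigr do rewrite ind.
    have [jn|nj] := ltnP j n.
      rewrite (bigD1 (Ordinal jn))//= eqxx big1 ?addr0// => i.
      by rewrite -val_eqE/= => /negbTE ->.
    by rewrite big1// => i _; rewrite (ltn_eqF (leq_trans (ltn_ord i) nj)).
  have sum0 x n : ~ (\bigcup_i F i) x -> (\sum_(i < n) \1_(F i) x = 0 :> R)%R.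
    move=> nFx; rewrite big1// => i _; rewrite indicE memNset// => Fix.
    by apply: nFx; exists i.
  apply: (@mean_continuous_lim (fun n x => \sum_(i < n) \1_(F i) x)%R _ 1%R).
  + by move=> n; apply: measurable_sum.
  + by move=> n; apply: mean_continuous_sum.
  + by apply: measurable_indic; exact: bigcup_measurable.
  + move=> n x; have [[j _ Fjx]|nFx] := pselect ((\bigcup_i F i) x).
      by rewrite (sumE _ _ _ Fjx) ger0_norm ?ler0n// lern1; case: ltnP.
    by rewrite sum0// normr0.
  + move=> x; rewrite indicE; have [Fx|nFx] := pselect ((\bigcup_i F i) x).
      rewrite mem_set//; have [j _ Fjx] := Fx.
      apply: cvg_near_cst; exists j.+1 => // n /= jn.
      by rewrite (sumE _ _ _ Fjx) jn.
    rewrite memNset//; apply: cvg_near_cst; apply: nearW => n.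
    by rewrite sum0.
Qed.

Import HBSimple.

Lemma mean_continuous_integrable f : measurable_fun setT f ->
  mu.-integrable Q2 (EFin \o f) -> mean_continuous f.
Proof.
move=> mf fi; apply: mean_continuous_approx => // e e0.
have [g_ [ig_ _ ]] := approximation_sfun_integrable mQ2 fi.
move=> /fine_cvgP[finn /cvgrPdist_le /(_ _ e0) nn]; near \oo => n.
exists (g_ n); split.
- exact: measurable_funP.
- rewrite (_ : (g_ n : 'rV[R]_N -> R) = fun x =>
      \sum_(c <- finmap.enum_fset (fset_set (range (g_ n)))) c * \1_(g_ n @^-1` [set c]) x)%R; last first.
    apply/funext => x; rewrite [LHS]fimfunE fsbig_finite//.
  have mp c : measurable (g_ n @^-1` [set c]).
    by rewrite -[X in measurable X]setTI; exact: measurable_funP.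
  apply: mean_continuous_sum => c.
    by apply: measurable_funM => //; exact: measurable_indic.
  by apply: mean_continuousZ; [exact: measurable_indic|exact: mean_continuous_indic].
have fn : \int[mu]_(x in Q2) `|(EFin \o f) x - (g_ n x)%:E| \is a fin_num.
  by near: n; exact: finn.
have -> : \int[mu]_(x in Q2) (`|f x - g_ n x|%R)%:E =
    \int[mu]_(x in Q2) `|(EFin \o f) x - (g_ n x)%:E|.
  by apply: eq_integral => x _.
rewrite -(fineK fn) lee_fin.
have : (`|0 - fine (\int[mu]_(x in Q2) `|(EFin \o f) x - (g_ n x)%:E|)| <= e)%R.
  by near: n; exact: nn.
by rewrite sub0r normrN; apply: le_trans; exact: ler_norm.
Unshelve. all: by end_near. Qed.

End translation_continuity.

(** * The gradient of a truncation *)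

Section truncation_gradient.
Context {R : realType} {N : nat}.
Local Notation mu := (@lebesgue_rV R N).
Local Notation leb := (@lebesgue_measure R).
Local Notation I01 := (`[0%R, 1%R]%classic : set R).
Implicit Types (h y : 'rV[R]_N).
Local Open Scope ereal_scope.

Let mI : measurable (I01 : set (measurableTypeR R)).
Proof. exact: measurable_itv. Qed.

Lemma ae_integrable_line (f : 'rV[R]_N -> R) h :
  mu.-integrable setT (EFin \o f) -> {ae mu, forall x,
    leb.-integrable setT (fun t => (f (x + t *: h) * \1_I01 t)%R%:E)}.
Proof. by move=> /(integrable_line h)/ae_integrable1. Qed.

Lemma mean_line_integral (f : 'rV[R]_N -> R) y (s e : R) :
  (0 < s)%R -> (0 < e)%R -> mu.-integrable setT (EFin \o f) ->
  exists2 d, (0 < d)%R & forall h, cube d 0%R h ->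
    \int[mu]_(x in cube s y) `|line_integral f h x - (f x)%:E| <= e%:E.
Proof.
move=> s0 e0 fi.
have mf : measurable_fun setT f by apply/measurable_EFinP; exact: measurable_int fi.
have fi2 : mu.-integrable (cube (s + s) y) (EFin \o f).
  by apply: integrableS fi => //; exact: measurable_cube.
have [d d0 df] := mean_continuous_integrable s0 mf fi2 e0.
exists d => // h hd.
pose D (z : 'rV[R]_N * measurableTypeR R) := `|f (z.1 + z.2 *: h) - f z.1|%R%:E.
have mD : measurable_fun setT D.
  apply/measurable_EFinP; apply: measurableT_comp => //; apply: measurable_funB.
    exact: (measurableT_comp mf (measurable_line h)).
  exact: (measurableT_comp mf measurable_fst).
have D0 z : 0 <= D z by rewrite lee_fin.
have mC := @measurable_cube R N s y.
have mL : measurable_fun setT (line_integral f h).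
  exact: measurable_int (integrable_line_integral h fi).
apply: (@le_trans _ _ (\int[mu]_(x in cube s y) \int[leb]_(t in I01) D (x, t))).
  apply: ae_ge0_le_integral => //.
  - apply: measurable_funTS; apply: measurableT_comp => //.
    by apply: emeasurable_funB => //; exact/measurable_EFinP.
  - by move=> x _; exact: integral_ge0.
  - by apply: measurable_funTS; exact: (measurable_fubini_tonelli_setF leb mI mD D0).
  have ai := ae_integrable_line h fi.
  apply: (filterS _ ai) => x ix _.
  have ix' : leb.-integrable I01 (fun t => (f (x + t *: h)%R)%:E).
    apply/(integrable_mkcond _ mI).
    rewrite (_ : _ \_ _ = fun t => (f (x + t *: h) * \1_I01 t)%R%:E)//.
    apply/funext => t; rewrite patchE indicE.
    by case: ifPn => _; rewrite ?mulr1 ?mulr0.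
  have ic : leb.-integrable I01 (cst (f x)%:E).
    apply/integrableP; split; first exact: measurable_cst.
    rewrite (eq_integral (cst `|f x|%:E))//.
    rewrite integral_cst//= lebesgue_measure_itv/= lte_fin ltr01 -EFinB subr0 mule1.
    exact: ltry.
  have E : line_integral f h x - (f x)%:E =
      \int[leb]_(t in I01) ((f (x + t *: h)%R)%:E - cst (f x)%:E t).
    rewrite (integralB mI ix' ic) line_integralE; congr (_ - _).
    by rewrite integral_cst//= lebesgue_measure_itv/= lte_fin ltr01 -EFinB subr0 mule1.
  rewrite E; apply: le_trans (le_abse_integral _ mI _) _.
    exact: measurable_int (integrableB mI ix' ic).
  by rewrite le_eqVlt; apply/orP; left; apply/eqP; apply: eq_integral => t _.
rewrite (fubini_tonelli_set mu leb mC mI mD D0).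
apply: (@le_trans _ _ (\int[leb]_(t in I01) e%:E)); last first.
  by rewrite integral_cst//= lebesgue_measure_itv/= lte_fin ltr01 -EFinB subr0 mule1.
apply: ge0_le_integral => //.
- by move=> t _; exact: integral_ge0.
- by apply: measurable_funTS; exact: (measurable_fubini_tonelli_setG mu mC mD D0).
move=> t t01.
have thd : cube d 0%R (t *: h) by apply: cube_scale => //; move: t01; rewrite /= in_itv.
exact: (df _ thd).
Qed.

Lemma line_integralZ (f : 'rV[R]_N -> R) h (c : R) :
  mu.-integrable setT (EFin \o f) ->
  {ae mu, forall x, line_integral (fun x => c * f x)%R h x = c%:E * line_integral f h x}.
Proof.
move=> fi; have ai := ae_integrable_line h fi; apply: (filterS _ ai) => x ix.
rewrite /line_integral -(integralZl _ ix)//.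
by apply: eq_integral => t _; rewrite -EFinM mulrA.
Qed.

Lemma below_convex (k a b : R) :
  (- (a < k)%R%:R * (b - a) <= Num.max (k - b) 0 - Num.max (k - a) 0)%R.
Proof.
have [ak|ka] := ltP a k.
  have -> : Num.max (k - a)%R 0%R = (k - a)%R by apply/max_idPl; rewrite subr_ge0 ltW.
  rewrite mulN1r.
  have : (k - b <= Num.max (k - b) 0)%R by rewrite le_max lexx.
  lra.
have -> : Num.max (k - a)%R 0%R = 0%R by apply/max_idPr; rewrite subr_le0.
rewrite oppr0 mul0r.
by rewrite addr0 le_max lexx orbT.
Qed.

Variables (E : set 'rV[R]_N) (u : 'rV[R]_N -> R) (k : R).
Variables (G g : 'rV[R]_N -> 'rV[R]_N).
Hypotheses (oE : open E) (mu_ : measurable_fun setT u).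
Hypothesis mG : forall i, measurable_fun setT (fun x => G x ord0 i).
Hypothesis mg : forall i, measurable_fun setT (fun x => g x ord0 i).
Hypotheses (uG : weak_gradient E u G) (vg : weak_gradient E (below u k) g).

(** Convexity compares the difference quotients of the truncation with those of
    [u] from one side; quotients in both directions give both inequalities. *)
Let one_sided y (s sigma : R) i : (0 < s)%R -> closed_cube (s + s) y `<=` E ->
  (sigma * sigma = 1)%R ->
  {ae mu, forall x, cube s y x ->
    sigma * (- (u x < k)%R%:R * G x ord0 i - g x ord0 i) <= 0}%R.
Proof.
move=> s0 KE sg1.
pose K := closed_cube (s + s) y.
have cK : compact K by exact: closed_cube_compact.
have sgn : (`|sigma| = 1)%R.
  have : (`|sigma| * `|sigma| = 1)%R by rewrite -normrM sg1 normr1.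
  move=> H; have := normr_ge0 sigma; nra.
have QK : cube s y `<=` K by apply: cube_sub_closed; rewrite lerDl ltW.
pose chi x : R := ((u x < k)%R%:R)%R.
have mchi : measurable_fun setT chi by exact: measurable_lt_level.
pose P x := Num.max (sigma * (- chi x * G x ord0 i - g x ord0 i))%R 0%R.
have mP : measurable_fun setT P.
  apply: measurable_maxr => //; apply: measurable_funM => //; apply: measurable_funB => //.
  by apply: measurable_funM => //; exact: measurableT_comp.
have [uL GL _] := uG; have [vL gL _] := vg.
have mv : measurable_fun setT (below u k) by exact: measurable_below.
have iW := integrable_cutoff mu_ uL cK KE.
have iV := integrable_cutoff mv vL cK KE.
have iGa j := integrable_cutoff (mG j) (GL j) cK KE.
have iga j := integrable_cutoff (mg j) (gL j) cK KE.
have mC := @measurable_cube R N s y.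
suff P0 : \int[mu]_(x in cube s y) (P x)%:E = 0.
  have : ae_eq mu (cube s y) (EFin \o P) (cst 0).
    apply/ae_eq_integral_abs => //.
      by apply/measurable_EFinP; exact: measurable_funTS.
    rewrite -P0; apply: eq_integral => x _.
    by rewrite /= ger0_norm// /P le_max lexx orbT.
  by apply: filterS => x /[apply] -[]; rewrite /P => H; rewrite -H le_max lexx.
apply/eqP; rewrite eq_le integral_ge0 ?andbT; last first.
  by move=> x _; rewrite lee_fin /P le_max lexx orbT.
apply/lee_addgt0Pr => e e0; rewrite add0e.
have e2 : (0 < e / 2)%R by rewrite divr_gt0.
have [d1 d10 dG] := mean_line_integral y s0 e2 (iGa i).
have [d2 d20 dg] := mean_line_integral y s0 e2 (iga i).
pose d := Num.min d1 (Num.min d2 s).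
have d0 : (0 < d)%R by rewrite !lt_min d10 d20.
pose tau := (sigma * (d / 2))%R.
pose h : 'rV[R]_N := (tau *: delta_mx ord0 i)%R.
have hd : cube d 0%R h.
  move=> j; rewrite !mxE subr0 normrM /tau normrM sgn mul1r.
  apply: (@le_lt_trans _ _ (d / 2)%R).
    rewrite ger0_norm ?divr_ge0 ?(ltW d0)//.
    by rewrite eqxx andTb ler_piMr ?divr_ge0 ?(ltW d0)//; case: (j == i); rewrite ?normr1 ?normr0.
  by rewrite ltr_pdivrMr// ltr_pMr// ltr1n.
have hd1 : cube d1 0%R h by apply: sub_cube hd; rewrite /d ge_min lexx.
have hd2 : cube d2 0%R h by apply: sub_cube hd; rewrite /d !ge_min lexx orbT.
have hs : cube s 0%R h by apply: sub_cube hd; rewrite /d !ge_min lexx !orbT.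
have sumh (F : 'I_N -> 'rV[R]_N -> R) :
    (fun x => \sum_j h ord0 j * F j x)%R = (fun x => tau * F i x)%R.
  apply/funext => x; rewrite (bigD1 i)//= big1 ?addr0.
    by rewrite !mxE !eqxx mulr1.
  by move=> j ji; rewrite !mxE eqxx/= (negbTE ji) mulr0 mul0r.
have tW := translation_formula s0 hs iW iGa
  (fun f tf j => weak_gradient_cutoff j uG KE tf).
have tV := translation_formula s0 hs iV iga
  (fun f tf j => weak_gradient_cutoff j vg KE tf).
rewrite !sumh in tW tV.
pose LG := line_integral (cutoff K (fun x => G x ord0 i)) h.
pose Lg := line_integral (cutoff K (fun x => g x ord0 i)) h.
have mLG : measurable_fun setT LG by exact: measurable_int (integrable_line_integral h (iGa i)).
have mLg : measurable_fun setT Lg by exact: measurable_int (integrable_line_integral h (iga i)).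
pose cG := cutoff K (fun x => G x ord0 i).
pose cg := cutoff K (fun x => g x ord0 i).
have mcG : measurable_fun setT (EFin \o cG) by exact: measurable_int (iGa i).
have mcg : measurable_fun setT (EFin \o cg) by exact: measurable_int (iga i).
have m1 : measurable_fun (cube s y) (fun x => `|LG x - (cG x)%:E|).
  by apply: measurable_funTS; apply: measurableT_comp => //; exact: emeasurable_funB.
have m2 : measurable_fun (cube s y) (fun x => `|Lg x - (cg x)%:E|).
  by apply: measurable_funTS; apply: measurableT_comp => //; exact: emeasurable_funB.
apply: (@le_trans _ _ (\int[mu]_(x in cube s y)
   (`|LG x - (cG x)%:E| + `|Lg x - (cg x)%:E|))); last first.
  rewrite ge0_integralD// (splitr e) EFinD.
  by apply: leeD; [exact: dG|exact: dg].
apply: ae_ge0_le_integral => //.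
- by move=> x _; rewrite lee_fin /P le_max lexx orbT.
- by apply/measurable_EFinP; exact: measurable_funTS.
- by move=> x _; rewrite adde_ge0.
- exact: emeasurable_funD.
have finG := integrable_ae measurableT (integrable_line_integral h (iGa i)).
have fing := integrable_ae measurableT (integrable_line_integral h (iga i)).
have ZG := line_integralZ h tau (iGa i).
have Zg := line_integralZ h tau (iga i).
have H1 : {ae mu, forall x, cube s y x -> exists a, LG x = a%:E /\
    (tau * a = cutoff K u (x + h) - cutoff K u x)%R}.
  apply: filterS3 tW finG ZG => x tWx fx Zx xy; exists (fine (LG x)).
  have LGf : LG x \is a fin_num by exact: fx.
  split; first by rewrite fineK.
  by apply: EFin_inj; rewrite EFinM fineK// -(tWx xy) Zx.
have H2 : {ae mu, forall x, cube s y x -> exists b, Lg x = b%:E /\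
    (tau * b = cutoff K (below u k) (x + h) - cutoff K (below u k) x)%R}.
  apply: filterS3 tV fing Zg => x tWx fx Zx xy; exists (fine (Lg x)).
  have LGf : Lg x \is a fin_num by exact: fx.
  split; first by rewrite fineK.
  by apply: EFin_inj; rewrite EFinM fineK// -(tWx xy) Zx.
apply: filterS2 H1 H2 => x H1 H2 xy.
have [a [-> Ha]] := H1 xy; have [b [-> Hb]] := H2 xy.
have Kx : K x by exact: QK.
have Kxh : K (x + h)%R.
  by have := cube_sub_closed (lexx (s + s)%R) (cubeD xy hs).
rewrite !cutoff_in// in Ha; rewrite !cutoff_in// in Hb.
rewrite /cG /cg !cutoff_in// -!EFinB !abse_EFin -EFinD lee_fin /P.
have conv := below_convex k (u x) (u (x + h)%R).
have : (- chi x * (tau * a) <= tau * b)%R by rewrite Ha Hb; exact: conv.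
have dd : (0 < d / 2)%R by rewrite divr_gt0.
have -> : (- chi x * (tau * a) = (d / 2) * (- chi x * (sigma * a)))%R by rewrite /tau; ring.
have -> : (tau * b = (d / 2) * (sigma * b))%R by rewrite /tau; ring.
rewrite ler_pM2l// => H.
have chi01 : (`|chi x| <= 1)%R by rewrite /chi; case: (u x < k)%R; rewrite ?normr1 ?normr0.
rewrite ge_max addr_ge0// andbT.
have -> : (sigma * (- chi x * G x ord0 i - g x ord0 i) =
   chi x * (sigma * (a - G x ord0 i)) + sigma * (b - g x ord0 i) +
   (- chi x * (sigma * a) - sigma * b))%R by ring.
have B1 : (chi x * (sigma * (a - G x ord0 i)) <= `|a - G x ord0 i|)%R.
  apply: le_trans (ler_norm _) _; rewrite !normrM sgn mul1r ler_piMl//.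
have B2 : (sigma * (b - g x ord0 i) <= `|b - g x ord0 i|)%R.
  by apply: le_trans (ler_norm _) _; rewrite normrM sgn mul1r.
lra.
Qed.

Lemma gradient_below :
  {ae mu, forall x, E x -> forall i, g x ord0 i = - (u x < k)%R%:R * G x ord0 i}%R.
Proof.
apply: ae_local => y Ey.
have [e e0 eE] := open_cube_sub oE Ey.
pose s := (e / 3)%R; have s0 : (0 < s)%R by rewrite divr_gt0.
have KE : closed_cube (s + s) y `<=` E.
  by apply: subset_trans eE; apply: closed_cube_sub; rewrite /s; lra.
exists s => //.
have ae_i i : {ae mu, forall x, cube s y x -> g x ord0 i = - (u x < k)%R%:R * G x ord0 i}%R.
  have p1 := one_sided i s0 KE (mulr1 1%R).
  have p2 : {ae mu, forall x, cube s y x ->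
      (-1 * (- (u x < k)%R%:R * G x ord0 i - g x ord0 i) <= 0)%R}.
    by apply: one_sided => //; rewrite mulrNN mulr1.
  apply: filterS2 p1 p2 => x H1 H2 xy; have := H1 xy; have := H2 xy.
  by rewrite mul1r mulN1r => *; lra.
have : {ae mu, forall x, forall n, forall i : 'I_N, nat_of_ord i = n ->
    cube s y x -> g x ord0 i = - (u x < k)%R%:R * G x ord0 i}%R.
  apply: ae_foralln => n; have [nN|Nn] := ltnP n N.
    apply: filterS (ae_i (Ordinal nN)) => x H i iE.
    by have -> : i = Ordinal nN by exact/val_inj.
  by apply: aeW => x i iE; exfalso; have := ltn_ord i; rewrite iE ltnNge Nn.
by apply: filterS => x H xy i; exact: (H i i erefl xy).
Qed.

End truncation_gradient.

(** * Convex functions as limits of truncations *)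

Section convex_functions.
Context {R : realType}.
Variables (a : \bar R) (phi : R -> R).
Local Notation D := [set t : R | (a < t%:E)%E].
Hypotheses (convex_phi : convex_on D phi) (phi_noninc : nonincreasing_on D phi).
Hypothesis phi_cvg0 : phi t @[t --> +oo] --> (0 : R).

Let D_up s t : D s -> s <= t -> D t.
Proof. by move=> /= Ds st; apply: (lt_le_trans Ds); rewrite lee_fin. Qed.

Lemma halfline_open t : D t -> exists2 s, D s & s < t.
Proof.
rewrite /=; case: a => [b| |] //=.
- rewrite lte_fin => bt; exists ((b + t) / 2); rewrite ?lte_fin; lra.
- by exists (t - 1); [exact: ltNyr|rewrite ltrBlDr ltrDl].
Qed.

Let nonincr s t : D s -> s <= t -> phi t <= phi s.
Proof.
move=> Ds st; apply: phi_noninc => //; rewrite inE //.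
exact: D_up Ds st.
Qed.

Let phi_ge0 t : D t -> 0 <= phi t.
Proof.
move=> Dt; apply: (cvgr_to_le phi_cvg0); near=> s.
by apply: nonincr => //; near: s; exact: nbhs_pinfty_ge.
Unshelve. all: by end_near. Qed.

Let three_points s t r : D s -> s < t -> t < r ->
  (r - s) * phi t <= (r - t) * phi s + (t - s) * phi r.
Proof.
move=> Ds st tr.
have rs : 0 < r - s by rewrite subr_gt0 (lt_trans st).
pose l := (r - t) / (r - s).
have l0 : 0 <= l by rewrite divr_ge0 ?subr_ge0 ?ltW// (lt_trans st).
have l1 : l <= 1 by rewrite ler_pdivrMr// mul1r lerD2l lerN2 ltW.
have Dr : D r by apply: (D_up Ds); rewrite ltW// (lt_trans st).
have : phi (l * s + (1 - l) * r) <= l * phi s + (1 - l) * phi r.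
  exact: (convex_phi (Itv01 l0 l1) (mem_set Ds) (mem_set Dr)).
have -> : 1 - l = (t - s) / (r - s) by rewrite /l; field; rewrite gt_eqF.
have -> : l * s + (t - s) / (r - s) * r = t.
  by rewrite /l; field; rewrite gt_eqF.
rewrite /l => H.
have : (r - s) * phi t <= (r - s) * ((r - t) / (r - s) * phi s + (t - s) / (r - s) * phi r).
  by rewrite ler_pM2l.
move/le_trans; apply.
by rewrite le_eqVlt; apply/orP; left; apply/eqP; field; rewrite gt_eqF.
Qed.

Let slope s t := (phi s - phi t) / (t - s).

Let slope_ge0 s t : D s -> s < t -> 0 <= slope s t.
Proof. by move=> Ds st; rewrite divr_ge0// subr_ge0 ?nonincr// ltW. Qed.

Let slope_incr_r s t r : D s -> s < t -> t <= r -> slope s r <= slope s t.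
Proof.
move=> Ds st; rewrite le_eqVlt => /predU1P[->//|tr].
have sr := lt_trans st tr.
rewrite /slope ler_pdivrMr ?subr_gt0// mulrAC ler_pdivlMr ?subr_gt0//.
have := three_points Ds st tr; lra.
Qed.

Let slope_incr_l s t r : D s -> s <= t -> t < r -> slope t r <= slope s r.
Proof.
move=> Ds; rewrite le_eqVlt => /predU1P[->//|st] tr.
have sr := lt_trans st tr.
rewrite /slope ler_pdivrMr ?subr_gt0// mulrAC ler_pdivlMr ?subr_gt0//.
have := three_points Ds st tr; lra.
Qed.

(** Chords of a convex function become less steep as they move to the right. *)
Let slope_mono s t s' t' : D s -> s < t -> s' < t' -> s <= s' -> t <= t' ->
  slope s' t' <= slope s t.
Proof.
move=> Ds st st' ss tt.
apply: (le_trans (slope_incr_l (s := s) _ ss st')) => //.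
by apply: slope_incr_r.
Qed.

Section grid.
Variables (h x0 : R) (m : nat).
Hypothesis h0 : 0 < h.

Let x i : R := x0 + i%:R * h.

Let xS i : x i.+1 = x i + h.
Proof. by rewrite /x -natr1 mulrDl mul1r addrA. Qed.

Let x_lt i : x i < x i.+1.
Proof. by rewrite xS ltrDl. Qed.

Let x_le i j : (i <= j)%N -> x i <= x j.
Proof. by move=> ij; rewrite lerD2l ler_pM2r// ler_nat. Qed.

(** Chords beyond the last node are discarded, so that the coefficient at that
    node is the slope of the last chord itself. *)
Definition chord_slope i : R :=
  if (i <= m)%N then slope (x i) (x i.+1) else 0.

Definition grid_coef i : R :=
  if `[< D (x i) >] then chord_slope i - chord_slope i.+1 else 0.

Let chord_slope_ge0 i : D (x i) -> 0 <= chord_slope i.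
Proof. by rewrite /chord_slope => Dx; case: ifP => // _; exact: slope_ge0. Qed.

Let grid_coef_ge0 i : 0 <= grid_coef i.
Proof.
rewrite /grid_coef; case: asboolP => // Dx; rewrite subr_ge0 /chord_slope.
have Dx' : D (x i.+1) by exact: D_up Dx (ltW (x_lt _)).
case: ifP => im1; last first.
  by rewrite -/(chord_slope i) chord_slope_ge0.
by rewrite (ltnW im1); apply: slope_mono => //; exact: ltW.
Qed.

(** On each cell the slope is that of the chord over the next cell. This chord is
    less steep than that of the cell itself, which keeps the sum below [phi]. *)
Definition grid_sum t := \sum_(0 <= i < m.+1) grid_coef i * Num.max (x i - t) 0.

Definition grid_slope t := \sum_(0 <= i < m.+1) grid_coef i * (t < x i)%R%:R.

Let first_node t : exists j, [/\ (j <= m.+1)%N, forall i, (i < j)%N -> x i <= t &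
  forall i, (j <= i)%N -> (i <= m)%N -> t < x i].
Proof.
have ex : exists j, (m < j)%N || (t < x j) by exists m.+1; rewrite ltnSn.
case: (ex_minnP ex) => j jP jmin; exists j; split.
- by apply: jmin; rewrite ltnSn.
- move=> i ij; rewrite leNgt; apply/negP => tx.
  by have := jmin i; rewrite tx orbT leqNgt ij => /(_ isT).
- move=> i ji im; case/orP: jP => [mj|tx]; first by move: (leq_trans ji im); rewrite leqNgt mj.
  exact: lt_le_trans tx (x_le ji).
Qed.

Let grid_split t j (F : nat -> R) : D t -> (j <= m.+1)%N ->
  (forall i, (i < j)%N -> F i = 0) ->
  (forall i, (j <= i)%N -> (i <= m)%N -> t < x i) ->
  \sum_(0 <= i < m.+1) grid_coef i * F i =
  \sum_(j <= i < m.+1) (chord_slope i - chord_slope i.+1) * F i.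
Proof.
move=> Dt jm F0 tx.
rewrite (big_cat_nat (n := j))//= big_nat big1 ?add0r; last first.
  by move=> i /andP[_ ij]; rewrite F0 ?mulr0.
apply: eq_big_nat => i /andP[ji im]; rewrite /grid_coef asboolT//.
by apply: (D_up Dt); rewrite ltW// tx.
Qed.

Let grid_slopeE t j : D t -> (j <= m.+1)%N ->
  (forall i, (i < j)%N -> x i <= t) ->
  (forall i, (j <= i)%N -> (i <= m)%N -> t < x i) ->
  grid_slope t = chord_slope j.
Proof.
move=> Dt jm xt tx.
rewrite /grid_slope (@grid_split t j)//; last first.
  by move=> i /xt; rewrite leNgt => /negbTE ->.
rewrite (eq_big_nat _ _ (F2 := fun i => - (chord_slope i.+1 - chord_slope i))); last first.
  by move=> i /andP[ji im]; rewrite tx// mulr1 opprB.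
by rewrite sumrN telescope_sumr// opprB [chord_slope m.+1]/chord_slope ltnn subr0.
Qed.

Let abel t d : (d <= m)%N ->
  \sum_(m - d <= i < m.+1) (chord_slope i - chord_slope i.+1) * (x i - t) =
  chord_slope (m - d) * (x (m - d) - t) + (phi (x (m - d).+1) - phi (x m.+1)).
Proof.
elim: d => [|d IH] dm.
  rewrite subn0 big_nat1 subrr addr0.
  by rewrite [chord_slope m.+1]/chord_slope ltnn subr0.
have mdS : (m - d)%N = (m - d.+1).+1 by lia.
rewrite big_ltn; last by lia.
rewrite -mdS IH; last exact: ltnW.
rewrite mdS; set j := (m - d.+1)%N.
have -> : chord_slope j.+1 = (phi (x j.+1) - phi (x j.+2)) / h.
  rewrite /chord_slope ifT; last by rewrite /j; lia.
  by rewrite /slope [x j.+2]xS [_ + h - _]addrC addKr.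
rewrite [x j.+1]xS; field.
by rewrite gt_eqF.
Qed.

Let grid_sumE t j : D t -> (j <= m)%N ->
  (forall i, (i < j)%N -> x i <= t) ->
  (forall i, (j <= i)%N -> (i <= m)%N -> t < x i) ->
  grid_sum t = chord_slope j * (x j - t) + (phi (x j.+1) - phi (x m.+1)).
Proof.
move=> Dt jm xt tx.
rewrite /grid_sum (@grid_split t j)//; [|exact: leqW|]; last first.
  by move=> i /xt xit; apply/max_idPr; rewrite subr_le0.
rewrite (eq_big_nat _ _ (F2 := fun i => (chord_slope i - chord_slope i.+1) * (x i - t))).
  by have := @abel t (m - j) (leq_subr _ _); rewrite subKn.
move=> i /andP[ji im]; congr (_ * _); apply/max_idPl.
by rewrite subr_ge0 ltW// tx.
Qed.

Lemma grid_sum_le t : D t -> grid_sum t <= phi t.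
Proof.
move=> Dt; have [j [jm xt tx]] := first_node t.
move: jm; rewrite leq_eqVlt => /predU1P[jm|jm].
  rewrite /grid_sum (@grid_split t j)//; [|by rewrite jm|]; last first.
    by move=> i /xt xit; apply/max_idPr; rewrite subr_le0.
  by rewrite jm big_geq// phi_ge0.
rewrite (@grid_sumE t j)//.
have tj : t < x j by exact: tx.
have Dj : D (x j) by exact: D_up Dt (ltW tj).
have H : chord_slope j * (x j - t) <= phi t - phi (x j).
  rewrite -ler_pdivlMr ?subr_gt0// /chord_slope ifT//.
  by apply: slope_mono => //; exact: ltW.
have H1 := nonincr Dj (ltW (x_lt j)).
have H2 : 0 <= phi (x m.+1) by apply: phi_ge0; apply: (D_up Dj); rewrite x_le// ltnW.
lra.
Qed.

Lemma le_grid_sum t : D t -> x0 <= t -> t < x m ->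
  phi (t + 2 * h) - phi (x m) <= grid_sum t.
Proof.
move=> Dt xt0 tm; have [j [jm xt tx]] := first_node t.
have jm' : (j <= m)%N.
  by rewrite leqNgt; apply/negP => /xt; rewrite leNgt tm.
rewrite (@grid_sumE t j)//.
have tj : t < x j by exact: tx.
have Dj : D (x j) by exact: D_up Dt (ltW tj).
have j0 : (0 < j)%N.
  by case: j {jm xt jm' Dj tx} tj => //; rewrite /x mul0r addr0 ltNge xt0.
have jt : x j <= t + h by rewrite -(prednK j0) xS lerD2r; apply: xt; rewrite prednK.
have H1 : phi (t + 2 * h) <= phi (x j.+1).
  by apply: nonincr; [apply: D_up Dj (ltW (x_lt _))|rewrite xS; lra].
have H2 : phi (x m.+1) <= phi (x m).
  by apply: nonincr; [apply: D_up Dj _; exact: x_le|exact: ltW].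
have H3 : 0 <= chord_slope j * (x j - t).
  by rewrite mulr_ge0 ?chord_slope_ge0// subr_ge0 ltW.
lra.
Qed.

Lemma grid_slope_le s t : D s -> s < t -> grid_slope t <= slope s t.
Proof.
move=> Ds st; have Dt : D t by exact: D_up Ds (ltW st).
have [j [jm xt tx]] := first_node t.
rewrite (@grid_slopeE t j)// /chord_slope; case: ifP => jm'; last exact: slope_ge0.
have tj := tx _ (leqnn _) jm'.
have sx := lt_trans st tj.
by apply: slope_mono => //; [exact: ltW|exact: ltW (lt_trans tj (x_lt _))].
Qed.

Lemma grid_slope_ge0 t : D t -> 0 <= grid_slope t.
Proof. by move=> Dt; apply: sumr_ge0 => i _; rewrite mulr_ge0 ?grid_coef_ge0 ?ler0n. Qed.

Lemma grid_coefs_ge0 i : 0 <= grid_coef i. Proof. exact: grid_coef_ge0. Qed.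

(** The slope is that of the chord which starts at the first node after [t]. *)
Lemma grid_slope_case t : D t -> x0 + m%:R * h <= t /\ grid_slope t = 0 \/
  exists j, [/\ (j <= m)%N, t < x0 + j%:R * h,
    grid_slope t = slope (x0 + j%:R * h) (x0 + j%:R * h + h) &
    forall i, t < x0 + i%:R * h -> x0 + j%:R * h <= x0 + i%:R * h].
Proof.
move=> Dt; have [j [jm xt tx]] := first_node t.
move: jm; rewrite leq_eqVlt => /predU1P[jm|jm]; [left|right].
  split; first by apply: xt; rewrite jm.
  by rewrite (@grid_slopeE t j) ?jm// -?jm// /chord_slope jm ltnn.
exists j; split => //; first by rewrite -/(x j) tx.
  by rewrite (@grid_slopeE t j) ?(ltnW jm)// /chord_slope ifT// xS.
move=> i ti; rewrite -/(x i); apply: x_le; rewrite leqNgt; apply/negP => /xt.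
by rewrite leNgt ti.
Qed.

End grid.

Let step n : R := 2 ^- n.
Let cells n := (2 * 4 ^ n)%N.

Let step_gt0 n : 0 < step n. Proof. by rewrite invr_gt0 exprn_gt0. Qed.

Let stepS n : step n = 2 * step n.+1.
Proof. by rewrite /step exprS invfM mulrA divff// mul1r. Qed.

Let last_node n : - 2 ^+ n + (cells n)%:R * step n = 2 ^+ n.
Proof.
rewrite /cells /step natrM natrX (_ : 4%:R = 2 * 2 :> R); last by ring.
rewrite exprMn mulrA mulfK ?expf_neq0//; ring.
Qed.

(** Refining a dyadic grid moves chords to the left. *)
Let grid_slope_refine n t : D t ->
  grid_slope (step n) (- 2 ^+ n) (cells n) t <=
  grid_slope (step n.+1) (- 2 ^+ n.+1) (cells n.+1) t.
Proof.
move=> Dt.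
have [[_ ->]|[j [jm tj -> _]]] := grid_slope_case (- 2 ^+ n) (cells n) (step_gt0 n) Dt.
  exact: grid_slope_ge0.
pose i := (j.*2 + cells n)%N.
have E : - 2 ^+ n + j%:R * step n = - 2 ^+ n.+1 + i%:R * step n.+1.
  have := last_node n; rewrite stepS => L.
  have -> : i%:R = 2 * j%:R + (cells n)%:R :> R by rewrite /i natrD -mul2n natrM.
  rewrite exprS [(_ + (cells n)%:R) * _]mulrDl.
  have -> : (cells n)%:R * step n.+1 = 2 ^+ n by lra.
  ring.
rewrite E in tj *.
have [[lt _]|[k [km tk -> kmin]]] :=
    grid_slope_case (- 2 ^+ n.+1) (cells n.+1) (step_gt0 n.+1) Dt.
  have ilast : - 2 ^+ n.+1 + i%:R * step n.+1 <=
      - 2 ^+ n.+1 + (cells n.+1)%:R * step n.+1.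
    rewrite lerD2l ler_pM2r// ler_nat.
    by rewrite /i /cells expnS; move: jm; rewrite /cells; lia.
  by have := lt_le_trans tj (le_trans ilast lt); rewrite ltxx.
have ki := kmin _ tj; apply: slope_mono => //.
- exact: D_up Dt (ltW tk).
- by rewrite ltrDl.
- by rewrite ltrDl.
- by rewrite (stepS n); have := step_gt0 n.+1; lra.
Qed.

Let right_continuous t : D t -> phi (t + 2 * step n) @[n --> \oo] --> phi t.
Proof.
move=> Dt; have [s Ds st] := halfline_open Dt.
have step0 : step n @[n --> \oo] --> (0 : R).
  rewrite (_ : step = fun n => 2^-1 ^+ n); last by apply/funext => n; rewrite /step exprVn.
  by apply: cvg_expr; rewrite ger0_norm ?invr_ge0// invf_lt1// ltr1n.
have low : (fun n => phi t - (2 * step n) * slope s t) @ \oo --> phi t.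
  rewrite -[X in _ --> X]subr0; apply: cvgB; first exact: cvg_cst.
  rewrite -(mul0r (slope s t)); apply: cvgM; last exact: cvg_cst.
  by rewrite -(mulr0 2); apply: cvgM => //; exact: cvg_cst.
apply: (squeeze_cvgr _ low (cvg_cst (phi t))); apply: nearW => n.
have n0 := step_gt0 n.
rewrite nonincr ?lerDl ?mulr_ge0 ?(ltW n0)// andbT.
have H : slope t (t + 2 * step n) <= slope s t.
  by apply: slope_mono => //; rewrite ?ltrDl ?mulr_gt0 ?(ltW st)// lerDl mulr_ge0 ?ltW.
have : phi t - phi (t + 2 * step n) <= 2 * step n * slope s t.
  rewrite [leRHS]mulrC -ler_pdivrMr ?mulr_gt0//.
  by move: H; rewrite {1}/slope [t + _ - t]addrC addKr.
lra.
Qed.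

(** A convex function decreasing to zero is a limit from below of nonnegative
    combinations of truncations, whose slopes increase to a locally bounded
    limit. *)
Lemma convex_truncations : exists (M : nat -> nat) (k c : nat -> nat -> R),
  let S n t := \sum_(0 <= i < M n) c n i * (t < k n i)%R%:R in
  let F n t := \sum_(0 <= i < M n) c n i * Num.max (k n i - t) 0 in
  [/\ forall n i, 0 <= c n i,
      forall n t, D t -> F n t <= phi t,
      forall t, D t -> F n t @[n --> \oo] --> phi t,
      forall n t, D t -> S n t <= S n.+1 t &
      forall n s t, D s -> s < t -> S n t <= phi s / (t - s)].
Proof.
exists (fun n => (cells n).+1).
exists (fun n i => - 2 ^+ n + i%:R * step n).
exists (fun n => grid_coef (step n) (- 2 ^+ n) (cells n)) => S F.
split.
- by move=> n i; exact: grid_coefs_ge0.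
- by move=> n t Dt; exact: grid_sum_le.
- move=> t Dt.
  have low : phi (t + 2 * step n) - phi (2 ^+ n) @[n --> \oo] --> phi t.
    rewrite -[X in _ --> X]subr0; apply: cvgB; first exact: right_continuous.
    apply: (cvg_comp _ _ _ phi_cvg0).
    apply/cvgryPge => A; near=> n; apply: (@le_trans _ _ n%:R).
      by near: n; exact: nbhs_infty_ger.
    by rewrite -natrX ler_nat ltnW// ltn_expl.
  apply: (squeeze_cvgr _ low (cvg_cst (phi t))).
  near=> n; rewrite grid_sum_le// andbT.
  have tn : `|t| < 2 ^+ n.
    apply: (@le_lt_trans _ _ n%:R); last by rewrite -natrX ltr_nat ltn_expl.
    by near: n; exact: nbhs_infty_ger.
  move: tn; rewrite ltr_norml => /andP[t1 t2].
  have := @le_grid_sum (step n) (- 2 ^+ n) (cells n) (step_gt0 n) t Dt (ltW t1).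
  by rewrite last_node => /(_ t2).
- by move=> n t Dt; exact: grid_slope_refine.
- move=> n s t Ds st; apply: (le_trans (@grid_slope_le (step n) _ _ (step_gt0 n) s t Ds st)).
  rewrite ler_pM2r ?invr_gt0 ?subr_gt0// gerBl.
  by apply: phi_ge0; exact: D_up Ds (ltW st).
Unshelve. all: by end_near. Qed.

End convex_functions.

(** * Sums of energies, and bounds on compact sets *)

Section minkowski_sums.
Context d (T : measurableType d) {R : realType} (nu : {measure set T -> \bar R}).
Variables (D : set T) (p : R).
Hypotheses (mD : measurable D) (p1 : 1 < p).
Local Open Scope ereal_scope.

Let p0 : (0 < p)%R. Proof. exact: lt_trans ltr01 p1. Qed.

Let normD (f : T -> R) := 'N[nu]_p%:E[EFin \o (fun x => f x * \1_D x)%R].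

Let normDK (f : T -> R) : (forall x, 0 <= f x)%R ->
  normD f `^ p = \int[nu]_(x in D) (f x `^ p)%:E.
Proof.
move=> f0; rewrite /normD powR_Lnorm ?gt_eqF// [RHS]integral_mkcond.
apply: eq_integral => x _; rewrite patchE /= indicE.
case: ifPn => _ /=; rewrite ?mulr1 ?mulr0.
  by rewrite ger0_norm.
by rewrite normr0 powR0// gt_eqF.
Qed.

Let normD_le (f : T -> R) (t : R) : (forall x, 0 <= f x)%R -> (0 <= t)%R ->
  \int[nu]_(x in D) (f x `^ p)%:E <= (t `^ p)%:E -> normD f <= t%:E.
Proof.
move=> f0 t0; rewrite -normDK// -poweR_EFin => H.
have root (x : \bar R) : x \in `[0, +oo] -> x = (x `^ p) `^ p^-1.
  by move=> x0; rewrite -poweRrM mulfV ?gt_eqF// poweRe1// ; move: x0; rewrite in_itv/= => /andP[].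
have N0 : normD f \in `[0, +oo] by rewrite in_itv/= leey Lnorm_ge0.
have T0 : t%:E \in `[0, +oo] by rewrite in_itv/= leey lee_fin t0.
rewrite (root _ N0) (root _ T0); apply: gt0_ler_poweR => //.
- by rewrite invr_ge0 ltW.
- by rewrite in_itv/= leey ?poweR_ge0 ?lee_fin ?powR_ge0.
- by rewrite in_itv/= leey ?poweR_ge0 ?lee_fin ?powR_ge0.
Qed.

(** Minkowski's inequality for finite sums, in terms of the [p]-th powers. *)
Lemma minkowski_sum (I : Type) (s : seq I) (H : I -> T -> R) (t : I -> R) :
  (forall i, measurable_fun setT (H i)) -> (forall i x, 0 <= H i x)%R ->
  (forall i, 0 <= t i)%R ->
  (forall i, \int[nu]_(x in D) (H i x `^ p)%:E <= (t i `^ p)%:E) ->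
  \int[nu]_(x in D) ((\sum_(i <- s) H i x) `^ p)%:E <= ((\sum_(i <- s) t i) `^ p)%:E.
Proof.
move=> mH H0 t0 Ht.
have sH0 s' x : (0 <= \sum_(i <- s') H i x)%R by apply: sumr_ge0 => i _; exact: H0.
have msH s' : measurable_fun setT (fun x => \sum_(i <- s') H i x)%R.
  exact: measurable_sum.
suff N : normD (fun x => \sum_(i <- s) H i x)%R <= (\sum_(i <- s) t i)%:E.
  rewrite -normDK// -poweR_EFin; apply: gt0_ler_poweR; rewrite ?(ltW p0)//.
  - by rewrite in_itv/= leey Lnorm_ge0.
  - by rewrite in_itv/= leey lee_fin sumr_ge0.
elim: s => [|i s IH].
  rewrite big_nil /normD (_ : _ \o _ = cst 0) ?Lnorm0//.
    by rewrite eqe gt_eqF.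
  by apply/funext => x /=; rewrite big_nil mul0r.
rewrite big_cons /normD.
have -> : EFin \o (fun x => (\sum_(j <- i :: s) H j x) * \1_D x)%R =
    EFin \o ((fun x => H i x * \1_D x)%R \+ (fun x => (\sum_(j <- s) H j x) * \1_D x)%R)%R.
  by apply/funext => x /=; rewrite big_cons mulrDl.
apply: le_trans (minkowski_EFin _ _ _ _) _.
- by apply: measurable_funM => //; exact: measurable_indic.
- by apply: measurable_funM => //; exact: measurable_indic.
- exact: ltW.
rewrite EFinD; apply: leeD; first exact: normD_le.
exact: IH.
Qed.

(** The power mean inequality in the form that also gives finiteness. *)
Lemma integral_le_root (f : T -> R) (m X : R) : (0 < m)%R -> (0 <= X)%R ->
  nu D = m%:E -> measurable_fun D f -> (forall x, D x -> 0 <= f x)%R ->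
  \int[nu]_(x in D) (f x `^ p)%:E <= X%:E ->
  \int[nu]_(x in D) (f x)%:E <= ((m `^ (p - 1) * X) `^ p^-1)%:E.
Proof.
move=> m0 X0 Dm mf f0 fX.
set L := (_ `^ p^-1)%R.
rewrite leNgt; apply/negP => Lf.
have L0 : (0 <= L)%R by exact: powR_ge0.
have [c Lc cf] : exists2 c, (L < c)%R & c%:E <= \int[nu]_(x in D) (f x)%:E.
  move: Lf; case: (\int[nu]_(x in D) (f x)%:E) => [r| |] //.
  - by rewrite lte_fin => Lr; exists r.
  - by move=> _; exists (L + 1)%R; rewrite ?ltrDl// leey.
have c0 : (0 <= c)%R by rewrite (le_trans L0)// ltW.
have := power_mean_le p1 mD mf f0 Dm m0 c0 cf.
have mX : (0 <= m `^ (p - 1) * X)%R by rewrite mulr_ge0// powR_ge0.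
apply/negP; rewrite -ltNge; apply: le_lt_trans (lee_wpmul2l _ fX) _.
  by rewrite lee_fin powR_ge0.
rewrite -EFinM lte_fin.
have -> : (m `^ (p - 1) * X = L `^ p)%R.
  by rewrite /L -powRrM mulVf ?gt_eqF// powRr1.
by apply: gt0_ltr_powR; rewrite ?nnegrE.
Qed.

End minkowski_sums.

Section compact_sets.
Context {R : realType} {N : nat}.
Local Notation mu := (@lebesgue_rV R N).
Implicit Types (E K : set 'rV[R]_N).

Lemma compact_measure_lty K : compact K -> (mu K < +oo)%E.
Proof.
move=> cK; have [M [_ /(_ (`|M| + 1)) KM]] := compact_bounded cK.
apply: (@le_lt_trans _ _ (mu (cube (`|M| + 2) 0))); last exact: cube_measure_lty.
apply: le_measure; rewrite ?inE; [exact: compact_measurable_rV|exact: measurable_cube|].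
move=> x Kx.
rewrite cube_ball; last by rewrite ltr_wpDl.
rewrite -ball_normE /= sub0r normrN.
have : M < `|M| + 1 by rewrite (le_lt_trans (ler_norm _))// ltrDl.
by move=> /KM /(_ x Kx) /= /le_lt_trans; apply; rewrite ltrD2l ltr1n.
Qed.

(** Local bounds that hold almost everywhere are uniform on compact sets. *)
Lemma ae_compact E K (P : R -> 'rV[R]_N -> Prop) : compact K -> K `<=` E ->
  (forall C C' x, C <= C' -> P C x -> P C' x) ->
  (forall y, E y -> exists2 e, 0 < e & exists C, {ae mu, forall x, cube e y x -> P C x}) ->
  exists C, {ae mu, forall x, K x -> P C x}.
Proof.
move=> cK KE Pmono loc.
have /choice[e eP] : forall y, exists e, 0 < e /\
    (E y -> exists C, {ae mu, forall x, cube e y x -> P C x}).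
  move=> y; have [Ey|nEy] := pselect (E y); last by exists 1.
  by have [e e0 H] := loc y Ey; exists e.
have /choice[C CP] : forall y, exists C, E y ->
    {ae mu, forall x, cube (e y) y x -> P C x}.
  move=> y; have [Ey|nEy] := pselect (E y); last by exists 0.
  by have [_ /(_ Ey)[C H]] := eP y; exists C.
move: cK; rewrite compact_cover => /(_ 'rV[R]_N K (fun y => cube (e y) y)) [].
- by move=> y _; apply: open_cube; have [] := eP y.
- by move=> x Kx; exists x => //; apply: cube_center; have [] := eP x.
move=> s sK Kcov.
pose M := \big[Num.max/0]_(y <- finmap.enum_fset s) C y.
exists M.
have aeall : {ae mu, forall x, forall n, (forall y, (onth (finmap.enum_fset s) n) = Some y ->
    cube (e y) y x -> P M x)}.
  apply: ae_foralln => n; case En : (onth _ n) => [y|]; last by apply: aeW.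
  have ys : y \in finmap.enum_fset s by apply/onthP; exists n.
  have Ey : E y by apply: KE; have := sK y ys; rewrite inE.
  apply: filterS (CP y Ey) => x Hx _ [<-] xy; apply: Pmono (Hx xy).
  by apply: le_bigmax_seq.
apply: filterS aeall => x Hx Kx.
have [y /= ys xy] := Kcov x Kx.
have /onthP[n En] : y \in finmap.enum_fset s by [].
exact: (Hx n y En xy).
Qed.

(** A multiple of a locally [q]-integrable function with locally bounded
    factor. *)
Lemma Lploc_dominated E (q : R) (G h : 'rV[R]_N -> R) : 0 < q ->
  measurable_fun setT h -> measurable_fun setT G ->
  (forall K, compact K -> K `<=` E -> (\int[mu]_(x in K) (`|G x| `^ q)%:E < +oo)%E) ->
  (forall K, compact K -> K `<=` E ->
    exists C, {ae mu, forall x, K x -> `|h x| <= C * `|G x|}) ->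
  Lploc E q h.
Proof.
move=> q0 mh mG GK hK; split.
  by exists h; [exact: measurable_funTS|exact: aeW].
move=> K cK KE; have [C HC] := hK K cK KE.
have mK : measurable K by exact: compact_measurable_rV.
have mGq : measurable_fun K (fun x => `|G x| `^ q).
  apply: measurable_funTS; apply: (measurableT_comp (measurable_powR q)).
  exact: measurableT_comp.
apply: (@le_lt_trans _ _ (\int[mu]_(x in K) ((`|C| `^ q)%:E * (`|G x| `^ q)%:E))%E).
  apply: ae_ge0_le_integral => //.
  - by apply/measurable_EFinP; apply: measurable_funTS;
      apply: (measurableT_comp (measurable_powR q)); exact: measurableT_comp.
  - by apply: measurable_funeM; exact/measurable_EFinP.
  apply: filterS HC => x /[apply] Hx.
  rewrite -EFinM lee_fin -powRM//.
  apply: ge0_ler_powR; rewrite ?nnegrE ?mulr_ge0 ?(ltW q0)//.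
  by apply: (le_trans Hx); rewrite ler_wpM2r// ler_norm.
have G0 x : K x -> (0 <= (`|G x| `^ q)%:E)%E by rewrite lee_fin powR_ge0.
have C0 : (0 <= (`|C| `^ q)%:E)%E by rewrite lee_fin powR_ge0.
rewrite (ge0_integralZl mu mK _ G0 C0); last exact/measurable_EFinP.
by apply: lte_mul_pinfty => //; exact: GK.
Qed.

Lemma Lploc_bounded E (q : R) (h : 'rV[R]_N -> R) : 0 < q ->
  measurable_fun setT h ->
  (forall K, compact K -> K `<=` E -> exists C, {ae mu, forall x, K x -> `|h x| <= C}) ->
  Lploc E q h.
Proof.
move=> q0 mh hK; apply: (@Lploc_dominated E q (cst 1)) => //.
  move=> K cK KE; rewrite (eq_integral (cst 1%E)); last first.
    by move=> x _; rewrite /= normr1 powR1.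
  rewrite integral_cst ?mul1e; last exact: compact_measurable_rV.
  exact: compact_measure_lty.
move=> K cK KE; have [C HC] := hK K cK KE; exists C.
by apply: filterS HC => x /[apply]; rewrite normr1 mulr1.
Qed.

Lemma integral_support E K (w f : 'rV[R]_N -> R) : K `<=` E ->
  (forall x, ~ K x -> f x = 0) ->
  (\int[mu]_(x in E) (w x * f x)%:E = \int[mu]_(x in K) (w x * f x)%:E)%E.
Proof.
move=> KE fK; rewrite [LHS]integral_mkcond [RHS]integral_mkcond.
apply: eq_integral => x _; rewrite !patchE.
have [Kx|nKx] := pselect (K x); first by rewrite !mem_set//; exact: KE.
by rewrite [x \in K]memNset// fK// mulr0; case: ifP.
Qed.

Lemma test_function_support E f i : test_function E f -> exists K,
  [/\ compact K, K `<=` E, forall x, ~ K x -> f x = 0 &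
      forall x, ~ K x -> partial i f x = 0].
Proof.
move=> tf; have [_ [K1 [cK1 K1E f1]]] := tf.
have [_ [K2 [cK2 K2E f2]]] := test_function_partial i tf.
exists (K1 `|` K2); split.
- exact: compactU.
- by move=> x [/K1E|/K2E].
- by move=> x nK; apply: f1 => Kx; apply: nK; left.
- by move=> x nK; apply: f2 => Kx; apply: nK; right.
Qed.

End compact_sets.

Lemma euclidean_normZ {R : realType} {N : nat} (c : R) (v : 'rV[R]_N) :
  euclidean_norm (c *: v) = `|c| * euclidean_norm v.
Proof.
rewrite /euclidean_norm -sqrtr_sqr -sqrtrM ?sqr_ge0//; congr Num.sqrt.
by rewrite mulr_sumr; apply: eq_bigr => i _; rewrite mxE exprMn.
Qed.

(** * The chain rule for limits of truncations *)

Section truncation_sums.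
Context {R : realType} {N : nat}.
Local Notation mu := (@lebesgue_rV R N).
Local Open Scope ereal_scope.

Lemma bounded_convergence (K : set 'rV[R]_N) (a_ : nat -> 'rV[R]_N -> R)
    (a b : 'rV[R]_N -> R) (C : R) : measurable K ->
  mu.-integrable K (EFin \o b) -> (forall n, measurable_fun setT (a_ n)) ->
  (forall x, a_ n x @[n --> \oo] --> a x) ->
  {ae mu, forall x, K x -> forall n, (`|a_ n x| <= C)%R} ->
  mu.-integrable K (fun x => (a x * b x)%:E) /\
  (\int[mu]_(x in K) (a_ n x * b x)%:E @[n --> \oo] -->
     \int[mu]_(x in K) (a x * b x)%:E).
Proof.
move=> mK ib ma acvg aC.
have mb : measurable_fun K b by apply/measurable_EFinP; exact: measurable_int ib.
have mab n : measurable_fun K (fun x => (a_ n x * b x)%:E).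
  by apply/measurable_EFinP; apply: measurable_funM => //; exact: measurable_funTS.
have cv x : K x -> (a_ n x * b x)%:E @[n --> \oo] --> (a x * b x)%:E.
  by move=> _; apply: cvg_EFin; [exact: nearW|apply: cvgM => //; exact: cvg_cst].
have ma' : measurable_fun K (fun x => (a x * b x)%:E) by exact: emeasurable_fun_cvg mab cv.
have ig : mu.-integrable K (fun x => `|C|%:E * `|(b x)%:E|).
  by apply: (integrableZl mK); exact: (integrable_abse ib).
have [] := @dominated_convergence _ _ _ mu K mK _ _ _ mab ma' (aeW _ cv) ig.
  apply: filterS aC => x H n Kx; rewrite -EFinM lee_fin normrM ler_wpM2r//.
  by apply: le_trans (H Kx n) _; exact: ler_norm.
by [].
Qed.

Variables (E : set 'rV[R]_N) (p gamma : R) (u : 'rV[R]_N -> R).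
Variables (g : R -> 'rV[R]_N -> 'rV[R]_N) (G : 'rV[R]_N -> 'rV[R]_N).
Hypotheses (oE : open E) (DGu : borel_DG E p gamma u g).
Hypothesis mG : forall i, measurable_fun setT (fun x => G x ord0 i).
Hypothesis uG : weak_gradient E u G.

Let mu_ : measurable_fun setT u. Proof. exact: bDG_fun DGu. Qed.

Let chi k x : R := (u x < k)%R%:R.

Let mchi k : measurable_fun setT (chi k).
Proof. exact: measurable_lt_level. Qed.

Let chi1 k x : (`|chi k x| <= 1)%R.
Proof. by rewrite /chi; case: (u x < k)%R; rewrite ?normr1 ?normr0. Qed.

Lemma gradient_truncation k :
  {ae mu, forall x, E x -> forall i, g k x ord0 i = - chi k x * G x ord0 i}%R.
Proof.
apply: gradient_below => //; [exact: (bDG_grad DGu)|exact: (bDG_weak DGu)].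
Qed.

Section test.
Variables (f : 'rV[R]_N -> R^o) (i : 'I_N) (K : set 'rV[R]_N).
Hypotheses (tf : test_function E f) (cK : compact K) (KE : K `<=` E).
Hypotheses (fK : forall x, ~ K x -> f x = 0%R).
Hypotheses (pfK : forall x, ~ K x -> partial i f x = 0%R).

Let mK : measurable K. Proof. exact: compact_measurable_rV. Qed.

Let b x : R := (G x ord0 i * f x)%R.

Let ib : mu.-integrable K (EFin \o b).
Proof.
have [C _ fC] := test_function_bounded tf; have [_ GL _] := uG.
apply: (integrable_mulb (C := C)) => //.
  exact: (integrable_compact (mG i) (GL i)).
by apply: measurable_funTS; exact: (measurable_test_function tf).
Qed.

Let tpf : test_function E (partial i f). Proof. exact: test_function_partial. Qed.

Let ipf : mu.-integrable K (EFin \o partial i f).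
Proof.
have [C _ fC] := test_function_bounded tpf.
have := @integrable_mulb R _ _ mu K (cst 1%R) (partial i f) C mK.
rewrite (_ : (fun x => (cst 1 x * partial i f x)%:E) = EFin \o partial i f); last first.
  by apply/funext => x /=; rewrite mul1r.
apply => //; last by apply: measurable_funTS; exact: (measurable_test_function tpf).
apply/integrableP; split; first exact: (measurable_cst (1%E : \bar R)).
rewrite (eq_integral (cst 1)); last by move=> x _; rewrite /= normr1.
by rewrite integral_cst// mul1e; exact: compact_measure_lty.
Qed.

Let ibelow k : mu.-integrable K (fun x => (below u k x * partial i f x)%:E).
Proof.
have [C _ fC] := test_function_bounded tpf; have [BL _ _] := bDG_weak DGu k.
apply: (integrable_mulb (C := C)) => //.
  by apply: integrable_compact BL cK KE; exact: measurable_below.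
by apply: measurable_funTS; exact: (measurable_test_function tpf).
Qed.

Let ichib k : mu.-integrable K (fun x => (chi k x * b x)%:E).
Proof.
rewrite (_ : (fun _ => _) = (fun x => (b x * chi k x)%:E)); last first.
  by apply/funext => x; rewrite mulrC.
by apply: (integrable_mulb (C := 1%R)) => //; exact: measurable_funTS.
Qed.

Let integral_opp (h : 'rV[R]_N -> R) : mu.-integrable K (EFin \o h) ->
  (- (\int[mu]_(x in K) (- h x)%R%:E)) = \int[mu]_(x in K) (h x)%:E.
Proof.
move=> ih; rewrite (_ : (fun x => (- h x)%:E) = (fun x => (-1)%:E * (h x)%:E)); last first.
  by apply/funext => x; rewrite -EFinM mulN1r.
by rewrite (integralZl mK ih) EFinN mulN1e oppeK.
Qed.

Let truncation_identity k :
  \int[mu]_(x in K) (below u k x * partial i f x)%:E =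
  \int[mu]_(x in K) (chi k x * b x)%:E.
Proof.
have [_ _ /(_ f tf i)] := bDG_weak DGu k.
rewrite (integral_support _ KE pfK) (integral_support _ KE fK) => ->.
rewrite -(integral_opp (ichib k)); congr (- _).
apply: ae_eq_integral => //.
- apply/measurable_EFinP; apply: measurable_funM.
    by apply: measurable_funTS; exact: (bDG_grad DGu).
  by apply: measurable_funTS; exact: (measurable_test_function tf).
- apply/measurable_EFinP; apply: measurableT_comp => //.
  by apply/measurable_EFinP; exact: measurable_int (ichib k).
apply: filterS (gradient_truncation k) => x H Kx.
by rewrite (H (KE Kx)) /b mulrA !mulNr.
Qed.

Variables (M : nat -> nat) (k c : nat -> nat -> R) (C : R).
Let S n t := (\sum_(0 <= j < M n) c n j * (t < k n j)%R%:R)%R.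
Let F n t := (\sum_(0 <= j < M n) c n j * Num.max (k n j - t) 0)%R.
Variables (w s : 'rV[R]_N -> R).
Hypothesis FSC : {ae mu, forall x, K x ->
  forall n, (`|F n (u x)| <= C /\ `|S n (u x)| <= C)%R}.
Hypothesis Fw : forall x, F n (u x) @[n --> \oo] --> w x.
Hypothesis Ss : forall x, S n (u x) @[n --> \oo] --> s x.

(** The chain rule holds for each truncation, hence for finite combinations of
    them, hence for dominated limits of these. *)
Lemma truncation_limit : mu.-integrable K (fun x => (w x * partial i f x)%:E) /\
  \int[mu]_(x in E) (w x * partial i f x)%:E =
  (- (\int[mu]_(x in E) ((- s x *: G x)%R ord0 i * f x)%:E)).
Proof.
have mF n : measurable_fun setT (fun x => F n (u x)).
  apply: measurable_sum => j; apply: measurable_funM => //.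
  exact: (measurable_below (k n j) mu_).
have mS n : measurable_fun setT (fun x => S n (u x)).
  by apply: measurable_sum => j; apply: measurable_funM => //; exact: mchi.
have FC : {ae mu, forall x, K x -> forall n, (`|F n (u x)| <= C)%R}.
  by apply: filterS FSC => x H Kx n; have [] := H Kx n.
have SC : {ae mu, forall x, K x -> forall n, (`|S n (u x)| <= C)%R}.
  by apply: filterS FSC => x H Kx n; have [] := H Kx n.
have [iw cw] := bounded_convergence mK ipf mF Fw FC.
have [is_ cs] := bounded_convergence mK ib mS Ss SC.
split=> //.
rewrite (integral_support _ KE pfK) (integral_support _ KE fK).
have -> : (- (\int[mu]_(x in K) ((- s x *: G x) ord0 i * f x)%:E)) =
    \int[mu]_(x in K) (s x * b x)%:E.
  rewrite -(integral_opp is_); congr (- _); apply: eq_integral => x _.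
  by rewrite mxE /b mulrA !mulNr.
have FS n : \int[mu]_(x in K) (F n (u x) * partial i f x)%:E =
    \int[mu]_(x in K) (S n (u x) * b x)%:E.
  transitivity (\int[mu]_(x in K)
     (\sum_(j <- index_iota 0 (M n)) c n j * (below u (k n j) x * partial i f x))%R%:E).
    by apply: eq_integral => x _; rewrite mulr_suml; congr EFin; apply: eq_bigr => j _;
      rewrite mulrA.
  rewrite (integral_lincomb _ _ mK (fun j => ibelow (k n j))).
  under eq_bigr do rewrite truncation_identity.
  rewrite -(integral_lincomb _ _ mK (fun j => ichib (k n j))).
  by apply: eq_integral => x _; rewrite mulr_suml; congr EFin; apply: eq_bigr => j _;
    rewrite mulrA.
move: cw; under eq_fun do rewrite FS.
by move=> cw; exact: (cvg_unique _ cw cs).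
Qed.

End test.

End truncation_sums.

(** * Distance from the endpoint *)

Section convex_composition.
Context {R : realType} {N : nat}.
Local Notation mu := (@lebesgue_rV R N).

Variables (p gamma eps : R).
Hypotheses (p1 : 1 < p) (gamma0 : 0 < gamma) (eps0 : 0 < eps) (eps8 : eps <= 8^-1).
Hypothesis epsC : 2 * gamma * (8 * N%:R * eps) `^ p <= 2^-1 `^ p * 4 ^- N.

Let p0 : 0 < p. Proof. exact: lt_trans ltr01 p1. Qed.

Variables (E : set 'rV[R]_N) (u : 'rV[R]_N -> R).
Variables (g : R -> 'rV[R]_N -> 'rV[R]_N) (G : 'rV[R]_N -> 'rV[R]_N).
Hypotheses (oE : open E) (DGu : borel_DG E p gamma u g).
Hypothesis mG : forall i, measurable_fun setT (fun x => G x ord0 i).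
Hypothesis uG : weak_gradient E u G.
Hypothesis GLp : forall i, Lploc E p (fun x => G x ord0 i).
Variable a : \bar R.
Hypothesis au : forall x, (a < (u x)%:E)%E.

Let mu_ : measurable_fun setT u. Proof. exact: bDG_fun DGu. Qed.

Let C := @sup_const R N p eps.

Let C0 : 0 < C. Proof. exact: sup_const_gt0. Qed.

(** The supremum estimate bounds [u] from below when [a] is infinite. When [a] is
    finite, the set where [u] is below a level [k] close to [a] occupies a small
    fraction of a cube, and there [k - u <= k - a]; the supremum estimate then
    halves this bound. *)
Lemma lower_bound_local y : E y -> exists2 e, 0 < e & exists c,
  (a < c%:E)%E /\ {ae mu, forall x, cube e y x -> c <= u x}.
Proof.
move=> Ey; have [r r0 rE] := open_cube_sub oE Ey.
have r2 : 0 < r / 2 by rewrite divr_gt0.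
have rr : r / 2 < r by rewrite ltr_pdivrMr// ltr_pMr// ltr1n.
have r4 : r / 2 / 2 < r / 2 by rewrite ltr_pdivrMr// ltr_pMr// ltr1n.
have Q : cube (r / 2) y `<=` E by apply: subset_trans rE; apply: sub_cube; exact: ltW.
have [aNy|aNy] := eqVneq a -oo%E.
  exists (r / 2 / 2); first by rewrite divr_gt0.
  have fin : (\int[mu]_(x in cube (r / 2) y) (below u 0 x)%:E < +oo)%E.
    have [[_ L1] _ _] := bDG_weak DGu 0.
    have KE : closed_cube (r / 2) y `<=` E by apply: subset_trans rE; exact: closed_cube_sub.
    apply: le_lt_trans (L1 _ (@closed_cube_compact R N (r / 2) y) KE).
    rewrite [leRHS](eq_integral (fun x => (below u 0 x)%:E)); last first.
      by move=> x _; rewrite powRr1// ger0_norm// below_ge0.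
    apply: ge0_subset_integral => //.
    - exact: measurable_cube.
    - exact: measurable_closed_cube.
    - by apply: measurable_funTS; apply/measurable_EFinP; exact: measurable_below.
    - by move=> x _; rewrite lee_fin below_ge0.
    - exact: cube_sub_closed.
  set I := (\int[mu]_(x in _) _)%E in fin.
  have I0 : (0 <= I)%E by apply: integral_ge0 => x _; rewrite lee_fin below_ge0.
  have IL : (I <= (fine I)%:E)%E by rewrite fineK// ge0_fin_numE.
  have L0 : 0 <= fine I by exact: fine_ge0.
  have := degiorgi_sup_cubes p1 gamma0 eps0 eps8 epsC DGu r4 Q L0 IL.
  move: (_ * fine _ / _) => M bM; exists (- M); split; first by rewrite aNy ltNyr.
  apply: filterS bM => x /[apply]; rewrite /below ge_max => /andP[ux _].
  by move: ux; rewrite sub0r => ux; lra.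
have [b ab] : exists b, a = b%:E.
  by move: (au y) aNy; case: a => [b| |]//; exists b.
exists (r / 2 / 2); first by rewrite divr_gt0.
pose k n : R := b + n.+1%:R^-1.
pose A n := cube (r / 2) y `&` [set x | u x < k n].
have mA n : measurable (A n).
  apply: measurableI; first exact: measurable_cube.
  rewrite (_ : [set x | _] = u @^-1` [set` `]-oo, k n[]); last first.
    by apply/seteqP; split => x /=; rewrite in_itv.
  by rewrite -[X in measurable X]setTI; exact: mu_.
have A0 : \bigcap_n A n = set0.
  apply/seteqP; split => // x /= Ax.
  have := au x; rewrite ab lte_fin => bx.
  pose n := Num.truncn (u x - b)^-1.
  have n1 : (u x - b)^-1 < n.+1%:R by rewrite truncnS_gt.
  have [_ /=] := Ax n I; rewrite /k; apply/negP; rewrite -leNgt.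
  rewrite -lerBrDl; apply: ltW.
  by rewrite -[ltRHS]invrK ltf_pV2 ?posrE ?invr_gt0 ?subr_gt0.
have cvA : mu (A n) @[n --> \oo] --> 0%E.
  rewrite -(measure0 mu) -A0; apply: nonincreasing_cvg_mu => //.
  - apply: (le_lt_trans _ (cube_measure_lty (r / 2) y)).
    by apply: le_measure; rewrite ?inE//; [exact: measurable_cube|exact: subIsetl].
  - by rewrite A0.
  - move=> m n mn; apply/subsetPset => x [xy /= ux]; split=> //=.
    by apply: (lt_le_trans ux); rewrite lerD2l lef_pV2 ?posrE ?ltr0n// ler_nat.
(* the fraction for which the estimate yields [(k - b) / 2] *)
pose c0 := (r / 2 - r / 2 / 2) ^+ N / C / 2.
have c00 : 0 < c0 by rewrite !divr_gt0// exprn_gt0// subr_gt0.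
have [n An] : exists n, (mu (A n) <= c0%:E)%E.
  have /fine_cvgP[_ /cvgrPdist_le /(_ c0 c00)] := cvA.
  have /fine_cvgP[fA _] := cvA.
  move=> cA; near \oo => n; exists n.
  have fn : mu (A n) \is a fin_num by near: n.
  rewrite -(fineK fn) lee_fin.
  have : `|fine 0 - fine (mu (A n))| <= c0 by near: n.
  by rewrite /= sub0r normrN ger0_norm// fine_ge0.
have kb0 : 0 < k n - b by rewrite /k addrC addKr invr_gt0.
have intL : (\int[mu]_(x in cube (r / 2) y) (below u (k n) x)%:E <=
    ((k n - b) * c0)%:E)%E.
  apply: (@le_trans _ _ (\int[mu]_(x in A n) (k n - b)%:E)%E); last first.
    by rewrite integral_cst// EFinM; apply: lee_wpmul2l => //; rewrite lee_fin ltW.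
  rewrite integral_mkcond [leRHS]integral_mkcond; apply: ge0_le_integral => //.
  - by move=> x _; rewrite patchE; case: ifP => // _; rewrite lee_fin below_ge0.
  - apply/(measurable_restrictT _ _).1; first exact: measurable_cube.
    by apply: measurable_funTS; apply/measurable_EFinP; exact: measurable_below.
  - by apply/(measurable_restrictT _ _).1 => //; exact: measurable_cst.
  move=> x _; rewrite !patchE; case: ifPn => [/set_mem xy|nxy].
    have [ux|ku] := ltP (u x) (k n).
      rewrite mem_set//; rewrite lee_fin /below ge_max (ltW kb0) andbT.
      by rewrite lerD2l lerN2 ltW// -lte_fin -ab.
    rewrite memNset; last by move=> [_ /=]; rewrite ltNge ku.
    by rewrite lee_fin /below (_ : Num.max _ _ = 0)//; apply/max_idPr; rewrite subr_le0.
  by case: ifP => // _; rewrite lee_fin ltW.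
have L0 : 0 <= (k n - b) * c0 by rewrite mulr_ge0// ltW.
have := degiorgi_sup_cubes p1 gamma0 eps0 eps8 epsC DGu r4 Q L0 intL.
have -> : C * ((k n - b) * c0) / (r / 2 - r / 2 / 2) ^+ N = (k n - b) / 2.
  rewrite /c0; field.
  by rewrite !gt_eqF//= exprn_gt0// subr_gt0.
move=> bM; exists ((k n + b) / 2); split; first by rewrite ab lte_fin; lra.
apply: filterS bM => x /[apply]; rewrite /below ge_max => /andP[ux _].
lra.
Unshelve. all: by end_near. Qed.

End convex_composition.

(** * The energy inequality for convex functions of [u] *)

Section convex_composition.
Context {R : realType} {N : nat}.
Local Notation mu := (@lebesgue_rV R N).

Variables (p gamma eps : R).
Hypotheses (p1 : 1 < p) (gamma0 : 0 < gamma) (eps0 : 0 < eps) (eps8 : eps <= 8^-1).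
Hypothesis epsC : 2 * gamma * (8 * N%:R * eps) `^ p <= 2^-1 `^ p * 4 ^- N.

Let p0 : 0 < p. Proof. exact: lt_trans ltr01 p1. Qed.

Let C := @energy_const R N p gamma eps.

Let C0 : 0 < C. Proof. exact: energy_const_gt0. Qed.

(** The second factor comes from the power mean inequality on the larger cube. *)
Definition composition_const : R := C * (2 ^+ N) `^ (p - 1).

Lemma composition_const_gt0 : 0 < composition_const.
Proof. by rewrite mulr_gt0// powR_gt0// exprn_gt0. Qed.

Variables (E : set 'rV[R]_N) (u : 'rV[R]_N -> R).
Variables (g : R -> 'rV[R]_N -> 'rV[R]_N) (G : 'rV[R]_N -> 'rV[R]_N).
Hypotheses (oE : open E) (DGu : borel_DG E p gamma u g).
Hypothesis mG : forall i, measurable_fun setT (fun x => G x ord0 i).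
Hypothesis uG : weak_gradient E u G.
Hypothesis GLp : forall i, Lploc E p (fun x => G x ord0 i).
Variable a : \bar R.
Hypothesis au : forall x, (a < (u x)%:E)%E.

Let mu_ : measurable_fun setT u. Proof. exact: bDG_fun DGu. Qed.

Section energy.
Variables (y : 'rV[R]_N) (rho r : R).
Hypotheses (rho0 : 0 < rho) (rhor : rho < r) (rE : cube r y `<=` E).

Let d := r - rho.
Let d0 : 0 < d. Proof. by rewrite subr_gt0. Qed.
Let r0 : 0 < r. Proof. exact: lt_trans rhor. Qed.
Let b : R := (C / d `^ p * r ^+ N) `^ p^-1 / d ^+ N.

Let b0 : 0 <= b.
Proof. by rewrite divr_ge0 ?powR_ge0// exprn_ge0// ltW. Qed.

Let bp t : 0 <= t -> (b * t) `^ p = C / d `^ p * r ^+ N * (t / d ^+ N) `^ p.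
Proof.
move=> t0; rewrite /b -mulrA [_^-1 * t]mulrC powRM ?powR_ge0//; last first.
  by rewrite divr_ge0// exprn_ge0// ltW.
rewrite -powRrM mulVf ?gt_eqF// powRr1//.
apply: mulr_ge0; last by rewrite exprn_ge0// ltW.
by rewrite divr_ge0 ?powR_ge0// ltW.
Qed.

(** [energy_mean] for a multiple of a truncation, with the gradient expressed
    through that of [u]. *)
Let energy_term k (c T : R) : 0 <= c -> 0 <= T ->
  (\int[mu]_(x in cube r y) (c * below u k x)%:E <= T%:E)%E ->
  (\int[mu]_(x in cube rho y)
     ((c * (u x < k)%R%:R * euclidean_norm (G x)) `^ p)%:E <= ((b * T) `^ p)%:E)%E.
Proof.
move=> c0 T0 intT.
have [cE|cN] := eqVneq c 0.
  rewrite (eq_integral (cst 0%E)) ?integral0 ?lee_fin ?powR_ge0//.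
  by move=> x _; rewrite cE !mul0r powR0 ?gt_eqF.
have cp : 0 < c by rewrite lt_neqAle eq_sym cN.
have mB : measurable_fun (cube r y) (fun x => (below u k x)%:E).
  by apply: measurable_funTS; apply/measurable_EFinP; exact: measurable_below.
have B0 x : cube r y x -> (0 <= (below u k x)%:E)%E by rewrite lee_fin below_ge0.
have intB : (\int[mu]_(x in cube r y) (below u k x)%:E <= (T / c)%:E)%E.
  move: intT; under eq_integral do rewrite EFinM.
  rewrite (ge0_integralZl mu (measurable_cube r y) mB B0) ?lee_fin//.
  by rewrite mulrC EFinM lee_pdivlMl.
have Tc : 0 <= T / c by rewrite divr_ge0.
have H := energy_mean p1 gamma0 eps0 eps8 epsC DGu rho0 rhor rE Tc intB.
have mg := measurable_euclidean_norm (bDG_grad DGu k).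
have mQ := @measurable_cube R N rho y.
have mgp : measurable_fun (cube rho y) (fun x => (euclidean_norm (g k x) `^ p)%:E).
  apply: measurable_funTS; apply/measurable_EFinP.
  exact: (measurableT_comp (measurable_powR p) mg).
have gp0 x : cube rho y x -> (0 <= (euclidean_norm (g k x) `^ p)%:E)%E.
  by rewrite lee_fin powR_ge0.
apply: (@le_trans _ _ (\int[mu]_(x in cube rho y)
    ((c `^ p)%:E * (euclidean_norm (g k x) `^ p)%:E))%E).
  apply: ae_ge0_le_integral => //.
  - by move=> x _; rewrite lee_fin powR_ge0.
  - apply: measurable_funTS; apply/measurable_EFinP.
    apply: (measurableT_comp (measurable_powR p)).
    apply: measurable_funM; last exact: measurable_euclidean_norm.
    by apply: measurable_funM => //; exact: measurable_lt_level.
  - by move=> x _; rewrite -EFinM lee_fin mulr_ge0 ?powR_ge0.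
  - exact: measurable_funeM.
  apply: filterS (gradient_truncation oE DGu mG uG k) => x Hx xy.
  have Ex : E x by apply: rE; apply: sub_cube xy; exact: ltW.
  have -> : g k x = (- (u x < k)%R%:R) *: G x.
    by apply/rowP => i; rewrite (Hx Ex) mxE.
  rewrite euclidean_normZ normrN -EFinM lee_fin -powRM ?mulr_ge0 ?euclidean_norm_ge0//.
  by rewrite mulrA ger0_norm.
have cp0 : (0 <= (c `^ p)%:E)%E by rewrite lee_fin powR_ge0.
rewrite (ge0_integralZl mu mQ mgp gp0 cp0).
apply: (le_trans (lee_wpmul2l cp0 H)).
rewrite -EFinM lee_fin bp// mulrCA -powRM//; last first.
  by rewrite divr_ge0// exprn_ge0// ltW.
by rewrite !mulrA [c * T]mulrC mulfK.
Qed.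

(** Minkowski's inequality adds up the energies of the truncations as
    homogeneous functions of their means, and the means add up to the mean of
    the combination. *)
Lemma energy_sum (M : nat) (k c : nat -> R) (T : R) : (forall i, 0 <= c i) -> 0 <= T ->
  (\int[mu]_(x in cube r y)
    (\sum_(0 <= i < M) c i * below u (k i) x)%:E <= T%:E)%E ->
  (\int[mu]_(x in cube rho y)
     (((\sum_(0 <= i < M) c i * (u x < k i)%R%:R) * euclidean_norm (G x)) `^ p)%:E <=
   (C / d `^ p * r ^+ N * (T / d ^+ N) `^ p)%:E)%E.
Proof.
move=> c0 T0 intT.
have mQ := @measurable_cube R N r y.
have mB i : measurable_fun (cube r y) (fun x => (c i * below u (k i) x)%:E).
  apply: measurable_funTS; apply/measurable_EFinP.
  by apply: measurable_funM => //; exact: measurable_below.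
have B0 i x : cube r y x -> (0 <= (c i * below u (k i) x)%:E)%E.
  by move=> _; rewrite lee_fin; apply: mulr_ge0; [exact: c0|exact: below_ge0].
pose I i := (\int[mu]_(x in cube r y) (c i * below u (k i) x)%:E)%E.
have I0 i : (0 <= I i)%E by apply: integral_ge0 => x; exact: B0.
have sumI : (\sum_(0 <= i < M) I i <= T%:E)%E.
  rewrite -(ge0_integral_sum mu mQ mB B0); apply: le_trans intT.
  by rewrite le_eqVlt; apply/orP; left; apply/eqP; apply: eq_integral => x _; rewrite sumEFin.
pose t i := if (i < M)%N then fine (I i) else 0.
have fI i : (i < M)%N -> I i \is a fin_num.
  move=> iM; rewrite ge0_fin_numE//; apply: le_lt_trans (ltry T).
  apply: le_trans sumI; rewrite big_mkord (bigD1 (Ordinal iM))//= leeDl//.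
  exact: sume_ge0.
have t0 i : 0 <= t i by rewrite /t; case: ifP => // _; exact: fine_ge0.
have sumt : \sum_(0 <= i < M) t i <= T.
  rewrite -lee_fin -sumEFin; apply: le_trans sumI.
  rewrite le_eqVlt; apply/orP; left; apply/eqP; apply: eq_big_nat => i /= iM.
  by rewrite /t iM fineK ?fI.
pose H i x := if (i < M)%N then c i * (u x < k i)%R%:R * euclidean_norm (G x) else 0.
have HE x : (\sum_(0 <= i < M) c i * (u x < k i)%R%:R) * euclidean_norm (G x) =
    \sum_(0 <= i < M) H i x.
  by rewrite mulr_suml; apply: eq_big_nat => i /= iM; rewrite /H iM.
under eq_integral do rewrite HE.
have H0 i x : 0 <= H i x.
  by rewrite /H; case: ifP => // _; rewrite !mulr_ge0 ?euclidean_norm_ge0.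
have mH i : measurable_fun setT (H i).
  rewrite /H; case: (i < M)%N => //.
  apply: measurable_funM; last exact: measurable_euclidean_norm.
  by apply: measurable_funM => //; exact: measurable_lt_level.
have bt0 i : 0 <= b * t i by rewrite mulr_ge0.
apply: le_trans (minkowski_sum (measurable_cube rho y) p1 _ mH H0 bt0 _) _.
  move=> i; rewrite /H /t; case: ifP => iM.
    apply: energy_term => //; first exact: fine_ge0.
    by rewrite fineK// fI.
  rewrite (eq_integral (cst 0%E)) ?integral0 ?lee_fin ?powR_ge0//.
  by move=> x _; rewrite powR0 ?gt_eqF.
rewrite lee_fin -bp// -mulr_sumr.
have st0 : 0 <= \sum_(0 <= i < M) t i by exact: sumr_ge0.
by apply: ge0_ler_powR (ler_wpM2l b0 sumt); rewrite ?nnegrE ?(ltW p0)// mulr_ge0.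
Qed.

End energy.

Section phi.
Variable phi : R -> R.
Local Notation D := [set t : R | (a < t%:E)%E].
Hypotheses (convex_phi : convex_on D phi) (phi_noninc : nonincreasing_on D phi).
Hypothesis phi_cvg0 : phi t @[t --> +oo] --> (0 : R).

Let nondecreasing_cvg_powR (v : nat -> R) (l : R) : (forall n, 0 <= v n) ->
  nondecreasing_seq v -> v @ \oo --> l -> v n `^ p @[n --> \oo] --> l `^ p.
Proof.
move=> v0 vnd vl.
have cv : cvgn v by apply/cvg_ex; exists l.
have lE : limn v = l by exact/cvg_lim.
have vle n : v n <= l by rewrite -lE; exact: nondecreasing_cvgn_le.
have l0 : 0 <= l by exact: le_trans (v0 0%N) (vle 0%N).
have low : (fun n => p * (l `^ (p - 1) * v n) - (p - 1) * l `^ p) @ \oo --> l `^ p.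
  have E0 : l `^ p = p * (l `^ (p - 1) * l) - (p - 1) * l `^ p.
    by rewrite [l `^ (p - 1) * l]mulrC mulr_powRB1//; ring.
  rewrite [X in _ --> X]E0; apply: cvgB; last exact: cvg_cst.
  by apply: cvgM; [exact: cvg_cst|apply: cvgM => //; exact: cvg_cst].
apply: (squeeze_cvgr _ low (cvg_cst (l `^ p))); apply: nearW => n.
rewrite ge0_ler_powR ?nnegrE ?(ltW p0)// andbT lerBlDr.
exact: powR_tangent.
Qed.

(** [s] is the limit of the slopes of the approximations at [u], so that [- s]
    stands for the derivative of [phi]. The factor [r / (r - rho)] to the power
    [N p] appears because means over the larger cube are taken relative to the
    volume of the gap. *)
Lemma convex_composition : exists s : 'rV[R]_N -> R,
  [/\ measurable_fun setT (phi \o u), forall x, 0 <= phi (u x),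
      (forall K, compact K -> K `<=` E -> exists c,
        {ae mu, forall x, K x -> `|phi (u x)| <= c}),
      (weak_gradient E (phi \o u) (fun x => - s x *: G x) /\
       forall i, Lploc E p (fun x => (- s x *: G x) ord0 i)) &
      forall y rho r, 0 < rho -> rho < r -> cube r y `<=` E ->
      (\int[mu]_(x in cube rho y) (euclidean_norm (- s x *: G x) `^ p)%:E <=
       (@GDG_const R N p composition_const rho r)%:E *
       \int[mu]_(x in cube r y) (phi (u x) `^ p)%:E)%E].
Proof.
have [M [k [c]]] := convex_truncations convex_phi phi_noninc phi_cvg0.
set S := (fun n t => \sum_(0 <= i < M n) c n i * (t < k n i)%R%:R).
set F := (fun n t => \sum_(0 <= i < M n) c n i * Num.max (k n i - t) 0).
move=> [c0 Fphi Fcvg Smono Sle].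
have Du x : D (u x) by exact: au.
have S0 n t : 0 <= S n t by apply: sumr_ge0 => i _; rewrite mulr_ge0.
have F0 n t : 0 <= F n t by apply: sumr_ge0 => i _; rewrite mulr_ge0// le_max lexx orbT.
have mF n : measurable_fun setT (fun x => F n (u x)).
  apply: measurable_sum => j; apply: measurable_funM => //.
  exact: (measurable_below (k n j) mu_).
have mS n : measurable_fun setT (fun x => S n (u x)).
  by apply: measurable_sum => j; apply: measurable_funM => //; exact: measurable_lt_level.
have Snd x : nondecreasing_seq (fun n => S n (u x)).
  by apply/nondecreasing_seqP => n; exact: Smono.
pose s x := limn (fun n => S n (u x)).
have Ss x : S n (u x) @[n --> \oo] --> s x.
  apply: nondecreasing_is_cvgn => //.
  have [t Dt tu] := halfline_open (Du x).
  by exists (phi t / (u x - t)) => _ [n _ <-]; exact: Sle.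
have Fu x : F n (u x) @[n --> \oo] --> phi (u x) by exact: Fcvg.
have ms : measurable_fun setT s by exact: (measurable_fun_cvg mS (fun x _ => Ss x)).
have mphi : measurable_fun setT (phi \o u) by exact: (measurable_fun_cvg mF (fun x _ => Fu x)).
have phi0 x : 0 <= phi (u x).
  by apply: (cvgr_to_ge (Fu x)); apply: nearW => n; exact: F0.
have s0 x : 0 <= s x.
  by apply: (cvgr_to_ge (Ss x)); apply: nearW => n; exact: S0.
have loc K : compact K -> K `<=` E -> exists B, {ae mu, forall x, K x ->
    forall n, `|F n (u x)| <= B /\ `|S n (u x)| <= B}.
  move=> cK KE; apply: (ae_compact
    (P := fun B x => forall n, `|F n (u x)| <= B /\ `|S n (u x)| <= B) cK KE).
    by move=> B B' x BB H n; have [H1 H2] := H n; split; exact: le_trans BB.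
  move=> z Ez; have [e e0 [b [ab ub]]] :=
    lower_bound_local p1 gamma0 eps0 eps8 epsC oE DGu au Ez.
  exists e => //; have [t Dt tb] := halfline_open ab.
  exists (Num.max (phi b) (phi t / (b - t))).
  apply: filterS ub => x /[apply] bu n.
  have bt : 0 < b - t by rewrite subr_gt0.
  have ut : 0 < u x - t by rewrite subr_gt0 (lt_le_trans tb).
  have pt0 : 0 <= phi t.
    have := le_trans (S0 n (u x)) (Sle n t (u x) Dt (lt_le_trans tb bu)).
    by rewrite pmulr_lge0// invr_gt0.
  rewrite !ger0_norm//; split.
    rewrite le_max (le_trans (Fphi n _ (Du x)))//.
    by apply: phi_noninc => //; rewrite inE.
  rewrite le_max; apply/orP; right; apply: (le_trans (Sle n t (u x) Dt _)).
    exact: lt_le_trans bu.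
  by rewrite ler_wpM2l// lef_pV2 ?posrE// lerD2r.
have locphi K : compact K -> K `<=` E -> exists B, {ae mu, forall x, K x ->
    `|phi (u x)| <= B /\ `|s x| <= B}.
  move=> cK KE; have [B HB] := loc K cK KE; exists B.
  apply: filterS HB => x /[apply] H; rewrite !ger0_norm//; split.
    apply: (cvgr_to_le (Fu x)); apply: nearW => n.
    by have [+ _] := H n; rewrite ger0_norm.
  apply: (cvgr_to_le (Ss x)); apply: nearW => n.
  by have [_ +] := H n; rewrite ger0_norm.
have locphi1 K : compact K -> K `<=` E -> exists B, {ae mu, forall x, K x ->
    `|phi (u x)| <= B}.
  move=> cK KE; have [B HB] := locphi K cK KE; exists B.
  by apply: filterS HB => x /[apply] -[].
have grad_Lp q i : 0 < q -> Lploc E q (fun x => G x ord0 i) ->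
    Lploc E q (fun x => (- s x *: G x) ord0 i).
  move=> q0 [_ GL]; apply: (@Lploc_dominated _ _ _ q (fun x => G x ord0 i)) => //.
    rewrite (_ : (fun x => _) = fun x => - s x * G x ord0 i); last first.
      by apply/funext => x; rewrite mxE.
    by apply: measurable_funM => //; exact: measurableT_comp.
  move=> K cK KE; have [B HB] := locphi K cK KE; exists B.
  apply: filterS HB => x /[apply] -[_ sB].
  by rewrite mxE normrM normrN ler_wpM2r.
exists s; split; [exact: mphi|exact: phi0|exact: locphi1| |].
  split; last by move=> i; exact: grad_Lp.
  have [_ GL1 _] := uG; split.
  - exact: Lploc_bounded.
  - by move=> i; exact: grad_Lp.
  move=> f tf i; have [K [cK KE fK pfK]] := test_function_support i tf.
  have [B HB] := loc K cK KE.
  by have [] := truncation_limit oE DGu mG uG tf cK KE fK pfK HB Fu Ss.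
move=> y rho r rho0 rhor rE.
have r0 := lt_trans rho0 rhor; have d0 : 0 < r - rho by rewrite subr_gt0.
set X := (\int[mu]_(x in cube r y) _)%E.
have X0 : (0 <= X)%E by apply: integral_ge0 => x _; rewrite lee_fin powR_ge0.
have GC0 : 0 < @GDG_const R N p composition_const rho r.
  by rewrite mulr_gt0 ?powR_gt0 ?divr_gt0 ?composition_const_gt0 ?powR_gt0.
have [->|Xfin] := eqVneq X +oo%E; first by rewrite gt0_muley ?leey.
have {}Xfin : X \is a fin_num by rewrite ge0_fin_numE// ltey.
pose m := (2 * r) ^+ N; have m0 : 0 < m by rewrite exprn_gt0// mulr_gt0.
pose T := (m `^ (p - 1) * fine X) `^ p^-1.
have mphiQ : measurable_fun (cube r y) (phi \o u) by exact: measurable_funTS.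
have intphi : (\int[mu]_(x in cube r y) ((phi \o u) x)%:E <= T%:E)%E.
  apply: (integral_le_root (f := phi \o u) (X := fine X) (measurable_cube r y) p1 m0 _
    (lebesgue_cube y r0)) => //.
  - exact: fine_ge0.
  - by move=> x _; exact: phi0.
  - by rewrite fineK.
have T0 : 0 <= T by exact: powR_ge0.
have bound n : (\int[mu]_(x in cube rho y)
     ((S n (u x) * euclidean_norm (G x)) `^ p)%:E <=
   (C / (r - rho) `^ p * r ^+ N * (T / (r - rho) ^+ N) `^ p)%:E)%E.
  apply: energy_sum => //; apply: le_trans intphi.
  apply: ge0_le_integral => //.
  - exact: measurable_cube.
  - by move=> x _; rewrite lee_fin; exact: F0.
  - by apply: measurable_funTS; apply/measurable_EFinP; exact: mF.
  - exact/measurable_EFinP.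
  - by move=> x _; rewrite lee_fin; exact: Fphi.
pose h n x := ((S n (u x) * euclidean_norm (G x)) `^ p)%:E.
have mh n : measurable_fun (cube rho y) (h n).
  apply: measurable_funTS; apply/measurable_EFinP.
  apply: (measurableT_comp (measurable_powR p)).
  by apply: measurable_funM => //; exact: measurable_euclidean_norm.
have h0 n x : cube rho y x -> (0 <= h n x)%E by rewrite lee_fin powR_ge0.
have hnd x : cube rho y x -> nondecreasing_seq (h^~ x).
  move=> _ i j ij; rewrite lee_fin.
  apply: ge0_ler_powR; rewrite ?nnegrE ?mulr_ge0 ?euclidean_norm_ge0 ?(ltW p0)//.
  by rewrite ler_wpM2r ?euclidean_norm_ge0//; exact: Snd.
have hlim x : limn (h^~ x) = (euclidean_norm (- s x *: G x) `^ p)%:E.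
  apply/cvg_lim => //; apply: cvg_EFin; first exact: nearW.
  rewrite euclidean_normZ normrN ger0_norm//=.
  have cv : (fun n => S n (u x) * euclidean_norm (G x)) @ \oo -->
      s x * euclidean_norm (G x).
    by apply: cvgM; [exact: Ss|exact: cvg_cst].
  apply: (nondecreasing_cvg_powR _ _ cv) => [n|i j ij].
    by rewrite mulr_ge0 ?euclidean_norm_ge0.
  by rewrite ler_wpM2r ?euclidean_norm_ge0//; exact: Snd.
rewrite (eq_integral (fun x => limn (h^~ x))); last by move=> x _; rewrite hlim.
rewrite (monotone_convergence mu (measurable_cube rho y) mh h0 hnd).
apply: (@le_trans _ _ (C / (r - rho) `^ p * r ^+ N * (T / (r - rho) ^+ N) `^ p)%:E).
  apply: lime_le; last by apply: nearW => n; exact: bound.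
  apply: ereal_nondecreasing_is_cvgn => i j ij; apply: ge0_le_integral => //.
  - exact: measurable_cube.
  - exact: h0.
  - by move=> x xy; exact: hnd.
rewrite -[X in (_ * X)%E](fineK Xfin) -EFinM lee_fin.
set d := r - rho in d0 *.
have dN0 : 0 < d ^+ N by rewrite exprn_gt0.
have dV : (d ^+ N)^-1 `^ p = ((d ^+ N) `^ p)^-1.
  by rewrite -(powR_inv1 (ltW dN0)) -powRrM mulN1r powRN.
have -> : (T / d ^+ N) `^ p = m `^ (p - 1) * fine X / (d ^+ N) `^ p.
  rewrite powRM ?powR_ge0 ?invr_ge0 ?(ltW dN0)// /T -powRrM mulVf ?gt_eqF//.
  rewrite powRr1; last by rewrite mulr_ge0 ?powR_ge0 ?fine_ge0.
  by rewrite dV.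
rewrite /GDG_const /composition_const -/d powRrM.
have -> : (r / d) `^ N%:R = r ^+ N / d ^+ N.
  by rewrite powR_mulrn ?divr_ge0 ?(ltW r0) ?(ltW d0)// expr_div_n.
have rN0 : 0 < r ^+ N by rewrite exprn_gt0.
have -> : (r ^+ N / d ^+ N) `^ p = r ^+ N * (r ^+ N) `^ (p - 1) / (d ^+ N) `^ p.
  by rewrite powRM ?invr_ge0 ?(ltW dN0) ?(ltW rN0)// dV mulr_powRB1 ?(ltW rN0)//.
rewrite /m exprMn powRM ?exprn_ge0 ?(ltW r0)//.
by rewrite le_eqVlt; apply/orP; left; apply/eqP; ring.
Qed.

End phi.

(** Rescaled truncations at levels tending to infinity approximate the constant
    one, with gradients tending to zero. *)
Lemma integral_partial_test f i : test_function E f ->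
  (\int[mu]_(x in E) (1 * partial i f x)%:E = 0)%E.
Proof.
move=> tf; have [K [cK KE fK pfK]] := test_function_support i tf.
pose M (n : nat) := 1%N; pose k (n j : nat) : R := n.+1%:R; pose c (n j : nat) : R := n.+1%:R^-1.
have n0 (n : nat) : 0 < n.+1%:R :> R by rewrite ltr0n.
have FE n t : \sum_(0 <= j < M n) c n j * Num.max (k n j - t) 0 =
    n.+1%:R^-1 * Num.max (n.+1%:R - t) 0 by rewrite big_nat1.
have SE n t : \sum_(0 <= j < M n) c n j * (t < k n j)%R%:R =
    n.+1%:R^-1 * (t < n.+1%:R)%R%:R by rewrite big_nat1.
have harm : (fun n => n.+1%:R^-1 : R) @ \oo --> (0 : R) by exact: cvg_harmonic.
have FSC : exists B, {ae mu, forall x, K x -> forall n,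
    `|\sum_(0 <= j < M n) c n j * Num.max (k n j - u x) 0| <= B /\
    `|\sum_(0 <= j < M n) c n j * (u x < k n j)%R%:R| <= B}.
  apply: (ae_compact (P := fun B x => forall n,
    `|\sum_(0 <= j < M n) c n j * Num.max (k n j - u x) 0| <= B /\
    `|\sum_(0 <= j < M n) c n j * (u x < k n j)%R%:R| <= B) cK KE).
    by move=> B B' x BB H n; have [H1 H2] := H n; split; exact: le_trans BB.
  move=> z Ez; have [e e0 [b [ab ub]]] :=
    lower_bound_local p1 gamma0 eps0 eps8 epsC oE DGu au Ez.
  exists e => //; exists (1 + `|b|).
  apply: filterS ub => x /[apply] bu n.
  have n1 : (n.+1%:R^-1 : R) <= 1 by rewrite invf_le1// ler1n.
  rewrite FE SE.
  have inv0 : 0 <= n.+1%:R^-1 :> R by rewrite invr_ge0.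
  have max0 : 0 <= Num.max (n.+1%:R - u x) 0 by rewrite le_max lexx orbT.
  rewrite (ger0_norm (mulr_ge0 inv0 max0)) (ger0_norm (mulr_ge0 inv0 (ler0n _ _))).
  split.
    rewrite mulrC ler_pdivrMr// ge_max; apply/andP; split; last first.
      by rewrite mulr_ge0// addr_ge0.
    have : `|b| <= `|b| * n.+1%:R by rewrite ler_peMr// ler1n.
    have := ler_norm (- b); rewrite normrN mulrDl mul1r; lra.
  apply: (@le_trans _ _ (1 * 1)); last by rewrite mul1r lerDl.
  by apply: ler_pM; rewrite ?invr_ge0//; case: (_ < _)%R.
have [B HB] := FSC.
have Fw x : \sum_(0 <= j < M n) c n j * Num.max (k n j - u x) 0 @[n --> \oo] --> (1 : R).
  have cv : (fun n => 1 - n.+1%:R^-1 * u x) @ \oo --> (1 : R).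
    rewrite -[X in _ --> X]subr0 -(mul0r (u x)); apply: cvgB; first exact: cvg_cst.
    by apply: cvgM => //; exact: cvg_cst.
  apply: cvg_trans cv; apply: near_eq_cvg; near=> n.
  rewrite FE (_ : Num.max _ _ = n.+1%:R - u x).
    by rewrite mulrBr mulVf ?gt_eqF.
  apply/max_idPl; rewrite subr_ge0; apply: (@le_trans _ _ n%:R).
    by near: n; exact: nbhs_infty_ger.
  by rewrite ler_nat.
have Ss x : \sum_(0 <= j < M n) c n j * (u x < k n j)%R%:R @[n --> \oo] --> (0 : R).
  apply: (squeeze_cvgr _ (cvg_cst (0 : R)) harm); apply: nearW => n.
  rewrite SE mulr_ge0 ?invr_ge0//=; apply: ler_piMr; first by rewrite invr_ge0.
  by case: (_ < _)%R.
have [_ ->] := truncation_limit (w := cst 1) (s := cst 0) oE DGu mG uG tf cK KE fK pfK HB Fw Ss.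
rewrite (eq_integral (cst 0%E)) ?integral0 ?oppe0// => x _.
by rewrite mxE /= oppr0 !mul0r.
Unshelve. all: by end_near. Qed.

Lemma max_convex_on (D : set R) (phi : R -> R) k : convex_on D phi ->
  convex_on D (fun t => Num.max (phi t - k) 0).
Proof.
move=> cphi l x y xD yD.
have H : phi (l%:num * x + (1 - l%:num) * y) <= l%:num * phi x + (1 - l%:num) * phi y.
  exact: (cphi l x y xD yD).
have l0 : 0 <= l%:num by [].
have l1 : 0 <= 1 - l%:num by rewrite subr_ge0.
suff : Num.max (phi (l%:num * x + (1 - l%:num) * y) - k) 0 <=
    l%:num * Num.max (phi x - k) 0 + (1 - l%:num) * Num.max (phi y - k) 0 by [].
rewrite ge_max; apply/andP; split; last first.
  by rewrite addr_ge0// mulr_ge0// le_max lexx orbT.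
have Hx : l%:num * (phi x - k) <= l%:num * Num.max (phi x - k) 0.
  by rewrite ler_wpM2l// le_max lexx.
have Hy : (1 - l%:num) * (phi y - k) <= (1 - l%:num) * Num.max (phi y - k) 0.
  by rewrite ler_wpM2l// le_max lexx.
lra.
Qed.

Section levels.
Variable phi : R -> R.
Local Notation D := [set t : R | (a < t%:E)%E].
Hypotheses (convex_phi : convex_on D phi) (phi_noninc : nonincreasing_on D phi).
Hypothesis phi_cvg0 : phi t @[t --> +oo] --> (0 : R).

(** At a nonnegative level the truncation of [phi] is again a convex function
    vanishing at infinity. At a negative level it is a translate of [phi] by a
    constant, which has no gradient and increases the right-hand side. *)
Lemma composition_GDG_plus : GDG_plus E p composition_const (phi \o u).
Proof.
have [s [mphi phi0 bphi [wphi Lphi] ephi]] := convex_composition convex_phi phi_noninc phi_cvg0.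
split.
  split; last by exists (fun x => - s x *: G x).
  exact: Lploc_bounded.
move=> k; rewrite (_ : (fun x => _)^\+ = fun x => Num.max (phi (u x) - k) 0)//.
have [k0|k0] := leP 0 k.
  pose psi t := Num.max (phi t - k) 0.
  have cpsi : convex_on D psi by exact: max_convex_on.
  have npsi : nonincreasing_on D psi.
    move=> x y xD yD xy; by rewrite /psi ge_max !le_max lerD2r phi_noninc//= lexx orbT.
  have psi0 : psi t @[t --> +oo] --> (0 : R).
    have phin : `|phi t| @[t --> +oo] --> (0 : R).
      by rewrite -(normr0 R); exact: cvg_norm.
    apply: (squeeze_cvgr _ (cvg_cst (0 : R)) phin); apply: nearW => t.
    rewrite /psi le_max lexx orbT ge_max normr_ge0 andbT.
    by rewrite lerBlDr (le_trans (ler_norm _))// lerDl.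
  have [s' [_ psi_ge0 _ [wpsi _] epsi]] := convex_composition cpsi npsi psi0.
  exists (fun x => - s' x *: G x); first exact: wpsi.
  move=> y rho r rho0 rhor rE.
  apply: (le_trans (epsi y rho r rho0 rhor rE)).
  rewrite le_eqVlt; apply/orP; left; apply/eqP; congr (_ * _)%E.
  by apply: eq_integral => x _; rewrite ger0_norm//; exact: psi_ge0.
have E1 : (fun x => Num.max (phi (u x) - k) 0) = (fun x => phi (u x) - k).
  by apply/funext => x; apply/max_idPl; rewrite subr_ge0 (le_trans (ltW k0)).
rewrite E1; exists (fun x => - s x *: G x).
  have [L1 L2 id] := wphi; split; [|exact: L2|].
    apply: Lploc_bounded; [exact: ltr01|exact: measurable_funB|].
    move=> K cK KE; have [c Hc] := bphi K cK KE; exists (c + `|k|).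
    apply: filterS Hc => x /[apply] H.
    by apply: (le_trans (ler_normB _ _)); rewrite lerD2r.
  move=> f tf i; rewrite -(id f tf i).
  have [K [cK KE fK pfK]] := test_function_support i tf.
  have [c Hc] := bphi K cK KE.
  have mK : measurable K by exact: compact_measurable_rV.
  have [B _ fB] := test_function_bounded (test_function_partial i tf).
  have mf : measurable_fun K (partial i f).
    by apply: measurable_funTS; exact: (measurable_test_function (test_function_partial i tf)).
  have iphi := integrable_compact mphi L1 cK KE.
  have i1 : mu.-integrable K (EFin \o cst 1).
    have L0 : Lploc E 1 (cst 1).
      apply: Lploc_bounded; [exact: ltr01|exact: measurable_cst|].
      by move=> *; exists 1; apply: aeW => x _; rewrite normr1.
    exact: (integrable_compact (measurable_cst _) L0 cK KE).
  have iphif := integrable_mulb mK iphi mf (fun x _ => fB x).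
  have i1f := integrable_mulb mK i1 mf (fun x _ => fB x).
  have := integral_partial_test i tf.
  rewrite !(integral_support _ KE pfK) => I0.
  rewrite (_ : (fun x => _) = fun x => ((phi \o u) x * partial i f x)%:E +
      (- k)%:E * (cst 1 x * partial i f x)%:E)%E; last first.
    by apply/funext => x; rewrite -EFinM -EFinD; congr EFin; rewrite /=; ring.
  rewrite (integralD mK iphif); last exact: integrableZl.
  by rewrite (integralZl mK i1f) I0 mule0 adde0.
move=> y rho r rho0 rhor rE; apply: (le_trans (ephi y rho r rho0 rhor rE)).
apply: lee_wpmul2l.
  rewrite lee_fin mulr_ge0 ?powR_ge0// divr_ge0 ?powR_ge0//.
  exact: ltW composition_const_gt0.
have mpow (h : 'rV[R]_N -> R) : measurable_fun setT h ->
    measurable_fun (cube r y) (fun x => (h x `^ p)%:E).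
  move=> mh; apply: measurable_funTS; apply/measurable_EFinP.
  exact: (measurableT_comp (measurable_powR p)).
apply: ge0_le_integral => //.
- exact: measurable_cube.
- by move=> x _; rewrite lee_fin powR_ge0.
- exact: mpow.
- apply: (mpow (fun x => `|phi (u x) - k|)); apply: measurableT_comp => //.
  exact: measurable_funB.
move=> x _; rewrite lee_fin; apply: ge0_ler_powR; rewrite ?nnegrE ?(ltW p0) ?phi0//.
apply: le_trans (ler_norm _); rewrite lerDl oppr_ge0; exact: ltW.
Qed.

End levels.

End convex_composition.

(** * Borel representatives *)

Section ae_transfer.
Context {R : realType}.
Local Open Scope ereal_scope.
Import HBNNSimple.

Section integral.
Context d (T : measurableType d) (nu : {measure set T -> \bar R}).

Let le_sup_ae (f f' : T -> \bar R) : {ae nu, forall x, f x = f' x} ->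
  (forall x, 0 <= f x) -> (forall x, 0 <= f' x) ->
  \int[nu]_x f x <= \int[nu]_x f' x.
Proof.
move=> [A [mA A0 Asub]] f0 f'0.
rewrite (ge0_integralTE nu f0) (ge0_integralTE nu f'0).
apply: ub_ereal_sup => _ [h hf <-].
pose h' := proj_nnsfun h (measurableC mA).
have h'E x : h' x = (h x * \1_(~` A) x)%R by [].
have -> : sintegral nu h = sintegral nu h'.
  rewrite -!integralT_nnsfun; apply: ae_eq_integral => //.
  - by apply/measurable_EFinP; exact: measurable_funP.
  - by apply/measurable_EFinP; exact: measurable_funP.
  exists A; split=> // x /= /not_implyP[_ hx]; apply: contrapT => Ax; apply: hx.
  by rewrite -[RHS]/((h' x)%:E) h'E /= indicE mem_set ?mulr1.
apply: ereal_sup_ubound; exists h' => // x.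
rewrite h'E indicE; have [Ax|nAx] := pselect (A x).
  by rewrite memNset ?mulr0//; apply; exact: Ax.
rewrite mem_set// mulr1.
have -> : f' x = f x.
  by apply: contrapT => H; apply: nAx; apply: Asub => /= E; apply: H.
exact: hf.
Qed.

(** The integral is the difference of the suprema of the integrals of the simple
    functions below the positive and negative parts, so that it does not see
    null sets even for functions that are not measurable. *)
Lemma ae_integral (D : set T) (f f' : T -> \bar R) :
  {ae nu, forall x, D x -> f x = f' x} ->
  \int[nu]_(x in D) f x = \int[nu]_(x in D) f' x.
Proof.
move=> ff'; rewrite [LHS]integral_mkcond [RHS]integral_mkcond.
have ffD : {ae nu, forall x, (f \_ D) x = (f' \_ D) x}.
  apply: filterS ff' => x H; rewrite !patchE; case: ifPn => // /set_mem; exact: H.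
rewrite [LHS]integralE [RHS]integralE; congr (_ - _).
- apply/eqP; rewrite eq_le; apply/andP; split; apply: le_sup_ae => //.
  + by apply: filterS ffD => x H; rewrite !funeposE H.
  + by apply: filterS ffD => x H; rewrite !funeposE H.
- apply/eqP; rewrite eq_le; apply/andP; split; apply: le_sup_ae => //.
  + by apply: filterS ffD => x H; rewrite !funenegE H.
  + by apply: filterS ffD => x H; rewrite !funenegE H.
Qed.

End integral.

Context {N : nat}.
Local Notation mu := (@lebesgue_rV R N).
Implicit Types (E : set 'rV[R]_N) (w v : 'rV[R]_N -> R) (g : 'rV[R]_N -> 'rV[R]_N).

Lemma Lploc_ae E q w w' : {ae mu, forall x, E x -> w x = w' x} ->
  Lploc E q w -> Lploc E q w'.
Proof.
move=> ww' [[h mh wh] wq]; split.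
  by exists h => //; apply: filterS2 ww' wh => x H1 H2 Ex; rewrite -H1// H2.
move=> K cK KE; rewrite (ae_integral (f' := fun x => (`|w x| `^ q)%:E)); first exact: wq.
by apply: filterS ww' => x H Kx; rewrite H//; exact: KE.
Qed.

Lemma weak_gradient_ae E w w' g g' : {ae mu, forall x, E x -> w x = w' x} ->
  {ae mu, forall x, E x -> g x = g' x} ->
  weak_gradient E w g -> weak_gradient E w' g'.
Proof.
move=> ww' gg' [Lw Lg id]; split.
- exact: Lploc_ae Lw.
- move=> i; apply: Lploc_ae (Lg i).
  by apply: filterS gg' => x H Ex; rewrite H.
move=> f tf i.
rewrite (ae_integral (f' := fun x => (w x * partial i f x)%:E)); last first.
  by apply: filterS ww' => x H Ex; rewrite H.
rewrite [in RHS](ae_integral (f' := fun x => (g x ord0 i * f x)%:E)); first exact: id.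
by apply: filterS gg' => x H Ex; rewrite H.
Qed.

Lemma W1ploc_ae E p w w' : {ae mu, forall x, E x -> w x = w' x} ->
  W1ploc E p w -> W1ploc E p w'.
Proof.
move=> ww' [Lw [g wg Lg]]; split; first exact: Lploc_ae Lw.
by exists g; [apply: (weak_gradient_ae ww' _ wg); exact: aeW|exact: Lg].
Qed.

Lemma energy_inequality_ae E p c w w' : {ae mu, forall x, E x -> w x = w' x} ->
  energy_inequality E p c w -> energy_inequality E p c w'.
Proof.
move=> ww' [g wg eg]; exists g.
  by apply: (weak_gradient_ae ww' _ wg); exact: aeW.
move=> y rho r rho0 rhor rE.
rewrite [X in _ <= _ * X](ae_integral (f' := fun x => (`|w x| `^ p)%:E)); first exact: eg.
by apply: filterS ww' => x H Kx; rewrite H//; exact: rE.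
Qed.

Lemma GDG_plus_ae E p c w w' : {ae mu, forall x, E x -> w x = w' x} ->
  GDG_plus E p c w -> GDG_plus E p c w'.
Proof.
move=> ww' [Lw ew]; split; first exact: W1ploc_ae Lw.
move=> k; apply: energy_inequality_ae (ew k).
by apply: filterS ww' => x H Ex; rewrite /funrpos H.
Qed.

Lemma borel_extension E (h : 'rV[R]_N -> R) (b : R) : measurable E ->
  measurable_fun E h -> exists v, [/\ measurable_fun setT v,
    forall x, E x -> v x = h x & forall x, ~ E x -> v x = b].
Proof.
move=> mE mh; exists (fun x => if x \in E then h x else b); split.
- apply: measurable_fun_if => //.
  + by apply: (measurable_fun_bool true); rewrite setTI (_ : _ @^-1` _ = E)//;
      apply/seteqP; split => x /=; [move=> /set_mem|move=> /mem_set].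
  + apply: measurable_funS mh => // x [_ /=]; exact: set_mem.
- by move=> x Ex; rewrite mem_set.
- by move=> x nEx; rewrite memNset.
Qed.

Lemma borel_gradient E g : measurable E ->
  (forall i, lebesgue_measurable_fun E (fun x => g x ord0 i)) ->
  exists g', (forall i, measurable_fun setT (fun x => g' x ord0 i)) /\
    {ae mu, forall x, E x -> g x = g' x}.
Proof.
move=> mE gm.
have /choice[h hP] : forall i, exists h : 'rV[R]_N -> R, measurable_fun setT h /\
    {ae mu, forall x, E x -> g x ord0 i = h x}.
  move=> i; have [h0 mh0 gh] := gm i.
  have [h [mh hE _]] := borel_extension 0%R mE mh0; exists h; split=> //.
  by apply: filterS gh => x H Ex; rewrite hE// H.
exists (fun x => \row_i h i x)%R; split.
  by move=> i; under eq_fun do rewrite mxE; have [] := hP i.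
have : {ae mu, forall x, forall n, forall i : 'I_N, nat_of_ord i = n ->
    E x -> g x ord0 i = h i x}.
  apply: ae_foralln => n; have [nN|Nn] := ltnP n N.
    have [_] := hP (Ordinal nN); apply: filterS => x H i iE.
    by have -> : i = Ordinal nN by exact/val_inj.
  by apply: aeW => x i iE; exfalso; have := ltn_ord i; rewrite iE ltnNge Nn.
apply: filterS => x H Ex; apply/rowP => i; rewrite mxE; exact: (H i i erefl Ex).
Qed.

End ae_transfer.

Section de_giorgi.
Context {R : realType} {N : nat}.
Local Notation mu := (@lebesgue_rV R N).

(** Borel representatives of [u] and of the gradients of its truncations. *)
Lemma DG_minus_borel (E : set 'rV[R]_N) (p gamma : R) (u0 : 'rV[R]_N -> R) (a : \bar R) (b : R) :
  1 < p -> open E -> (a < b%:E)%E -> DG_minus E p gamma u0 ->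
  (forall x, E x -> (a < (u0 x)%:E)%E) ->
  exists (u : 'rV[R]_N -> R) (g : R -> 'rV[R]_N -> 'rV[R]_N) (G : 'rV[R]_N -> 'rV[R]_N),
  [/\ borel_DG E p gamma u g,
    (forall i, measurable_fun setT (fun x => G x ord0 i)) /\ weak_gradient E u G,
    forall i, Lploc E p (fun x => G x ord0 i),
    forall x, (a < (u x)%:E)%E &
    {ae mu, forall x, E x -> u x = u0 x}].
Proof.
move=> p1 oE ab [[Lu0 [G0 uG0 G0p]] e0] au0.
have p0 : 0 < p by rewrite (lt_trans ltr01).
have mE : measurable E by exact: open_measurable_rV.
have [[h mh u0h] Lu0p] := Lu0.
have [v [mv vE vb]] := borel_extension b mE mh.
(* a second modification, on a null set, makes the bound by [a] hold everywhere *)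
have mA : measurable [set x | (a < (v x)%:E)%E].
  rewrite (_ : [set x | _] = (EFin \o v) @^-1` [set z | (a < z)%E])//.
  rewrite -[X in measurable X]setTI.
  have mv' : measurable_fun setT (EFin \o v) by exact/measurable_EFinP.
  have := emeasurable_fun_o_infty measurableT mv' a.
  congr measurable; apply/seteqP; split => x /=; rewrite in_itv/= andbT => -[? ?]; split=> //.
have [u [mu_ uA ub]] := borel_extension b mA (measurable_funTS mv).
have au x : (a < (u x)%:E)%E.
  by have [Ax|nAx] := pselect (a < (v x)%:E)%E; [rewrite uA|rewrite ub].
have uu0 : {ae mu, forall x, E x -> u x = u0 x}.
  apply: filterS u0h => x H Ex.
  have vu0 : v x = u0 x by rewrite vE// H.
  by rewrite uA //= vu0; exact: au0.
have u0u : {ae mu, forall x, E x -> u0 x = u x} by apply: filterS uu0 => x H Ex; rewrite H.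
have [G [mG G0G]] := borel_gradient mE (fun i => (G0p i).1).
have uG : weak_gradient E u G by exact: weak_gradient_ae u0u G0G uG0.
have Gp i : Lploc E p (fun x => G x ord0 i).
  by apply: Lploc_ae (G0p i); apply: filterS G0G => x H Ex; rewrite H.
have below0 k : {ae mu, forall x, E x -> (fun x => u0 x - k)^\- x = below u k x}.
  by apply: filterS u0u => x H Ex; rewrite /below /funrneg /= H// opprB.
have /choice[g gP] : forall k, exists gk : 'rV[R]_N -> 'rV[R]_N,
    [/\ forall i, measurable_fun setT (fun x => gk x ord0 i),
     weak_gradient E (below u k) gk &
     forall y rho r, 0 < rho -> rho < r -> cube r y `<=` E ->
     (\int[mu]_(x in cube rho y) (euclidean_norm (gk x) `^ p)%:E <=
     (gamma / (r - rho) `^ p)%:E * \int[mu]_(x in cube r y) (below u k x `^ p)%:E)%E].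
  move=> k; have [g0 wg0 eg0] := e0 k.
  have [_ Lg0 _] := wg0.
  have [gk [mgk g0gk]] := borel_gradient mE (fun i => (Lg0 i).1).
  exists gk; split; [exact: mgk|exact: (weak_gradient_ae (below0 k) g0gk wg0)|].
  move=> y rho r rho0 rhor rE.
  rewrite (ae_integral (f' := fun x => (euclidean_norm (g0 x) `^ p)%:E)); last first.
    apply: filterS g0gk => x H xy; rewrite H//; apply: rE.
    by apply: sub_cube xy; exact: ltW.
  rewrite [X in (_ <= _ * X)%E](ae_integral
    (f' := fun x => (`|(fun x => u0 x - k)^\- x| `^ p)%:E)); first exact: eg0.
  apply: filterS (below0 k) => x H xy; rewrite H; last exact: rE.
  by rewrite ger0_norm// below_ge0.
have Lu : Lploc E p u by exact: Lploc_ae u0u Lu0.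
exists u, g, G; split; [|by split; [exact: mG|exact: uG]|exact: Gp|exact: au|exact: uu0].
split; [exact: mu_| | | |].
- by move=> k i; have [] := gP k.
- move=> k; split.
    exists (below u k); last exact: aeW.
    by apply: measurable_funTS; exact: measurable_below.
  move=> K cK KE; have mK : measurable K by exact: compact_measurable_rV.
  have mpow (h' : 'rV[R]_N -> R) : measurable_fun setT h' ->
      measurable_fun K (fun x => (`|h' x| `^ p)%:E).
    move=> mh'; apply: measurable_funTS; apply/measurable_EFinP.
    by apply: (measurableT_comp (measurable_powR p)); exact: measurableT_comp.
  apply: (@le_lt_trans _ _ (\int[mu]_(x in K)
      ((2 `^ p)%:E * ((`|u x| `^ p)%:E + (`|k| `^ p)%:E)))%E).
    apply: ge0_le_integral => //.
    - by apply: mpow; exact: measurable_below.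
    - apply: measurable_funeM; apply: emeasurable_funD; first exact: mpow.
      exact: measurable_cst.
    move=> x _; rewrite -EFinD -EFinM lee_fin.
    have m0 : 0 <= Num.max `|u x| `|k| by rewrite le_max normr_ge0.
    apply: (@le_trans _ _ ((2 * Num.max `|u x| `|k|) `^ p)).
      apply: ge0_ler_powR; rewrite ?nnegrE ?(ltW p0)// ?mulr_ge0//.
      rewrite ger0_norm ?below_ge0// /below ge_max mulr_ge0// andbT.
      rewrite mulr2n mulrDl mul1r; apply: (le_trans (ler_norm _)).
      apply: (le_trans (ler_normB _ _)); rewrite lerD// le_max lexx ?orbT//.
    rewrite powRM// ler_wpM2l ?powR_ge0//.
    by case: (leP `|u x| `|k|) => _; rewrite ?lerDl ?lerDr powR_ge0.
  have [_ LuK] := Lu.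
  have m1 : measurable_fun K (fun x => (`|u x| `^ p)%:E + (`|k| `^ p)%:E)%E.
    by apply: emeasurable_funD; [exact: mpow|exact: measurable_cst].
  have n1 x : K x -> (0 <= (`|u x| `^ p)%:E + (`|k| `^ p)%:E)%E.
    by move=> _; rewrite -EFinD lee_fin addr_ge0 ?powR_ge0.
  have n2 : (0 <= (2 `^ p)%:E)%E by rewrite lee_fin powR_ge0.
  rewrite (ge0_integralZl mu mK m1 n1 n2); apply: lte_mul_pinfty => //.
  rewrite ge0_integralD//; last exact: mpow.
  apply: lte_add_pinfty; first exact: LuK.
  rewrite integral_cst//; apply: lte_mul_pinfty => //.
  exact: compact_measure_lty.
- by move=> k; have [] := gP k.
- by move=> k; have [] := gP k.
Qed.

End de_giorgi.

(** * Reflection, and the theorem *)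

Section opposite.
Context {R : realType} {N : nat}.
Local Notation mu := (@lebesgue_rV R N).
Implicit Types (E : set 'rV[R]_N) (w : 'rV[R]_N -> R) (g : 'rV[R]_N -> 'rV[R]_N).

Lemma Lploc_opp E q w : Lploc E q w -> Lploc E q (fun x => - w x).
Proof.
move=> [[h mh wh] wq]; split.
  exists (fun x => - h x); first exact: measurableT_comp.
  by apply: filterS wh => x H Ex; rewrite H.
by move=> K cK KE; under eq_integral do rewrite normrN; exact: wq.
Qed.

Lemma Lploc_opp_coord E q g i : Lploc E q (fun x => g x ord0 i) ->
  Lploc E q (fun x => (- g x) ord0 i).
Proof.
move=> /Lploc_opp; congr (Lploc _ _ _).
by apply/funext => x; rewrite mxE.
Qed.

Let weak_gradient_opp_borel E w g : measurable_fun setT w ->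
  (forall i, measurable_fun setT (fun x => g x ord0 i)) ->
  weak_gradient E w g -> weak_gradient E (fun x => - w x) (fun x => - g x).
Proof.
move=> mw mg [Lw Lg id]; split.
- exact: Lploc_opp.
- by move=> i; exact: Lploc_opp_coord.
move=> f tf i; have [K [cK KE fK pfK]] := test_function_support i tf.
have mK : measurable K by exact: compact_measurable_rV.
have opp (h f' : 'rV[R]_N -> R) : measurable_fun setT h -> Lploc E 1 h ->
    test_function E f' -> (forall x, ~ K x -> f' x = 0) ->
    (\int[mu]_(x in E) (- h x * f' x)%:E = - \int[mu]_(x in E) (h x * f' x)%:E)%E.
  move=> mh Lh tf' f'K; rewrite !(integral_support _ KE f'K).
  have [C _ fC] := test_function_bounded tf'.
  have mf' : measurable_fun K f'.
    by apply: measurable_funTS; exact: (measurable_test_function tf').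
  have ihf := integrable_mulb mK (integrable_compact mh Lh cK KE) mf' (fun x _ => fC x).
  rewrite -mulN1e -EFinN -(integralZl mK ihf); apply: eq_integral => x _.
  by rewrite -EFinM mulN1r mulNr.
rewrite (opp w (partial i f) mw Lw (test_function_partial i tf) pfK) (id f tf i).
rewrite -(opp (fun x => g x ord0 i) f (mg i) (Lg i) tf fK).
by congr (- _)%E; apply: eq_integral => x _; rewrite mxE.
Qed.

(** An integral over [E] changes sign with its integrand when it is finite, which
    Borel representatives ensure. *)
Lemma weak_gradient_opp E w g : open E ->
  weak_gradient E w g -> weak_gradient E (fun x => - w x) (fun x => - g x).
Proof.
move=> oE wg; have mE : measurable E by exact: open_measurable_rV.
have [[[h mh wh] _] Lg _] := wg.
have [w' [mw' w'E _]] := borel_extension 0 mE mh.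
have [g' [mg' gg']] := borel_gradient mE (fun i => (Lg i).1).
have ww' : {ae mu, forall x, E x -> w x = w' x}.
  by apply: filterS wh => x H Ex; rewrite H// w'E.
have := weak_gradient_opp_borel mw' mg' (weak_gradient_ae ww' gg' wg).
apply: weak_gradient_ae.
- by apply: filterS ww' => x H Ex; rewrite H.
- by apply: filterS gg' => x H Ex; rewrite H.
Qed.

Lemma W1ploc_opp E p w : open E -> W1ploc E p w -> W1ploc E p (fun x => - w x).
Proof.
move=> oE [Lw [g wg Lg]]; split; first exact: Lploc_opp.
exists (fun x => - g x); first exact: weak_gradient_opp.
by move=> i; exact: Lploc_opp_coord.
Qed.

Lemma DG_minus_opp E p gamma u : open E -> DG_plus E p gamma u ->
  DG_minus E p gamma (fun x => - u x).
Proof.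
move=> oE [Wu eu]; split; first exact: W1ploc_opp.
move=> k; have := eu (- k); congr (energy_inequality _ _ _ _).
by apply/funext => x; rewrite /funrpos /funrneg /= opprD !opprK.
Qed.

Lemma GDG_minus_opp E p gamma u : open E -> GDG_plus E p gamma (fun x => - u x) ->
  GDG_minus E p gamma u.
Proof.
move=> oE [Wu eu]; split.
  have := W1ploc_opp oE Wu; congr (W1ploc _ _ _).
  by apply/funext => x; rewrite opprK.
move=> k; have := eu (- k); congr (energy_inequality _ _ _ _).
by apply/funext => x; rewrite /funrpos /funrneg /= opprD.
Qed.

End opposite.

Section reflection.
Context {R : realType}.
Variables (a : \bar R) (psi : R -> R).
Local Notation D := [set t : R | (t%:E < a)%E].
Local Notation D' := [set t : R | (- a < t%:E)%E].

Let mem_opp t : t \in D' -> - t \in D.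
Proof. by rewrite !inE /= EFinN lteNl. Qed.

Lemma convex_on_reflection : concave_on D psi -> convex_on D' (fun t => - psi (- t)).
Proof.
move=> cpsi l x y xD yD.
have H : - psi (l%:num * - x + (1 - l%:num) * - y) <=
    l%:num * - psi (- x) + (1 - l%:num) * - psi (- y).
  exact: (cpsi l (- x) (- y) (mem_opp xD) (mem_opp yD)).
suff : - psi (- (l%:num * x + (1 - l%:num) * y)) <=
    l%:num * - psi (- x) + (1 - l%:num) * - psi (- y) by [].
by move: H; rewrite !mulrN -opprD.
Qed.

Lemma nonincreasing_on_reflection : nonincreasing_on D psi ->
  nonincreasing_on D' (fun t => - psi (- t)).
Proof. by move=> npsi x y xD yD xy; rewrite lerN2 npsi ?lerN2// mem_opp. Qed.

Lemma cvg_reflection : psi t @[t --> -oo] --> (0 : R) ->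
  - psi (- t) @[t --> +oo] --> (0 : R).
Proof.
move=> psi0; rewrite -oppr0; apply: cvgN.
exact: (cvgNy_compNP _ _).1 psi0.
Qed.

End reflection.

(** The constant is fixed by [p], [gamma] and the dimension, before the data. *)
Lemma convex_GDG_plus {R : realType} {N : nat} (p gamma : R) : 1 < p -> 0 < gamma ->
  exists2 gammabar : R, 0 < gammabar &
    forall (E : set 'rV[R]_N) (a : \bar R) (phi : R -> R) (u : 'rV[R]_N -> R),
      open E -> (a < +oo)%E ->
      convex_on [set t : R | (a < t%:E)%E] phi ->
      nonincreasing_on [set t : R | (a < t%:E)%E] phi ->
      phi t @[t --> +oo] --> (0 : R) ->
      DG_minus E p gamma u -> (forall x, E x -> (a < (u x)%:E)%E) ->
      GDG_plus E p gammabar (phi \o u).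
Proof.
move=> p1 gamma0; have [eps [eps0 eps8 epsC]] := @step_constant R N p gamma p1 gamma0.
exists (@composition_const R N p gamma eps); first exact: composition_const_gt0.
move=> E a phi u0 oE aoo cphi nphi phi0 DGu au0.
have [b ab] : exists b : R, (a < b%:E)%E.
  move: aoo {cphi nphi au0}; case: a => [c| |]//= _.
  - by exists (c + 1); rewrite lte_fin ltrDl.
  - by exists 0; exact: ltNyr.
have [u [g [G [DGu' [mG uG] GLp au uu0]]]] := DG_minus_borel p1 oE ab DGu au0.
have := composition_GDG_plus p1 gamma0 eps0 eps8 epsC oE DGu' mG uG GLp au cphi nphi phi0.
by apply: GDG_plus_ae; apply: filterS uu0 => x H Ex; rewrite /= H.
Qed.

Theorem lemma2p2 (R : realType) (N : nat) (p gamma : R)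
    (hN : (0 < N)%N) (hp : 1 < p) (hgamma : 0 < gamma) :
  (exists gammabar : R, 0 < gammabar /\
    forall (E : set 'rV[R]_N) (a : \bar R) (phi dphi : R -> R)
      (u : 'rV[R]_N -> R),
      open E ->
      (a < +oo)%E ->
      convex_on [set t : R | (a < t%:E)%E] phi ->
      nonincreasing_on [set t : R | (a < t%:E)%E] phi ->
      (forall t : R, (a < t%:E)%E -> one_sided_derivative phi t (dphi t)) ->
      phi t @[t --> +oo] --> (0 : R) ->
      t * dphi t @[t --> +oo] --> (0 : R) ->
      DG_minus E p gamma u ->
      (forall x, E x -> (a < (u x)%:E)%E) ->
      GDG_plus E p gammabar (phi \o u)) /\
  (exists gammabar : R, 0 < gammabar /\
    forall (E : set 'rV[R]_N) (a : \bar R) (psi dpsi : R -> R)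
      (u : 'rV[R]_N -> R),
      open E ->
      (-oo < a)%E ->
      concave_on [set t : R | (t%:E < a)%E] psi ->
      nonincreasing_on [set t : R | (t%:E < a)%E] psi ->
      (forall t : R, (t%:E < a)%E -> one_sided_derivative psi t (dpsi t)) ->
      psi t @[t --> -oo] --> (0 : R) ->
      t * dpsi t @[t --> -oo] --> (0 : R) ->
      DG_plus E p gamma u ->
      (forall x, E x -> ((u x)%:E < a)%E) ->
      GDG_minus E p gammabar (psi \o u)).
Proof.
have [gammabar gammabar0 H] := @convex_GDG_plus R N p gamma hp hgamma.
split; exists gammabar; (split; first exact: gammabar0).
  move=> E a phi dphi u oE aoo cphi nphi _ phi0 _ DGu au.
  exact: (H E a phi u oE aoo cphi nphi phi0 DGu au).
move=> E a psi dpsi u oE aoo cpsi npsi _ psi0 _ DGu ua.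
apply: GDG_minus_opp; first exact: oE.
have -> : (fun x => - (psi \o u) x) = (fun t => - psi (- t)) \o (fun x => - u x).
  by apply/funext => x; rewrite /= opprK.
apply: (H E (- a)%E (fun t => - psi (- t)) (fun x => - u x) oE).
- by rewrite lteNl.
- exact: convex_on_reflection.
- exact: nonincreasing_on_reflection.
- exact: cvg_reflection.
- exact: DG_minus_opp.
- by move=> x Ex; rewrite EFinN lteN2; exact: ua.
Qed.
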